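(* If $f\in L^1(\Omega)$, then $T_Zf$ satisfies $L(T_Zf)=f$ in $\Omega$.
   Context: Setting. $C^{1+\epsilon}$ denotes $C^1$ with first derivatives Hölder continuous of exponent $\epsilon$, for some $\epsilon>0$. $\tilde\Omega\subset\mathbb{R}^2$ is open, $L=A(x,y)\partial/\partial x+B(x,y)\partial/\partial y$ is a complex vector field on $\tilde\Omega$ with $\mathbb{C}$-valued Hölder continuous coefficients, $|A|+|B|>0$, and $\Omega$ is a relatively compact open set, $\overline\Omega\subset\tilde\Omega$, with $\partial\Omega$ piecewise of class $C^1$. The characteristic set is $\Sigma=\{\mathsf p\in\overline\Omega:\ \Im(A\overline B)(\mathsf p)=0\}$. It is assumed that: (i) $L$ is hypocomplex in $\overline\Omega$: for every $\mathsf p\in\overline\Omega$ there are an open set $\mathcal U\ni\mathsf p$ and a $C^{1+\epsilon}$ function $Z:\mathcal U\to\mathbb{C}$ (a first integral) with $dZ\neq0$, $LZ=0$, and $Z:\mathcal U\to Z(\mathcal U)$ a homeomorphism; (ii) $\Sigma$ is a $C^{1+\epsilon}$ curve nontangent to $L$ (i.e. $L_{\mathsf p}\notin\mathbb{C}\otimes T_{\mathsf p}\Sigma$ for $\mathsf p\in\Sigma$); (iii) for every $\mathsf p\in\Sigma$ there is an open set $\mathcal U\ni\mathsf p$ in which $\Sigma\cap\mathcal U$ is given by a $C^{1+\epsilon}$ defining function $\rho$ and $\Im(A\overline B)(x,y)=|\rho(x,y)|^{\sigma_{\mathsf p}}g(x,y)$ for some $\sigma_{\mathsf p}>0$ and some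 continuous $g$ nowhere zero in $\mathcal U$. $\Sigma$ has finitely many connected components, and the exponent in (iii) is constant along each of them. $Z:\overline\Omega\to Z(\overline\Omega)\subset\mathbb{C}$ is a fixed global first integral of $L$: it is of class $C^{1+\epsilon}$, a homeomorphism onto its image, with $LZ=0$ and $dZ\neq0$. It is assumed that $L=Z_x\,\partial/\partial y-Z_y\,\partial/\partial x$. For $f\in L^1(\Omega)$, $$T_Zf(x,y)=\frac1{2\pi i}\int_\Omega\frac{f(\xi,\eta)}{Z(\xi,\eta)-Z(x,y)}\,d\xi d\eta .$$ The equation $Lu=f$ in $\Omega$ is understood in the weak sense: $-\int_\Omega u\,L\phi\,dxdy=\int_\Omega f\phi\,dxdy$ for all $\phi\in C_0^\infty(\Omega)$.
   Formalization: It is additionally assumed that Z preserves orientation (its Jacobian is nonnegative in Ω, i.e. Im(A·conj B) ≤ 0); otherwise the claim fails by a sign, e.g. Z = x − iy on a disc gives L(T_Z f) = −f. *)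

(* Defs.v *)
From HB Require Import structures.
From mathcomp Require Import all_boot all_order all_algebra.
From mathcomp Require Import all_classical all_reals all_analysis.
From mathcomp Require Import complex.
Set Implicit Arguments.
Unset Strict Implicit.
Unset Printing Implicit Defensive.
Import Order.TTheory GRing.Theory Num.Theory.
Import numFieldNormedType.Exports.
Local Open Scope classical_set_scope.
Local Open Scope ring_scope.
Local Open Scope complex_scope.

Section Plane.
Context {R : realType}.
Local Notation plane := (R * R)%type.
Implicit Types (D U V S : set plane) (f rho : plane -> R) (h Z A B : plane -> R[i]).

Local Notation ex := ((1, 0) : plane).
Local Notation ey := ((0, 1) : plane).

(* R[i] carries no topology over R in the library: limits, derivatives and
   integrals of complex-valued functions are taken on real and imaginary
   parts, and C is identified with the plane by C_to_plane. *)
Definition C_to_plane (z : R[i]) : plane := (complex.Re z, complex.Im z).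
Definition re_part h : plane -> R := fun p => complex.Re (h p).
Definition im_part h : plane -> R := fun p => complex.Im (h p).

Definition dx f : plane -> R := fun p => 'D_ex f p.
Definition dy f : plane -> R := fun p => 'D_ey f p.
Definition cdx h : plane -> R[i] := fun p => dx (re_part h) p +i* dx (im_part h) p.
Definition cdy h : plane -> R[i] := fun p => dy (re_part h) p +i* dy (im_part h) p.

(* The norm of R * R is the sup norm, equivalent to the Euclidean one. *)
Definition hoelder_on (eps : R) S f : Prop :=
  exists C : R, forall p q, S p -> S q -> `|f p - f q| <= C * `|p - q| `^ eps.

Definition hoelder_onC (eps : R) S h : Prop :=
  hoelder_on eps S (re_part h) /\ hoelder_on eps S (im_part h).

Definition C1_hoelder (eps : R) U f : Prop :=
  (forall p, U p -> derivable f p ex /\ derivable f p ey) /\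
  hoelder_on eps U (dx f) /\ hoelder_on eps U (dy f).

Definition C1_plus U f : Prop := exists2 eps : R, 0 < eps & C1_hoelder eps U f.

Definition C1_plusC U h : Prop :=
  exists2 eps : R, 0 < eps &
    C1_hoelder eps U (re_part h) /\ C1_hoelder eps U (im_part h).

(* Class C^{1+eps} on the closure of an open set D: f is continuous on the
   closure, C^1 in D, and fx, fy are the (unique) continuous extensions to the
   closure of its partial derivatives, Hoelder continuous there. *)
Definition C1_hoelder_closure (eps : R) D f (fx fy : plane -> R) : Prop :=
  {within closure D, continuous f} /\
  (forall p, D p -> is_derive p ex f (fx p) /\ is_derive p ey f (fy p)) /\
  hoelder_on eps (closure D) fx /\ hoelder_on eps (closure D) fy.

Definition C1_plus_closureC D h (hx hy : plane -> R[i]) : Prop :=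
  exists2 eps : R, 0 < eps &
    C1_hoelder_closure eps D (re_part h) (re_part hx) (re_part hy) /\
    C1_hoelder_closure eps D (im_part h) (im_part hx) (im_part hy).

(* The Jacobian determinant of (Re Z, Im Z) is nonnegative; hx, hy are the
   partial derivatives of Z.  Without this, L (T_Z f) = f fails by a sign: for
   Z = x - iy, L = Z_x ∂/∂y - Z_y ∂/∂x = ∂/∂y + i ∂/∂x, one gets
   L (T_Z f) = - f. *)
Definition orientation_preserving_on S (hx hy : plane -> R[i]) : Prop :=
  forall p, S p ->
    0 <= re_part hx p * im_part hy p - im_part hx p * re_part hy p.

Definition homeomorphism_onto_image S h : Prop :=
  {within S, continuous (C_to_plane \o h)} /\
  exists g : plane -> plane,
    (forall p, S p -> g (C_to_plane (h p)) = p) /\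
    {within (C_to_plane \o h) @` S, continuous g}.

(* ∂D is a finite union of simple regular C^1 arcs, parametrized by [0, 1],
   any two of which can meet only at endpoints. *)
Definition C1_arc (gamma gamma' : R -> plane) : Prop :=
  {within `[0, 1], continuous gamma} /\
  (forall t : R, t \in `]0, 1[ -> is_derive t 1 gamma (gamma' t)) /\
  {within `[0, 1], continuous gamma'} /\
  (forall t : R, t \in `[0, 1] -> gamma' t != 0) /\
  {in `[0, 1] : interval R &, injective gamma}.

Definition piecewise_C1_boundary D : Prop :=
  exists (n : nat) (gamma gamma' : 'I_n -> R -> plane),
    (forall i, C1_arc (gamma i) (gamma' i)) /\
    closure D `\` interior D = \bigcup_(i in [set: 'I_n]) (gamma i @` `[0, 1]) /\
    (forall i j (s t : R), i != j -> s \in `[0, 1] -> t \in `[0, 1] ->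
       gamma i s = gamma j t -> (s = 0 \/ s = 1) /\ (t = 0 \/ t = 1)).

(* L = A ∂/∂x + B ∂/∂y *)
Definition vfield A B h : plane -> R[i] :=
  fun p => A p * cdx h p + B p * cdy h p.

Definition char_set D A B : set plane :=
  [set p | closure D p /\ complex.Im (A p * (B p)^*) = 0].

Definition local_first_integral U A B Z : Prop :=
  C1_plusC U Z /\
  (forall p, U p -> (cdx Z p, cdy Z p) != (0, 0)) /\
  (forall p, U p -> vfield A B Z p = 0) /\
  homeomorphism_onto_image U Z.

Definition hypocomplex_on V S A B : Prop :=
  forall p, S p -> exists U Z,
    [/\ open U, U p, U `<=` V & local_first_integral U A B Z].

(* S is a subset of a closed set K; at boundary points of K the zero set of
   rho may leave K, hence the restriction to K. *)
Definition defining_function K U S rho : Prop :=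
  [/\ C1_plus U rho,
      S `&` U = [set p | K p /\ U p /\ rho p = 0] &
      forall p, S p -> U p -> (dx rho p, dy rho p) != (0, 0)].

Definition tangent_line rho (p : plane) : set plane :=
  [set v | dx rho p * v.1 + dy rho p * v.2 = 0].

(* C ⊗ E = E + iE, for a real subspace E of the plane *)
Definition complexification (E : set plane) : set (R[i] * R[i]) :=
  [set w | E (complex.Re w.1, complex.Re w.2) /\ E (complex.Im w.1, complex.Im w.2)].

Definition nontangent_curve V K S A B : Prop :=
  forall p, S p -> exists U rho,
    [/\ open U, U p, U `<=` V, defining_function K U S rho &
        ~ complexification (tangent_line rho p) (A p, B p)].

(* sigma p is the order of vanishing of Im (A conj B) at p, constant along
   each connected component of S. *)
Definition finite_order_along V K S A B : Prop :=
  exists sigma : plane -> R,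
    (forall p, S p -> 0 < sigma p /\ exists U rho (g : plane -> R),
       [/\ open U, U p, U `<=` V, defining_function K U S rho &
           {within U, continuous g} /\
           (forall q, U q -> g q != 0) /\
           (forall q, U q ->
              complex.Im (A q * (B q)^*) = `|rho q| `^ sigma p * g q)]) /\
    (forall p q, S p -> connected_component S p q -> sigma p = sigma q).

Definition finitely_many_components S : Prop :=
  finite_set [set connected_component S p | p in S].

Fixpoint Cn (n : nat) f : Prop :=
  continuous f /\
  if n is m.+1 then
    (forall p, derivable f p ex /\ derivable f p ey) /\ Cn m (dx f) /\ Cn m (dy f)
  else True.

Definition test_function D h : Prop :=
  (forall n, Cn n (re_part h) /\ Cn n (im_part h)) /\
  compact (closure [set p | h p != 0]) /\
  closure [set p | h p != 0] `<=` D.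

Local Notation leb2 := (@lebesgue_measure R \x @lebesgue_measure R)%E.

Definition integrableC D h : Prop :=
  leb2.-integrable D (EFin \o re_part h) /\ leb2.-integrable D (EFin \o im_part h).

Definition integralC D h : R[i] :=
  (\int[leb2]_(p in D) re_part h p) +i* (\int[leb2]_(p in D) im_part h p).

Definition locally_integrableC D h : Prop :=
  forall K : set plane, compact K -> K `<=` D -> integrableC K h.

(* L u = f in D in the weak sense *)
Definition weak_solution D A B (u f : plane -> R[i]) : Prop :=
  locally_integrableC D u /\
  forall phi, test_function D phi ->
    - integralC D (fun p => u p * vfield A B phi p) =
    integralC D (fun p => f p * phi p).

Definition cauchy_integrand Z (f : plane -> R[i]) (p : plane) : plane -> R[i] :=
  fun q => f q / (Z q - Z p).

Definition T_op Z D (f : plane -> R[i]) : plane -> R[i] :=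
  fun p => (2 * (pi : R)%:C * 'i%C)^-1 * integralC D (cauchy_integrand Z f p).

(* T_op Z D f p is an absolutely convergent integral for a.e. p in D. *)
Definition T_op_defined_ae Z D (f : plane -> R[i]) : Prop :=
  {ae leb2, forall p, D p -> integrableC D (cauchy_integrand Z f p)}.

End Plane.

(* Main.v *)
Require Import Defs.
From HB Require Import structures.
From mathcomp Require Import all_boot all_order all_algebra.
From mathcomp Require Import all_classical all_reals all_analysis.
From mathcomp Require Import measurable_realfun complex.
From mathcomp Require Import ring lra.

(** Write [Z = u + i v], [{a, b} = a_x b_y - a_y b_x] and [J = {u, v}], which is
    nonnegative on [Omega]. The normalization of [L] means that
    [L phi = {Z, phi}], and the characteristic set is the zero set of [J].

    The kernel [1 / (Z p - Z q)] is integrable in [p] near each point, uniformly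
    in [q] ([kernel_bounded_compact]). Where [J > 0] this is the planar bound of
    a local diffeomorphism. At a point where [J = 0], let [w] define the
    characteristic set and be transverse to [L]; up to replacing [Z] by [- i Z]
    and exchanging the coordinates, [{u, w}] and [u_x] do not vanish. On the
    level curves of [u], which are graphs over the [y]-axis, [w] grows linearly
    and [v] has derivative [J / u_x], while [J] is at least a multiple of
    [|w|^n] for some integer [n], its order of vanishing being finite. Hence
    [|Z p - Z q|] dominates [|u p - u q| + |p_y - q_y|^(n + 1)]
    ([level_estimate]), whose inverse is integrable, by Young's inequality and
    integration first in [x], then in [y] ([plane_singular_bound]). By Tonelli's
    theorem [T_Z f] is then given by an absolutely convergent integral almost
    everywhere, and is locally integrable.

    By Fubini's theorem ([fubini_cauchy]) the weak equation reduces to the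
    identity: the integral in [p] of [L phi p / (Z p - Z q)] equals
    [2 i pi phi q] for almost every [q]. The set [J = 0] is null, since the zero
    set of [w] locally meets each horizontal, or each vertical, line in at most
    one point ([null_zero_set]), so [q] can be taken with [J q > 0]. The function
    [F z = (1 - exp (- l |z|^2)) / z] is Lipschitz, with derivative
    [l exp (- l |z|^2)] with respect to the conjugate variable, and the form
    [dZ] is closed in the weak sense although [Z] has only one derivative: for
    difference quotients the identity is translation invariance of the integral
    ([discrete_curl], [curl_free]). Pairing [dZ] with [phi F (Z - Z q)] gives
    the integral of [F (Z - Z q) L phi] as that of
    [2 i phi J l exp (- l |Z - Z q|^2)] ([regularized_identity]). As [l] goes to
    infinity the former tends to the integral of [L phi / (Z - Z q)] by dominated
    convergence, and the latter to [2 i pi phi q] by the substitution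
    [p = q + s / sqrt l] and a Gaussian integral ([blowup_limit]). *)

Set Implicit Arguments.
Unset Strict Implicit.
Unset Printing Implicit Defensive.
Import Order.TTheory GRing.Theory Num.Theory.
Import numFieldNormedType.Exports.
Local Open Scope classical_set_scope.
Local Open Scope ring_scope.

(** * Squares, balls and affine maps of the plane *)

Section PlaneMeasure.
Context {R : realType}.
Local Notation leb := (@lebesgue_measure R).
Local Notation leb2 := (@lebesgue_measure R \x @lebesgue_measure R)%E.
Local Notation pushm :=
  measure_function_pushforward__canonical__measure_function_Measure.
Implicit Types (p q c : R * R) (U : set (R * R)).

(** The closed ball for the sup norm; it is empty when [r < 0]. *)
Definition closed_square (c : R * R) (r : R) : set (R * R) :=
  `[c.1 - r, c.1 + r]%classic `*` `[c.2 - r, c.2 + r]%classic.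

Lemma closed_squareP c r p :
  closed_square c r p <-> (`|p.1 - c.1| <= r) /\ (`|p.2 - c.2| <= r).
Proof.
rewrite /closed_square /= !in_itv /= !ler_norml.
by split=> -[/andP[? ?] /andP[? ?]]; split; apply/andP; split; lra.
Qed.

Lemma prod_ltP p q (e : R) :
  `|p - q| < e <-> (`|p.1 - q.1| < e) /\ (`|p.2 - q.2| < e).
Proof. by rewrite prod_normE /= gt_max; split=> [/andP[]//|[-> ->]]. Qed.

Lemma prod_leP p q (e : R) :
  `|p - q| <= e <-> (`|p.1 - q.1| <= e) /\ (`|p.2 - q.2| <= e).
Proof. by rewrite prod_normE /= ge_max; split=> [/andP[]//|[-> ->]]. Qed.

Lemma closed_square_normE c r : closed_square c r = [set p | `|p - c| <= r].
Proof. by apply/seteqP; split=> p /=; rewrite closed_squareP prod_leP. Qed.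

Lemma open_ballP U : open U <->
  (forall p, U p -> exists2 e : R, 0 < e & forall q, `|q - p| < e -> U q).
Proof.
split=> [oU p Up|H].
  have /nbhs_ballP[e e0 eU] : nbhs p U by exact: open_nbhs_nbhs.
  exists e => // q qp; apply: eU.
  by rewrite ball_prod_normE /= distrC.
rewrite openE => p /H[e e0 He]; apply/nbhs_ballP; exists e => // q.
by rewrite ball_prod_normE /ball_ /= distrC => /He.
Qed.

Lemma open_norm_ball p (r : R) : open [set q : R * R | `|q - p| < r].
Proof.
apply/open_ballP => q /= qr; exists (r - `|q - p|); first by rewrite subr_gt0.
by move=> t tq; have := ler_distD q t p; lra.
Qed.

Lemma cvg_plane_epsP (f : R * R -> R) p : {for p, continuous f} <->
  (forall e : R, 0 < e -> exists2 d : R, 0 < d &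
     forall q, `|q - p| < d -> `|f q - f p| < e).
Proof.
split=> [/cvgrPdist_lt cf e e0|H].
  have /nbhs_ballP[d d0 Hd] : nbhs p [set q | `|f p - f q| < e] by exact: cf.
  exists d => // q qp.
  rewrite distrC; apply: Hd.
  by rewrite ball_prod_normE /= distrC.
apply/cvgrPdist_lt => e /H[d d0 Hd].
suff : nbhs p [set q | `|f p - f q| < e] by [].
apply/nbhs_ballP; exists d => // q.
by rewrite ball_prod_normE /ball_ /= distrC => /Hd; rewrite distrC.
Qed.

Lemma measurable_closed_square c r : measurable (closed_square c r).
Proof. by apply: measurableX; exact: measurable_itv. Qed.

Lemma compact_closed_square c r : compact (closed_square c r).
Proof. by apply: compact_setX; exact: segment_compact. Qed.

Lemma open_rat_square U p : open U -> U p -> exists a b r : rat,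
  closed_square (ratr a, ratr b) (ratr r) p /\
  closed_square (ratr a, ratr b) (ratr r) `<=` U.
Proof.
move=> /open_ballP/(_ p) H /H[e e0 He].
have [r /[!in_itv]/= /andP[r0 re]] : exists r : rat, ratr r \in `]0, (e / 2)[.
  by apply: rat_in_itvoo; rewrite divr_gt0.
have [a /[!in_itv]/= /andP[a1 a2]] :
    exists a : rat, ratr a \in `](p.1 - ratr r), (p.1 + ratr r)[.
  by apply: rat_in_itvoo; lra.
have [b /[!in_itv]/= /andP[b1 b2]] :
    exists b : rat, ratr b \in `](p.2 - ratr r), (p.2 + ratr r)[.
  by apply: rat_in_itvoo; lra.
exists a, b, r; split.
  by apply/closed_squareP; rewrite !ler_norml /=; split; apply/andP; split; lra.
move=> q /closed_squareP; rewrite !ler_norml /= => -[/andP[? ?] /andP[? ?]].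
by apply: He; apply/prod_ltP; rewrite !ltr_norml; split; apply/andP; split; lra.
Qed.

Lemma open_bigcup_square U : open U -> exists (c : nat -> R * R) (r : nat -> R),
  U = \bigcup_n closed_square (c n) (r n).
Proof.
move=> oU.
pose P (t : rat * rat * rat) := closed_square (ratr t.1.1, ratr t.1.2) (ratr t.2) `<=` U.
pose T n := odflt (0, 0, 0) (unpickle n : option (rat * rat * rat)).
exists (fun n => (ratr (T n).1.1, ratr (T n).1.2)).
(* radius [- 1] empties the squares that are not contained in [U] *)
exists (fun n => if `[< P (T n) >] then ratr (T n).2 else -1).
apply/seteqP; split=> [p Up|p [n _]].
  have [a [b [r [Hp HU]]]] := open_rat_square oU Up.
  exists (pickle (a, b, r)) => //.
  rewrite /T pickleK /=; case: asboolP => //.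
case: asboolP => [|_ /closed_squareP[/=]]; first exact.
by move=> /(le_trans (normr_ge0 _)); rewrite oppr_ge0 ler10.
Qed.

Lemma open_measurable_plane U : open U -> measurable U.
Proof.
move=> /open_bigcup_square[c [r ->]].
by apply: bigcupT_measurable => n; exact: measurable_closed_square.
Qed.

Lemma open_continuous_measurable_plane U (f : R * R -> R) :
  open U -> (forall p, U p -> {for p, continuous f}) -> measurable_fun U f.
Proof.
move=> oU cf; apply: (measurability _ (RGenOpens.measurableE R)).
move=> /= _ [_ [a [b ->]] <-]; apply: open_measurable_plane.
apply/open_ballP => p /= [Up]; rewrite in_itv /= => /andP[H1 H2].
have /open_ballP/(_ _ Up)[e1 e10 He1] := oU.
have e0 : 0 < Num.min (f p - a) (b - f p) by rewrite lt_min !subr_gt0 H1 H2.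
have /cvg_plane_epsP/(_ _ e0)[d d0 Hd] := cf p Up.
exists (Num.min e1 d) => [|q]; first by rewrite lt_min e10 d0.
rewrite lt_min => /andP[/He1 Uq /Hd H]; split => //.
move: H; rewrite lt_min in_itv /= !ltr_norml => /andP[/andP[? ?] /andP[? ?]].
by apply/andP; split; lra.
Qed.

Lemma measurable_affine (a e : R) : measurable_fun setT (fun x : R => a + e * x).
Proof.
apply: measurable_funD; first exact: measurable_cst.
by apply: measurable_funM; [exact: measurable_cst|exact: measurable_id].
Qed.

Lemma leb_affine (a : R) (e : {posnum R}) (A : set R) : measurable A ->
  leb A = (e%:num%:E * leb ((fun x => (a + e%:num * x)%R) @^-1` A))%E.
Proof.
move=> mA.
have enz : e%:num != 0 by [].
have e0 : 0 <= e%:num by [].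
pose phi : measurableTypeR R -> measurableTypeR R := fun x => (a + e%:num * x)%R.
have mT : measurable_fun setT phi by exact: measurable_affine.
pose nu : {measure set (measurableTypeR R) -> \bar R} := pushm leb mT.
pose mu : {measure set (measurableTypeR R) -> \bar R} :=
  mscale (NngNum e0)  nu.
transitivity (mu A); last by [].
apply: lebesgue_measure_unique => // X [[x y] _ <-] /=.
have H : phi @^-1` `]x, y]%classic = `](x - a) / e%:num, (y - a) / e%:num]%classic.
  apply/seteqP; split=> t /=; rewrite !in_itv /= ltr_pdivrMr// ler_pdivlMr// /phi;
  by rewrite mulrC => /andP[? ?]; apply/andP; split; lra.
pose X' := `](x - a) / e%:num, (y - a) / e%:num]%classic.
transitivity (e%:num%:E * leb X')%E; last first.
  by rewrite /X' -H.
rewrite !lebesgue_measure_itv /= !lte_fin ltr_pM2r ?invr_gt0// ltrBlDr subrK.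
case: ifPn => _; last by rewrite mule0.
by rewrite -!EFinB -EFinM; congr EFin; field.
Qed.

(** The map [p |-> a + e p]. *)
Definition affine (a : R * R) (e : R) (p : R * R) : R * R :=
  (a.1 + e * p.1, a.2 + e * p.2).

Lemma measurable_affine2 a e : measurable_fun setT (affine a e).
Proof.
apply/measurable_fun_pairP; split.
  exact: (measurableT_comp (measurable_affine a.1 e) measurable_fst).
exact: (measurableT_comp (measurable_affine a.2 e) measurable_snd).
Qed.

Lemma leb2_affine a (e : {posnum R}) (A : set (R * R)) : measurable A ->
  leb2 A = ((e%:num ^+ 2)%:E * leb2 (affine a e%:num @^-1` A))%E.
Proof.
move=> mA; have e0 : 0 <= e%:num ^+ 2 by [].
pose phi : measurableTypeR R * measurableTypeR R -> measurableTypeR R * measurableTypeR R :=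
  affine a e%:num.
have mT : measurable_fun setT phi by exact: measurable_affine2.
pose nu : {measure set (measurableTypeR R * measurableTypeR R) -> \bar R} := pushm leb2 mT.
pose mu : {measure set (measurableTypeR R * measurableTypeR R) -> \bar R} :=
  mscale (NngNum e0) nu.
transitivity (mu A); last by [].
apply: product_measure_unique => // X Y mX mY.
set X' := ((fun x : R => (a.1 + e%:num * x)%R) @^-1` X).
set Y' := ((fun x : R => (a.2 + e%:num * x)%R) @^-1` Y).
have mX' := measurable_affine a.1 e%:num measurableT mX.
have mY' := measurable_affine a.2 e%:num measurableT mY.
rewrite !setTI in mX' mY'.
transitivity ((e%:num ^+ 2)%:E * leb2 (X' `*` Y'))%E; first by [].
rewrite product_measure1E// expr2 EFinM muleACA.
by congr (_ * _)%E; apply/esym; exact: leb_affine.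
Qed.

Lemma ge0_integral_affine a (e : {posnum R}) (f : R * R -> \bar R) :
  measurable_fun setT f -> (forall p, 0 <= f p)%E ->
  (\int[leb2]_p f p = (e%:num ^+ 2)%:E * \int[leb2]_p f (affine a e%:num p))%E.
Proof.
move=> mf f0.
have e0 : 0 <= e%:num ^+ 2 by [].
pose phi : measurableTypeR R * measurableTypeR R -> measurableTypeR R * measurableTypeR R :=
  affine a e%:num.
have mT : measurable_fun setT phi by exact: measurable_affine2.
pose nu : {measure set (measurableTypeR R * measurableTypeR R) -> \bar R} := pushm leb2 mT.
pose mu : {measure set (measurableTypeR R * measurableTypeR R) -> \bar R} :=
  mscale (NngNum e0) nu.
rewrite (eq_measure_integral mu); last first.
  by move=> A mA _; exact: (leb2_affine a e mA).
transitivity ((e%:num ^+ 2)%:E * \int[nu]_p f p)%E.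
  by apply: (ge0_integral_mscale nu measurableT (NngNum e0)) => // p _; exact: f0.
have E2 : (\int[nu]_p f p = \int[leb2]_p f (affine a e%:num p))%E.
  by apply: (ge0_integral_pushforward mT leb2 measurableT mf) => p _; exact: f0.
by rewrite E2.
Qed.

Lemma integrable_affine a (e : {posnum R}) (f : R * R -> R) :
  leb2.-integrable setT (EFin \o f) ->
  leb2.-integrable setT (EFin \o (f \o affine a e%:num)).
Proof.
move=> /integrableP[mf intf]; have mT := measurable_affine2 a e%:num.
apply/integrableP; split; first exact: (measurableT_comp mf mT).
move: intf; rewrite (ge0_integral_affine a e); last 2 first.
- exact: measurableT_comp.
- by move=> p; exact: abse_ge0.
set I := (X in (_ * X)%E) => H; rewrite -/I ltNge; apply/negP => /=.
by rewrite leye_eq => /eqP Ioo; move: H; rewrite Ioo gt0_muley// lte_fin exprn_gt0.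
Qed.

Lemma Rintegral_affine a (e : {posnum R}) (f : R * R -> R) :
  leb2.-integrable setT (EFin \o f) ->
  \int[leb2]_p f p = e%:num ^+ 2 * \int[leb2]_p f (affine a e%:num p).
Proof.
move=> intf; have intf' := integrable_affine a e intf.
have mf := measurable_int _ intf.
rewrite /Rintegral [in LHS]integralE [in RHS]integralE.
rewrite (ge0_integral_affine a e (measurable_funepos mf)); last by [].
rewrite (ge0_integral_affine a e (measurable_funeneg mf)); last by [].
have -> : (fun p => (EFin \o f)^\+%E (affine a e%:num p)) =
  (fun p => (f (affine a e%:num p))%:E)^\+%E by apply/funext => p; rewrite !funeposE.
have -> : (fun p => (EFin \o f)^\-%E (affine a e%:num p)) =
  (fun p => (f (affine a e%:num p))%:E)^\-%E by apply/funext => p; rewrite !funenegE.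
have fp : (\int[leb2]_x (fun p => (f (affine a e%:num p))%:E)^\+ x)%E \is a fin_num.
  exact: integrable_pos_fin_num.
have fm : (\int[leb2]_x (fun p => (f (affine a e%:num p))%:E)^\- x)%E \is a fin_num.
  exact: integrable_neg_fin_num.
rewrite -(fineK fp) -(fineK fm) -!EFinM -!EFinB /=; ring.
Qed.

End PlaneMeasure.

(** * Functions of class C^1 *)

Section PlaneCalculus.
Context {R : realType}.
Implicit Types (p q : R * R) (U : set (R * R)).

Lemma plane_diff_x (f : R * R -> R) p :
  (fun h : R => h^-1 *: ((f \o shift p) (h *: ((1, 0) : R * R)) - f p)) =
  (fun h : R => h^-1 *: (((fun s => f (s, p.2)) \o shift p.1) (h *: (1 : R)) - f (p.1, p.2))).
Proof.
apply/funext => h /=; rewrite -surjective_pairing; congr (_ *: (f _ - _)).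
by rewrite [LHS]surjective_pairing /= scaler0 add0r.
Qed.

Lemma plane_diff_y (f : R * R -> R) p :
  (fun h : R => h^-1 *: ((f \o shift p) (h *: ((0, 1) : R * R)) - f p)) =
  (fun h : R => h^-1 *: (((fun s => f (p.1, s)) \o shift p.2) (h *: (1 : R)) - f (p.1, p.2))).
Proof.
apply/funext => h /=; rewrite -surjective_pairing; congr (_ *: (f _ - _)).
by rewrite [LHS]surjective_pairing /= scaler0 add0r.
Qed.

Lemma is_derive_lineX (f : R * R -> R) p (df : R) :
  is_derive p (1, 0) f df <-> is_derive p.1 1 (fun s => f (s, p.2)) df.
Proof.
by split=> -[]; rewrite /derivable /derive => H1 H2; split;
  rewrite /derivable /derive; move: H1 H2; rewrite plane_diff_x.
Qed.

Lemma is_derive_lineY (f : R * R -> R) p (df : R) :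
  is_derive p (0, 1) f df <-> is_derive p.2 1 (fun s => f (p.1, s)) df.
Proof.
by split=> -[]; rewrite /derivable /derive => H1 H2; split;
  rewrite /derivable /derive; move: H1 H2; rewrite plane_diff_y.
Qed.

(** [u] has partial derivatives [ux] and [uy] at each point of [U], which are
    continuous there; partial derivatives are taken along coordinate lines. *)
Definition C1on U (u ux uy : R * R -> R) : Prop := forall p, U p ->
  [/\ is_derive p.1 1 (fun s => u (s, p.2)) (ux p),
      is_derive p.2 1 (fun t => u (p.1, t)) (uy p),
      {for p, continuous ux} & {for p, continuous uy}].

(** [s] lies in the segment with endpoints [a] and [b], in either order. *)
Definition between (a b s : R) := Num.min a b <= s <= Num.max a b.

Lemma betweenP (a b s : R) :
  between a b s <-> (a <= s <= b) \/ (b <= s <= a).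
Proof.
rewrite /between; case: (leP a b) => ab; split.
- by left.
- by move=> [//|/andP[? ?]]; apply/andP; split; lra.
- by right.
- by move=> [/andP[? ?]|//]; apply/andP; split; lra.
Qed.

Lemma between_dist (a b s c r : R) : between a b s ->
  `|a - c| < r -> `|b - c| < r -> `|s - c| < r.
Proof.
by move=> /betweenP[|] /andP[? ?]; rewrite !ltr_norml => /andP[? ?] /andP[? ?];
  apply/andP; split; lra.
Qed.

Lemma between_shift (a h s : R) : between a (a + h) s -> exists2 t, s = a + t & `|t| <= `|h|.
Proof.
move=> /betweenP H; exists (s - a); first by rewrite addrC subrK.
have := ler_norm h; have := ler_norm (- h); rewrite normrN ler_norml.
by case: H => /andP[? ?] ? ?; apply/andP; split; lra.
Qed.

Lemma MVT_between (g dg : R -> R) (a b : R) :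
  (forall s, between a b s -> is_derive s 1 g (dg s)) ->
  exists2 c, between a b c & g b - g a = dg c * (b - a).
Proof.
wlog ab : a b / a <= b.
  move=> H Hd; have [ab|/ltW ba] := leP a b; first exact: H.
  have [|c cab Hc] := H b a ba; first by move=> s; rewrite /between minC maxC => /Hd.
  exists c; first by rewrite /between minC maxC.
  by rewrite -opprB Hc; ring.
move=> Hd.
have Hd' s : a <= s <= b -> is_derive s 1 g (dg s).
  by move=> sab; apply: Hd; apply/betweenP; left.
have [||c] := @MVT_segment R g dg a b ab.
- by move=> x; rewrite in_itv /= => /andP[/ltW ? /ltW ?]; apply: Hd'; apply/andP.
- apply: derivable_within_continuous => x; rewrite in_itv /= => xab.
  by have [] := Hd' x xab.
by rewrite in_itv /= => cab Hc; exists c => //; apply/betweenP; left.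
Qed.

Lemma MVT_le (g dg : R -> R) (a b : R) : a <= b ->
  (forall s, a <= s <= b -> is_derive s 1 g (dg s)) ->
  exists2 c, a <= c <= b & g b - g a = dg c * (b - a).
Proof.
move=> ab H; have [s /betweenP sab|c /betweenP cab E] := @MVT_between g dg a b.
  by apply: H; case: sab => // /andP[? ?]; apply/andP; split; lra.
by exists c => //; case: cab => // /andP[? ?]; apply/andP; split; lra.
Qed.

(** A C^1 function is strictly differentiable: both points of the increment
    may vary near [p]. *)
Lemma strict_differentiable U (u ux uy : R * R -> R) p (e : R) :
  open U -> C1on U u ux uy -> U p -> 0 < e ->
  exists2 d, 0 < d & forall q q', `|q - p| < d -> `|q' - p| < d ->
    `|u q' - u q - (ux p * (q'.1 - q.1) + uy p * (q'.2 - q.2))|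
    <= e * (`|q'.1 - q.1| + `|q'.2 - q.2|).
Proof.
move=> /open_ballP oU Cu Up e0.
have [d0 d00 Hd0] := oU p Up.
have [_ _ /cvg_plane_epsP/(_ _ e0)[d1 d10 Hd1] /cvg_plane_epsP/(_ _ e0)[d2 d20 Hd2]] := Cu p Up.
exists (Num.min d0 (Num.min d1 d2)) => [|[x y] [x' y']]; first by rewrite !lt_min d00 d10 d20.
move=> /prod_ltP /= [Hx Hy] /prod_ltP /= [Hx' Hy'].
have Hb (s t : R) : `|s - p.1| < Num.min d0 (Num.min d1 d2) ->
    `|t - p.2| < Num.min d0 (Num.min d1 d2) ->
    [/\ U (s, t), `|ux (s, t) - ux p| < e & `|uy (s, t) - uy p| < e].
  rewrite !lt_min => /and3P[? ? ?] /and3P[? ? ?].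
  by split; [apply: Hd0|apply: Hd1|apply: Hd2]; apply/prod_ltP.
have [s sx Es] := @MVT_between (fun s => u (s, y')) (fun s => ux (s, y')) x x'
  ltac:(by move=> s /between_dist/(_ Hx Hx') Hs; have [/Cu[]] := Hb _ _ Hs Hy').
have [t ty Et] := @MVT_between (fun t => u (x, t)) (fun t => uy (x, t)) y y'
  ltac:(by move=> t /between_dist/(_ Hy Hy') Ht; have [/Cu[]] := Hb _ _ Hx Ht).
have [_ H1 _] := Hb _ _ (between_dist sx Hx Hx') Hy'.
have [_ _ H2] := Hb _ _ Hx (between_dist ty Hy Hy').
have -> : u (x', y') - u (x, y) - (ux p * (x' - x) + uy p * (y' - y)) =
  (ux (s, y') - ux p) * (x' - x) + (uy (x, t) - uy p) * (y' - y).
  have -> : u (x', y') - u (x, y) = (u (x', y') - u (x, y')) + (u (x, y') - u (x, y)) by ring.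
  by rewrite Es Et; ring.
rewrite [leRHS]mulrDr; apply: (le_trans (ler_normD _ _)).
by rewrite !normrM lerD// ler_wpM2r//; exact: ltW.
Qed.

Lemma C1on_continuous U (u ux uy : R * R -> R) p :
  open U -> C1on U u ux uy -> U p -> {for p, continuous u}.
Proof.
move=> oU Cu Up; apply/cvg_plane_epsP => e e0.
have [d d0 Hd] := strict_differentiable oU Cu Up ltr01.
pose M := `|ux p| + `|uy p| + 2.
have M0 : 0 < M by rewrite ltr_wpDl// addr_ge0.
exists (Num.min d (e / M)) => [|q]; first by rewrite lt_min d0 divr_gt0.
rewrite lt_min => /andP[qd]; rewrite ltr_pdivlMr// => qe.
have := Hd p q; rewrite subrr normr0 => /(_ d0 qd).
have [q1 q2] : `|q.1 - p.1| <= `|q - p| /\ `|q.2 - p.2| <= `|q - p| by apply/prod_leP.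
move=> H; apply: le_lt_trans qe.
have -> : u q - u p = (u q - u p - (ux p * (q.1 - p.1) + uy p * (q.2 - p.2)))
   + (ux p * (q.1 - p.1) + uy p * (q.2 - p.2)) by ring.
rewrite (le_trans (ler_normD _ _))//.
have H2 := ler_normD (ux p * (q.1 - p.1)) (uy p * (q.2 - p.2)).
rewrite !normrM in H2.
have h1 : `|ux p| * `|q.1 - p.1| <= `|ux p| * `|q - p| by rewrite ler_wpM2l.
have h2 : `|uy p| * `|q.2 - p.2| <= `|uy p| * `|q - p| by rewrite ler_wpM2l.
have -> : `|q - p| * M = `|ux p| * `|q - p| + `|uy p| * `|q - p| + 2 * `|q - p|.
  by rewrite /M; ring.
lra.
Qed.

Lemma C1on_measurable U (w wx wy : R * R -> R) : open U -> C1on U w wx wy ->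
  [/\ measurable_fun U w, measurable_fun U wx & measurable_fun U wy].
Proof.
move=> oU Cw; split; apply: open_continuous_measurable_plane => // p.
- exact: C1on_continuous oU Cw.
- by move=> /Cw[].
- by move=> /Cw[].
Qed.

Lemma C1on_sub U V (u ux uy : R * R -> R) : V `<=` U -> C1on U u ux uy -> C1on V u ux uy.
Proof. by move=> VU Cu p /VU/Cu. Qed.

Lemma C1onN U (u ux uy : R * R -> R) : C1on U u ux uy ->
  C1on U (fun p => - u p) (fun p => - ux p) (fun p => - uy p).
Proof.
move=> Cu p /Cu[? ? ? ?]; split.
- exact: is_deriveN.
- exact: is_deriveN.
- exact: (@continuousN _ _ _ ux).
- exact: (@continuousN _ _ _ uy).
Qed.

Definition swap p : R * R := (p.2, p.1).

Lemma swapK p : swap (swap p) = p. Proof. by case: p. Qed.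

Lemma norm_swap p q : `|swap p - swap q| = `|p - q|.
Proof. by rewrite !prod_normE /= maxC. Qed.

Lemma C1on_swap U (u ux uy : R * R -> R) : C1on U u ux uy ->
  C1on (swap @^-1` U) (u \o swap) (uy \o swap) (ux \o swap).
Proof.
have cs (f : R * R -> R) p : {for swap p, continuous f} -> {for p, continuous (f \o swap)}.
  move=> /cvg_plane_epsP H; apply/cvg_plane_epsP => e /H[d d0 Hd].
  by exists d => // q qp; apply: Hd; rewrite norm_swap.
by move=> Cu p /Cu[h1 h2 h3 h4]; split; [exact: h2|exact: h1|exact: cs|exact: cs].
Qed.

Lemma open_swap U : open U -> open (swap @^-1` U).
Proof.
move=> /open_ballP oU; apply/open_ballP => p /oU[e e0 He].
by exists e => // q; rewrite -norm_swap => /He.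
Qed.

End PlaneCalculus.

(** * Level curves *)

Section LevelCurve.
Context {R : realType}.
Implicit Types (p q : R * R).

Lemma is_derive_eps (w : R -> R) (s D : R) :
  (forall e : R, 0 < e -> exists2 d : R, 0 < d & forall h, h != 0 -> `|h| < d ->
     `|w (h + s) - w s - D * h| <= e * `|h|) -> is_derive s 1 w D.
Proof.
move=> H.
have C : (fun h : R => h^-1 *: ((w \o shift s) (h *: (1 : R)) - w s)) @ 0^' --> D.
  apply/cvgrPdist_le => e /H[d d0 Hd]; near=> h.
  have h0 : h != 0 by near: h; exact: nbhs_dnbhs_neq.
  have hd : `|h| < d by near: h; exact: dnbhs0_lt.
  have := Hd h h0 hd; rewrite -ler_pdivrMr ?normr_gt0// => H1.
  rewrite -normf_div in H1.
  rewrite distrC /= [h *: 1]mulr1 /GRing.scale /=.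
  suff <- : (w (h + s) - w s - D * h) / h = h^-1 * (w (h + s) - w s) - D by [].
  by field.
split; first by apply/cvg_ex; exists D.
exact: cvg_lim.
Unshelve. all: by end_near. Qed.

(** Level curves of [u] are graphs [x = X s] over the [y]-axis, and along them
    a function [k] has derivative [{u, k} / u_x], where
    [{u, k} = u_x k_y - u_y k_x]. *)
Lemma level_curve (p0 : R * R) (r c M : R) (u ux uy : R * R -> R) :
  0 < c -> 0 < M -> C1on [set p | `|p - p0| < r] u ux uy ->
  (forall p, `|p - p0| < r -> c <= ux p /\ `|uy p| <= M) ->
  forall r' p, r' * (1 + 2 * (M / c)) <= r -> `|p - p0| < r' ->
  exists X : R -> R,
   [/\ X p.2 = p.1,
      forall s, `|s - p0.2| < r' -> `|(X s, s) - p0| < r,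
      forall s, `|s - p0.2| < r' -> u (X s, s) = u p &
      forall k kx ky, C1on [set p | `|p - p0| < r] k kx ky ->
        forall s, `|s - p0.2| < r' ->
        is_derive s 1 (fun t => k (X t, t))
          ((ux (X s, s) * ky (X s, s) - uy (X s, s) * kx (X s, s)) / ux (X s, s))].
Proof.
move=> c0 M0 Cu Hu r' p Hr /prod_ltP[p1 p2].
have L0 : 0 < M / c by rewrite divr_gt0.
set L := M / c in Hr L0 *.
have cL : c * L = M by rewrite /L; field; lra.
have r'0 : 0 < r' by apply: le_lt_trans p1.
have r'r : r' <= r by rewrite (le_trans _ Hr)// ler_peMr ?ltW//; lra.
have oU : open [set p | `|p - p0| < r].
  exact: open_norm_ball.
have inr (x s : R) : `|x - p.1| <= L * `|s - p.2| -> `|s - p0.2| < r' ->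
    `|(x, s) - p0| < r.
  move=> Hx Hs; apply/prod_ltP => /=; split; last exact: lt_le_trans r'r.
  have H1 : `|s - p.2| < 2 * r'.
    by have := ler_distD p0.2 s p.2; rewrite (distrC p0.2); lra.
  have H2 : L * `|s - p.2| < L * (2 * r') by rewrite ltr_pM2l.
  have := ler_distD p.1 x p0.1; clear -Hx p1 H2 Hr; lra.
have slope (x x' s : R) : `|(x, s) - p0| < r -> `|(x', s) - p0| < r -> x <= x' ->
    c * (x' - x) <= u (x', s) - u (x, s).
  move=> /prod_ltP[/= xr sr] /prod_ltP[/= x'r _] xx'.
  have [t tx ->] := @MVT_between _ (fun t => u (t, s)) (fun t => ux (t, s)) x x'
    ltac:(by move=> t /between_dist/(_ xr x'r) tr; have [|] := Cu (t, s); [apply/prod_ltP|]).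
  rewrite ler_wpM2r ?subr_ge0//; apply: (Hu _ _).1; apply/prod_ltP; split => //=.
  exact: between_dist xr x'r.
have vert (x s s' : R) : `|(x, s) - p0| < r -> `|(x, s') - p0| < r ->
    `|u (x, s') - u (x, s)| <= M * `|s' - s|.
  move=> /prod_ltP[/= xr sr] /prod_ltP[/= _ s'r].
  have [t tx ->] := @MVT_between _ (fun t => u (x, t)) (fun t => uy (x, t)) s s'
    ltac:(by move=> t /between_dist/(_ sr s'r) tr; have [|] := Cu (x, t); [apply/prod_ltP|]).
  rewrite normrM ler_wpM2r//; apply: (Hu _ _).2; apply/prod_ltP; split => //=.
  exact: between_dist sr s'r.
have ex s : exists x, `|s - p0.2| < r' -> `|x - p.1| <= L * `|s - p.2| /\ u (x, s) = u p.
  have [sr|_] := ltP `|s - p0.2| r'; last by exists 0.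
  have d0 : 0 <= L * `|s - p.2| by rewrite mulr_ge0// ltW.
  set d := L * `|s - p.2| in d0 *.
  have I x : p.1 - d <= x <= p.1 + d -> `|(x, s) - p0| < r.
    by move=> xI; apply: inr => //; rewrite -/d ler_distl.
  have Ip : `|(p.1, s) - p0| < r by apply: I; clear -d0; apply/andP; split; lra.
  have I1 : `|(p.1 - d, s) - p0| < r by apply: I; clear -d0; apply/andP; split; lra.
  have I2 : `|(p.1 + d, s) - p0| < r by apply: I; clear -d0; apply/andP; split; lra.
  have pE : p = (p.1, p.2) by case: (p).
  have V : `|u (p.1, s) - u p| <= M * `|s - p.2|.
    by rewrite pE; apply: vert => //; apply/prod_ltP; split => /=; apply: lt_le_trans r'r.
  have S1 := slope _ _ _ I1 Ip ltac:(clear -d0; lra).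
  have S2 := slope _ _ _ Ip I2 ltac:(clear -d0; lra).
  have cd : c * d = M * `|s - p.2| by rewrite /d mulrA cL.
  move: V; rewrite ler_norml => /andP[V1 V2].
  have [||| x] := @IVT R (fun x => u (x, s)) (p.1 - d) (p.1 + d) (u p).
  - by clear -d0; lra.
  - apply: derivable_within_continuous => x; rewrite in_itv /= => /I/Cu[].
    by case.
  - clear -S1 S2 cd V1 V2; rewrite ge_min le_max; apply/andP; split; apply/orP; [left|right]; nra.
  rewrite in_itv /= => xI ux_; exists x => _; split => //.
  by rewrite ler_distl.
have [X HX] := choice ex.
have Xr s : `|s - p0.2| < r' -> `|(X s, s) - p0| < r.
  by move=> sr; apply: inr => //; have [] := HX s sr.
have XL s s' : `|s - p0.2| < r' -> `|s' - p0.2| < r' -> `|X s' - X s| <= L * `|s' - s|.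
  move=> sr s'r.
  have Xr1 : `|(X s, s') - p0| < r.
    apply/prod_ltP => /=; split; last exact: lt_le_trans r'r.
    by have /prod_ltP[] := Xr _ sr.
  have H1 := vert _ _ _ (Xr _ sr) Xr1.
  rewrite (HX s sr).2 -(HX s' s'r).2 distrC in H1.
  rewrite -(ler_pM2l c0) mulrA cL (le_trans _ H1)//.
  have [xx|/ltW xx] := leP (X s) (X s').
    have := slope _ _ _ Xr1 (Xr _ s'r) xx.
    by rewrite ger0_norm ?subr_ge0// => /le_trans -> //; exact: ler_norm.
  have := slope _ _ _ (Xr _ s'r) Xr1 xx.
  rewrite [`|X s' - X s|]distrC [`|X s - X s'|]ger0_norm ?subr_ge0// => /le_trans -> //.
  by rewrite distrC ler_norm.
exists X; split => //.
- have := (HX p.2 p2).1; rewrite subrr normr0 mulr0 normr_le0 subr_eq0.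
  by move=> /eqP.
- by move=> s /HX[].
move=> k kx ky Ck s sr; apply: is_derive_eps => e e0.
set P := (X s, s); have PU := Xr _ sr.
have uxP : c <= ux P by have [] := Hu _ PU.
have uxP0 : 0 < ux P by exact: lt_le_trans uxP.
pose C := (1 + L) * (`|kx P| / ux P + 1).
have k0 : 0 <= `|kx P| / ux P by rewrite divr_ge0// ltW.
have C0 : 0 < C by rewrite mulr_gt0//; clear -L0 k0; lra.
have eC : 0 < e / C by rewrite divr_gt0.
have [d1 d10 Hd1] := strict_differentiable oU Cu PU eC.
have [d2 d20 Hd2] := strict_differentiable oU Ck PU eC.
pose d := Num.min (r' - `|s - p0.2|) (Num.min d1 d2 / (1 + L)).
have L1 : 0 < 1 + L by rewrite addr_gt0.
have d0 : 0 < d by rewrite lt_min subr_gt0 sr divr_gt0// lt_min d10 d20.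
exists d => // h h0; rewrite lt_min => /andP[h1].
rewrite ltr_pdivlMr// mulrC lt_min => /andP[h2 h3].
have shr : `|h + s - p0.2| < r'.
  by have := ler_normD h (s - p0.2); rewrite addrA; clear -h1; lra.
have XLh := XL _ _ sr shr; rewrite addrK in XLh.
set P' := (X (h + s), h + s).
have PP' : `|P' - P| <= (1 + L) * `|h|.
  apply/prod_leP; split => /=; first by rewrite (le_trans XLh)// ler_wpM2r// lerDr.
  by rewrite addrK ler_peMl// lerDl ltW.
have PP : `|P - P| = 0 by rewrite subrr normr0.
have E1 := Hd1 P P'; rewrite PP in E1; have := E1 d10 (le_lt_trans PP' h2).
have E2 := Hd2 P P'; rewrite PP in E2; have := E2 d20 (le_lt_trans PP' h3).
rewrite (HX _ shr).2 (HX _ sr).2 subrr /= addrK.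
set a := X (h + s) - X s; set K := k P' - k P => {E1 E2} F2 F1.
have S : `|a| + `|h| <= (1 + L) * `|h| by rewrite mulrDl mul1r addrC lerD2l.
set E2 := K - _ in F2; set E1 := 0 - _ in F1.
have eC0 := ltW eC.
have G1 : `|E1| <= e / C * ((1 + L) * `|h|) by rewrite (le_trans F1)// ler_wpM2l.
have G2 : `|E2| <= e / C * ((1 + L) * `|h|) by rewrite (le_trans F2)// ler_wpM2l.
have -> : K - (ux P * ky P - uy P * kx P) / ux P * h = E2 + (- (kx P / ux P)) * E1.
  by rewrite /E1 /E2; field; rewrite gt_eqF.
rewrite (le_trans (ler_normD _ _))// normrM normrN normrM normfV (gtr0_norm uxP0).
have -> : e * `|h| = e / C * ((1 + L) * `|h|) + `|kx P| / ux P * (e / C * ((1 + L) * `|h|)).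
  have eE : e = e / C * C by rewrite mulfVK// gt_eqF.
  by rewrite [in LHS]eE; set e1 := e / C; rewrite /C; ring.
by rewrite lerD// ler_wpM2l.
Qed.

End LevelCurve.

(** * Lower bounds for the increments of Z *)

Section KernelPointwise.
Context {R : realType}.
Implicit Types (p q : R * R).

(** If [z] grows at least linearly and [g' >= k |z|^n], then [g] grows at least
    like a power: [|z|] is at least a quarter of its oscillation on one of the
    two outer quarters of the interval. *)
Lemma degenerate_growth (g z : R -> R) (a b m k : R) (n : nat) :
  a <= b -> 0 <= m -> 0 <= k ->
  (forall s t, a <= s -> s <= t -> t <= b -> m * (t - s) <= z t - z s) ->
  (forall s t y, a <= s -> s <= t -> t <= b -> 0 <= y ->
     (forall x, s <= x <= t -> y <= `|z x|) ->
     k * y ^+ n * (t - s) <= g t - g s) ->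
  k * (m / 4) ^+ n / 4 * (b - a) ^+ n.+1 <= g b - g a.
Proof.
move=> ab m0 k0 z_mono g_mono.
have g_mono0 s t : a <= s -> s <= t -> t <= b -> g s <= g t.
  move=> qs st tp; have := g_mono s t 0 qs st tp (lexx _) (fun y _ => normr_ge0 _).
  rewrite -(subr_ge0 (g s)); apply: le_trans.
  by rewrite mulr_ge0 ?subr_ge0// mulr_ge0 ?exprn_ge0.
have -> : k * (m / 4) ^+ n / 4 * (b - a) ^+ n.+1 =
    k * (m * ((b - a) / 4)) ^+ n * ((b - a) / 4).
  by rewrite exprS !exprMn; ring.
set d := (b - a) / 4.
have d0 : 0 <= d by rewrite /d; lra.
have md : 0 <= m * d by rewrite mulr_ge0.
have [t0 [at0 t0b]] : exists t0, t0 - a = 2 * d /\ b - t0 = 2 * d.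
  by exists ((a + b) / 2); rewrite /d; split; field.
have [zt0|/ltW zt0] := leP 0 (z t0).
  have [h1 h2 h3] : [/\ a <= b - d, b - d <= b & t0 <= b - d]
    by clear -at0 t0b d0; split; lra.
  have := @g_mono (b - d) b (m * d) h1 h2 (lexx _) md; rewrite subKr => H.
  apply: (le_trans (H _)); last by rewrite lerB// g_mono0.
  move=> y /andP[y1 y2].
  have [h4 h5 h6] : [/\ a <= t0, t0 <= y & d <= y - t0]
    by clear -at0 t0b d0 y1; split; lra.
  have := z_mono t0 y h4 h5 y2; have := ler_wpM2l m0 h6.
  by have := ler_norm (z y); clear -zt0; lra.
have [h1 h2 h3] : [/\ a <= a + d, a + d <= b & a + d <= t0]
  by clear -at0 t0b d0; split; lra.
have := @g_mono a (a + d) (m * d) (lexx _) h1 h2 md; rewrite [a + d]addrC addrK => H.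
apply: (le_trans (H _)); last by rewrite lerB// g_mono0 1?addrC.
move=> y /andP[y1 y2].
have [h4 h5 h6] : [/\ t0 <= b, y <= t0 & d <= t0 - y]
  by clear -at0 t0b d0 y2; split; lra.
have := z_mono y t0 y1 h5 h4; have := ler_wpM2l m0 h6.
by have := ler_norm (- z y); rewrite normrN; clear -zt0; lra.
Qed.

(** Follow the level curve of [u] through [p] down to the height of [q]. Along
    it [v] has derivative [{u, v} / u_x], which is at least a constant times
    [|w|^n], while [w] grows linearly since [{u, w}] is bounded below; hence [v]
    varies at least like a power of [p.2 - q.2]. The end of the curve has the
    height of [q] and is at distance at most a constant times [|u p - u q|]
    from [q]. *)
Lemma level_estimate (p0 : R * R) (r c M k : R) (n : nat)
    (u ux uy v vx vy w wx wy : R * R -> R) :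
  0 < r -> 0 < c -> 0 < M -> 0 < k ->
  C1on [set p | `|p - p0| < r] u ux uy ->
  C1on [set p | `|p - p0| < r] v vx vy ->
  C1on [set p | `|p - p0| < r] w wx wy ->
  (forall p, `|p - p0| < r ->
     [/\ c <= ux p <= M, `|uy p| <= M, `|vx p| <= M,
         c <= ux p * wy p - uy p * wx p &
         k * `|w p| ^+ n <= ux p * vy p - uy p * vx p]) ->
  exists2 c', 0 < c' & forall p q,
    `|p - p0| < r / (1 + 2 * (M / c)) -> `|q - p0| < r / (1 + 2 * (M / c)) ->
    c' * (`|u p - u q| + `|p.2 - q.2| ^+ n.+1) <= `|u p - u q| + `|v p - v q|.
Proof.
move=> r0 c0 M0 k0 Cu Cv Cw H.
have L0 : 0 < M / c by rewrite divr_gt0.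
have D0 : 0 < 1 + 2 * (M / c) by rewrite addr_gt0// mulr_gt0.
set r' := r / _.
have r'E : r' * (1 + 2 * (M / c)) <= r by rewrite divfK// gt_eqF.
have r'r : r' <= r.
  by rewrite ler_pdivrMr// ler_peMr ?ltW//; lra.
pose m := c / M; have m0 : 0 < m by rewrite divr_gt0.
pose A := k / M * (m / 4) ^+ n / 4.
have A0 : 0 < A by rewrite divr_gt0// mulr_gt0 ?divr_gt0// exprn_gt0// divr_gt0.
pose c' := Num.min A 1 / (1 + M / c).
have L1 : 0 < 1 + M / c by rewrite addr_gt0.
have c'0 : 0 < c' by rewrite divr_gt0// lt_min A0 ltr01.
exists c' => //.
suff main p q : `|p - p0| < r' -> `|q - p0| < r' -> q.2 <= p.2 ->
    A * `|p.2 - q.2| ^+ n.+1 - M / c * `|u p - u q| <= `|v p - v q|.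
  move=> p q pr qr.
  have {main} : A * `|p.2 - q.2| ^+ n.+1 - M / c * `|u p - u q| <= `|v p - v q|.
    have [qp|/ltW pq] := leP q.2 p.2; first exact: main.
    by rewrite (distrC p.2) (distrC (u p)) (distrC (v p)); exact: main.
  set a := `|u p - u q|; set b := `|v p - v q|; set d := _ ^+ _ => main.
  have a0 : 0 <= a by exact: normr_ge0.
  have d0 : 0 <= d by exact: exprn_ge0.
  rewrite /c' mulrAC ler_pdivrMr//.
  have [B1 B2] : Num.min A 1 <= A /\ Num.min A 1 <= 1.
    by split; rewrite ge_min lexx ?orbT.
  have h1 : Num.min A 1 * a <= a by rewrite ler_piMl.
  have h2 : Num.min A 1 * d <= A * d by rewrite ler_wpM2r.
  have b0 : 0 <= b by exact: normr_ge0.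
  have h3 : 0 <= M / c * b by rewrite mulr_ge0// ltW.
  by rewrite mulrDr; move: main; clear -h1 h2 h3; lra.
move=> pr qr qp.
have [X [Xp Xr Xu Xd]] := @level_curve R p0 r c M u ux uy c0 M0 Cu
  (fun p pr => let: And5 H1 H2 _ _ _ := H p pr in conj (andP H1).1 H2) r' p r'E pr.
have [/prod_ltP[p1 p2] /prod_ltP[q1 q2]] := (pr, qr).
have I s : q.2 <= s <= p.2 -> `|s - p0.2| < r'.
  by move=> sI; apply: between_dist q2 p2; apply/betweenP; left.
have dv s : q.2 <= s <= p.2 -> is_derive s 1 (fun t => v (X t, t))
    ((ux (X s, s) * vy (X s, s) - uy (X s, s) * vx (X s, s)) / ux (X s, s)).
  by move=> /I; apply: Xd.
have dw s : q.2 <= s <= p.2 -> is_derive s 1 (fun t => w (X t, t))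
    ((ux (X s, s) * wy (X s, s) - uy (X s, s) * wx (X s, s)) / ux (X s, s)).
  by move=> /I; apply: Xd.
set z := fun t => w (X t, t) in dw.
set g := fun t => v (X t, t) in dv.
have z_mono s t : q.2 <= s -> s <= t -> t <= p.2 -> m * (t - s) <= z t - z s.
  move=> qs st tp.
  have st' y : s <= y <= t -> q.2 <= y <= p.2.
    by move=> /andP[sy yt]; rewrite (le_trans qs sy) (le_trans yt tp).
  have [y yst ->] := MVT_le st (fun y yst => dw y (st' y yst)).
  have yr : `|(X y, y) - p0| < r by apply: Xr; apply: I; exact: st'.
  have [/andP[ux1 ux2] _ _ B _] := H _ yr.
  have ux0 := lt_le_trans c0 ux1.
  rewrite ler_wpM2r ?subr_ge0// ler_pdivlMr// (le_trans _ B)//.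
  by rewrite /m mulrAC ler_pdivrMr// ler_wpM2l// ltW.
have g_mono s t y0 : q.2 <= s -> s <= t -> t <= p.2 -> 0 <= y0 ->
    (forall y, s <= y <= t -> y0 <= `|z y|) ->
    k / M * y0 ^+ n * (t - s) <= g t - g s.
  move=> qs st tp y00 Hy.
  have st' y : s <= y <= t -> q.2 <= y <= p.2.
    by move=> /andP[sy yt]; rewrite (le_trans qs sy) (le_trans yt tp).
  have [y yst ->] := MVT_le st (fun y yst => dv y (st' y yst)).
  have yr : `|(X y, y) - p0| < r by apply: Xr; apply: I; exact: st'.
  have [/andP[ux1 ux2] _ _ _ B] := H _ yr.
  have ux0 := lt_le_trans c0 ux1.
  rewrite ler_wpM2r ?subr_ge0// ler_pdivlMr//.
  have yzy : y0 <= `|z y| by exact: Hy.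
  have h1 : k * y0 ^+ n <= k * `|z y| ^+ n by rewrite ler_pM2l// lerXn2r ?nnegrE.
  apply: le_trans B; apply: le_trans h1.
  have -> : k / M * y0 ^+ n * ux (X y, y) = k * y0 ^+ n * ux (X y, y) / M by ring.
  by rewrite ler_pdivrMr// ler_wpM2l// mulr_ge0 ?exprn_ge0// ltW.
set d := p.2 - q.2.
have gpq : A * d ^+ n.+1 <= g p.2 - g q.2.
  have kM : 0 <= k / M by rewrite divr_ge0// ltW.
  exact: (degenerate_growth qp (ltW m0) kM z_mono g_mono).
have gp : g p.2 = v p by rewrite /g Xp; case: (p).
have qI : `|q.2 - p0.2| < r' by exact: q2.
have uq : u (X q.2, q.2) = u p by exact: Xu.
have /prod_ltP[/= X1 X2] := Xr _ qI.
have q1r := lt_le_trans q1 r'r.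
have Hline s : between q.1 (X q.2) s -> `|(s, q.2) - p0| < r.
  by move=> /between_dist/(_ q1r X1) sr; apply/prod_ltP.
have [s1 s1I E1] := @MVT_between _ (fun s => u (s, q.2)) (fun s => ux (s, q.2)) q.1 (X q.2)
  ltac:(by move=> s /Hline/Cu[]).
have [s2 s2I E2] := @MVT_between _ (fun s => v (s, q.2)) (fun s => vx (s, q.2)) q.1 (X q.2)
  ltac:(by move=> s /Hline/Cv[]).
rewrite uq -surjective_pairing in E1; rewrite -surjective_pairing in E2.
have [/andP[ux1 _] _ _ _ _] := H _ (Hline _ s1I).
have [_ _ vx2 _ _] := H _ (Hline _ s2I).
have G1 : c * `|X q.2 - q.1| <= `|u p - u q|.
  by rewrite E1 normrM ler_wpM2r// (le_trans ux1)// ler_norm.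
have G2 : `|v (X q.2, q.2) - v q| <= M * `|X q.2 - q.1| by rewrite E2 normrM ler_wpM2r.
have G3 : M * `|X q.2 - q.1| <= M / c * `|u p - u q|.
  by rewrite -mulrA ler_pM2l// mulrC ler_pdivlMr// mulrC.
rewrite ger0_norm ?subr_ge0// -/d.
have G4 : g q.2 - v q <= M / c * `|u p - u q|.
  exact: le_trans (ler_norm _) (le_trans G2 G3).
have G5 : v q - g q.2 <= M / c * `|u p - u q|.
  by rewrite -opprB; apply: le_trans (le_trans G2 G3); rewrite -normrN ler_norm.
rewrite (le_trans _ (ler_norm _))// -gp; clear -gpq G5; lra.
Qed.

(** [level_estimate] under conditions at [p0] only, together with a bound for
    horizontal increments. *)
Lemma kernel_pointwise U p0 (k : R) (n : nat)
    (u ux uy v vx vy w wx wy : R * R -> R) :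
  open U -> U p0 -> 0 < k ->
  C1on U u ux uy -> C1on U v vx vy -> C1on U w wx wy ->
  ux p0 != 0 -> ux p0 * wy p0 - uy p0 * wx p0 != 0 ->
  (forall p, U p -> k * `|w p| ^+ n <= ux p * vy p - uy p * vx p) ->
  exists r c : R, [/\ 0 < r, 0 < c, (forall p, `|p - p0| < r -> U p) &
    forall p q, `|p - p0| < r -> `|q - p0| < r ->
    c * (`|u p - u q| + `|p.2 - q.2| ^+ n.+1) <= `|u p - u q| + `|v p - v q| /\
    (p.2 = q.2 -> c * `|p.1 - q.1| <= `|u p - u q|)].
Proof.
move=> oU Up k0.
wlog ux0 : u ux uy v vx vy / 0 < ux p0.
  move=> H Cu Cv Cw ux_neq0 uw J.
  have [ux0|] := ltP 0 (ux p0); first by apply: (H u ux uy v vx vy).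
  rewrite le_eqVlt (negbTE ux_neq0) /= => ux0.
  have N0 : 0 < - ux p0 by rewrite oppr_gt0.
  have [|||r [c [r0 c0 rU Hr]]] := H _ _ _ _ _ _ N0 (C1onN Cu) (C1onN Cv) Cw.
  - by rewrite oppr_eq0.
  - by rewrite !mulNr -opprD oppr_eq0.
  - by move=> p /J; rewrite !mulrNN.
  by exists r, c; split => // p q pr qr; have := Hr p q pr qr;
    rewrite -!opprD !normrN.
wlog uw0 : w wx wy / 0 < ux p0 * wy p0 - uy p0 * wx p0.
  move=> H Cu Cv Cw ux_neq0 uw J.
  have [uw0|] := ltP 0 (ux p0 * wy p0 - uy p0 * wx p0); first exact: (H w wx wy).
  rewrite le_eqVlt (negbTE uw) /= => uw0.
  apply: (H _ _ _ _ Cu Cv (C1onN Cw)) => //.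
  - by rewrite !mulrN; lra.
  - by rewrite !mulrN -opprD oppr_eq0.
  - by move=> p /J; rewrite normrN.
move=> Cu Cv Cw _ _ J.
have [_ _ cux cuy] := Cu _ Up; have [_ _ cvx cvy] := Cv _ Up.
have [_ _ cwx cwy] := Cw _ Up.
have cuw : {for p0, continuous (fun p => ux p * wy p - uy p * wx p)}.
  by apply: continuousB; apply: continuousM.
pose c := Num.min (ux p0 / 2) ((ux p0 * wy p0 - uy p0 * wx p0) / 2).
have c0 : 0 < c by rewrite lt_min !divr_gt0.
pose M := `|ux p0| + `|uy p0| + `|vx p0| + 1.
have M0 : 0 < M by rewrite ltr_wpDl// !addr_ge0.
have /open_ballP/(_ _ Up)[d0 d00 Hd0] := oU.
have /cvg_plane_epsP/(_ _ c0)[d1 d10 Hd1] := cux.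
have /cvg_plane_epsP/(_ _ c0)[d2 d20 Hd2] := cuw.
have /cvg_plane_epsP/(_ _ ltr01)[d3 d30 Hd3] := cux.
have /cvg_plane_epsP/(_ _ ltr01)[d4 d40 Hd4] := cuy.
have /cvg_plane_epsP/(_ _ ltr01)[d5 d50 Hd5] := cvx.
pose r := Num.min d0 (Num.min d1 (Num.min d2 (Num.min d3 (Num.min d4 d5)))).
have r0 : 0 < r by rewrite !lt_min d00 d10 d20 d30 d40 d50.
have rU p : `|p - p0| < r -> U p by rewrite lt_min => /andP[/Hd0].
have B (a b : R) : `|a - b| < 1 -> `|a| < `|b| + 1.
  by move=> h; have := ler_distD b a 0; rewrite !subr0; clear -h; lra.
have H p : `|p - p0| < r ->
     [/\ c <= ux p <= M, `|uy p| <= M, `|vx p| <= M,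
         c <= ux p * wy p - uy p * wx p &
         k * `|w p| ^+ n <= ux p * vy p - uy p * vx p].
  rewrite !lt_min => /and5P[/Hd0 /J ? /Hd1 h1 /Hd2 h2 /Hd3/B h3].
  move=> /andP[/Hd4/B h4 /Hd5/B h5].
  have [c1 c2] : c <= ux p0 / 2 /\ c <= (ux p0 * wy p0 - uy p0 * wx p0) / 2.
    by rewrite /c; split; rewrite ge_min lexx ?orbT.
  have [n1 n2 n3] : [/\ 0 <= `|ux p0|, 0 <= `|uy p0| & 0 <= `|vx p0|] by [].
  split => //.
  - apply/andP; split; last by have := ler_norm (ux p); rewrite /M; clear -h3 n2 n3; lra.
    by move: h1 c1; clear; rewrite ltr_norml => /andP[? _] ?; lra.
  - by rewrite /M; clear -h4 n1 n3; lra.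
  - by rewrite /M; clear -h5 n1 n2; lra.
  - by move: h2 c2; clear; rewrite ltr_norml => /andP[? _] ?; lra.
have sub : [set p | `|p - p0| < r] `<=` U by move=> p /rU.
have [c' c'0 Hc'] := level_estimate r0 c0 M0 k0 (C1on_sub sub Cu) (C1on_sub sub Cv)
  (C1on_sub sub Cw) H.
have D0 : 0 < 1 + 2 * (M / c) by rewrite addr_gt0// mulr_gt0// divr_gt0.
have r'r : r / (1 + 2 * (M / c)) <= r.
  by rewrite ler_pdivrMr// ler_peMr ?ltW// ltrDl mulr_gt0// divr_gt0.
exists (r / (1 + 2 * (M / c))), (Num.min c c'); split.
- exact: divr_gt0.
- by rewrite lt_min c0 c'0.
- by move=> p pr; apply: rU; exact: lt_le_trans r'r.
move=> p q pr qr; split.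
  apply: le_trans (Hc' p q pr qr).
  by rewrite ler_wpM2r ?addr_ge0 ?exprn_ge0// ge_min lexx orbT.
move=> pq.
have /prod_ltP[p1 p2] := lt_le_trans pr r'r.
have /prod_ltP[q1 _] := lt_le_trans qr r'r.
have Hline s : between q.1 p.1 s -> `|(s, p.2) - p0| < r.
  by move=> /between_dist/(_ q1 p1) sr; apply/prod_ltP.
have [s sI E] := @MVT_between _ (fun s => u (s, p.2)) (fun s => ux (s, p.2)) q.1 p.1
  ltac:(by move=> s /Hline/rU/Cu[]).
have pE : (p.1, p.2) = p by case: (p).
have qE : (q.1, p.2) = q by rewrite pq; case: (q).
rewrite /= pE qE in E.
rewrite E normrM ler_wpM2r//.
have [/andP[B1 _] _ _ _ _] := H _ (Hline _ sI).
by rewrite (le_trans _ (ler_norm _))// (le_trans _ B1)// ge_min lexx.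
Qed.

End KernelPointwise.

(** * Integrals of powers on the line *)

Section SingularKernel1D.
Context {R : realType}.
Local Notation leb := (@lebesgue_measure R).

(** The singular weight [|x|^(- a)]. *)
Definition pw (a x : R) : R := `|x| `^ (- a).

Lemma pw_ge0 a x : 0 <= pw a x. Proof. exact: powR_ge0. Qed.

Lemma measurable_pw a (c : R) : measurable_fun setT (fun x : R => pw a (x - c)).
Proof.
apply: (measurableT_comp (measurable_powR (- a))).
apply: measurableT_comp; first exact: normr_measurable.
exact: measurable_funB.
Qed.

(** The segment lies on one side of [c]: on its right if [s = 1], on its left
    if [s = - 1]. *)
Lemma integral_pw_segment (a c s x y D : R) : a < 1 -> s ^+ 2 = 1 -> x < y ->
  (forall t, x <= t <= y -> 0 < s * (t - c) <= D) ->
  (\int[leb]_(t in `[x, y]) (pw a (t - c))%:E <= (D `^ (1 - a) / (1 - a))%:E)%E.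
Proof.
move=> a1 s2 xy H.
have s1 : s = 1 \/ s = -1.
  have : (s - 1) * (s + 1) = 0 by rewrite -subr_sqr expr1n s2 subrr.
  move/eqP; rewrite mulf_eq0 subr_eq0 addr_eq0 => /orP[/eqP ->|/eqP ->]; first by left.
  by right.
have a0 : 0 < 1 - a by rewrite subr_gt0.
have a0' : 1 - a != 0 by rewrite gt_eqF.
pose f t := (s * (t - c)) `^ (- a).
pose G t := s / (1 - a) * (s * (t - c)) `^ (1 - a).
have dl (t : R) : is_derive t 1 (fun t : R => s * (t - c)) s.
  apply: is_derive_eq; by rewrite /GRing.scale /= ; ring.
have dG (t : R) : x <= t <= y -> is_derive t 1 G (f t).
  move=> /H/andP[t0 _].
  have := @is_derive1_comp _ (fun z : R => z `^ (1 - a)) _ t _ _ (is_derive1_powR (1 - a) t0) (dl t).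
  move=> d; have := is_deriveZ (s / (1 - a)) d; rewrite /G /f.
  move=> d'; apply: is_derive_eq.
  rewrite /GRing.scale /= -[1 - a - 1]addrAC subrr add0r.
  by rewrite -[RHS]mul1r -[in RHS]s2; field.
have df (t : R) : x <= t <= y -> derivable f t 1.
  move=> /H/andP[t0 _].
  have [] // := @is_derive1_comp _ (fun z : R => z `^ (- a)) _ t _ _ (is_derive1_powR (- a) t0) (dl t).
have cG (t : R) : x <= t <= y -> {for t, continuous G}.
  by move=> /dG[d _]; apply: differentiable_continuous; exact/derivable1_diffP.
have -> : (\int[leb]_(t in `[x, y]) (pw a (t - c))%:E = \int[leb]_(t in `[x, y]) (f t)%:E)%E.
  apply: eq_integral => t; rewrite inE /= in_itv /= => /H/andP[t0 _].
  congr (_%:E); rewrite /pw /f; congr (_ `^ _).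
  by case: s1 => E; move: t0; rewrite E ?mul1r ?mulN1r => t0;
    [rewrite gtr0_norm|rewrite ltr0_norm// -oppr_gt0].
rewrite (@continuous_FTC2 _ f G x y xy).
- rewrite -EFinB lee_fin.
  have xI : x <= x <= y by rewrite lexx ltW.
  have yI : x <= y <= y by rewrite lexx ltW.
  have [/andP[x0 xD] /andP[y0 yD]] := (H x xI, H y yI).
  have Px := powR_ge0 (s * (x - c)) (1 - a). have Py := powR_ge0 (s * (y - c)) (1 - a).
  have Dx : (s * (x - c)) `^ (1 - a) <= D `^ (1 - a).
    by rewrite ge0_ler_powR ?nnegrE// ltW// (lt_le_trans x0).
  have Dy : (s * (y - c)) `^ (1 - a) <= D `^ (1 - a).
    by rewrite ge0_ler_powR ?nnegrE// ltW// (lt_le_trans x0).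
  rewrite /G -mulrBr mulrAC ler_pM2r ?invr_gt0//.
  by move: Px Py Dx Dy; case: s1 => ->; lra.
- apply: derivable_within_continuous => t; rewrite in_itv /=; exact: df.
- split.
  + by move=> t; rewrite in_itv /= => /andP[/ltW ? /ltW ?]; have [] : is_derive t 1 G (f t) by apply: dG; apply/andP.
  + by apply: cvg_at_right_filter; apply: cG; rewrite lexx ltW.
  + by apply: cvg_at_left_filter; apply: cG; rewrite lexx ltW.
- move=> t; rewrite in_itv /= => /andP[/ltW ? /ltW ?].
  by rewrite derive1E; have [_ ->] : is_derive t 1 G (f t) by apply: dG; apply/andP.
Qed.

Lemma ge0_integral_bigcup_le d (T : measurableType d) (mu : {measure set T -> \bar R})
    (F : (set T)^nat) (f : T -> \bar R) (B : \bar R) :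
  (forall n, F n `<=` F n.+1) -> (forall n, measurable (F n)) ->
  measurable_fun setT f -> (forall x, 0 <= f x)%E ->
  (forall n, \int[mu]_(x in F n) f x <= B)%E ->
  (\int[mu]_(x in \bigcup_n F n) f x <= B)%E.
Proof.
move=> ndF mF mf f0 H.
have nd : nondecreasing_seq F by apply/nondecreasing_seqP => n; exact/subsetPset.
have C := @ge0_nondecreasing_set_cvg_integral _ _ _ F f mu nd mF
  (fun i => measurable_funTS mf) (fun i x _ => f0 x).
apply: cvge_le C; exact: nearW.
Qed.

(** The bound is uniform in the position [c] of the singularity. *)
Lemma integral_pw (a D : R) : 0 < a < 1 -> 0 < D ->
  exists2 B : R, 0 <= B & forall c x y, (forall t, x <= t <= y -> `|t - c| <= D) ->
   (\int[leb]_(t in `[x, y]) (pw a (t - c))%:E <= B%:E)%E.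
Proof.
move=> /andP[a0 a1] D0.
pose B := D `^ (1 - a) / (1 - a).
have B0 : 0 <= B by rewrite divr_ge0 ?powR_ge0// subr_ge0 ltW.
exists (B + B); first exact: addr_ge0.
move=> c x y H.
have mpw : measurable_fun setT (fun t : R => (pw a (t - c))%:E).
  by apply/measurable_EFinP; exact: measurable_pw.
have pw0 (t : R) : (0 <= (pw a (t - c))%:E)%E by rewrite lee_fin pw_ge0.
pose d (n : nat) : R := D / n.+2%:R.
have Dn n : 0 < d n < D.
  by rewrite divr_gt0//= ltr_pdivrMr// ltr_pMr// ltr1n.
have Dnn n : d n.+1 <= d n.
  by rewrite ler_pM2l// lef_pV2 ?posrE// ler_nat.
have ex (t : R) : 0 < t -> exists n : nat, d n <= t.
  move=> t0; exists (Num.bound (D / t)).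
  have := archi_boundP (ltW (divr_gt0 D0 t0)); rewrite ltr_pdivrMr// => H1.
  rewrite ler_pdivrMr// (le_trans (ltW H1))// mulrC ler_pM2l// ler_nat.
  by rewrite ltnW.
clearbody d.
pose F1 n := `[c + d n, c + D]%classic.
pose F2 n := `[c - D, c - d n]%classic.
have I1 : (\int[leb]_(t in \bigcup_n F1 n) (pw a (t - c))%:E <= B%:E)%E.
  apply: ge0_integral_bigcup_le => // n.
    move=> t; rewrite /F1 /= !in_itv /= => /andP[? ->]; rewrite andbT.
    by have := Dnn n; lra.
  - exact: measurable_itv.
  have /andP[? ?] := Dn n.
  rewrite /F1 /B; apply: (@integral_pw_segment a c 1); rewrite ?expr1n//; first lra.
  by move=> t /andP[? ?]; rewrite mul1r; apply/andP; split; lra.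
have I2 : (\int[leb]_(t in \bigcup_n F2 n) (pw a (t - c))%:E <= B%:E)%E.
  apply: ge0_integral_bigcup_le => // n.
    move=> t; rewrite /F2 /= !in_itv /= => /andP[-> ?] /=.
    by have := Dnn n; lra.
  - exact: measurable_itv.
  have /andP[? ?] := Dn n.
  rewrite /F2 /B; apply: (@integral_pw_segment a c (- 1)); rewrite ?sqrrN ?expr1n//; first lra.
  by move=> t /andP[? ?]; rewrite mulN1r; apply/andP; split; lra.
have mF1 : measurable (\bigcup_n F1 n) by apply: bigcupT_measurable => n; exact: measurable_itv.
have mF2 : measurable (\bigcup_n F2 n) by apply: bigcupT_measurable => n; exact: measurable_itv.
have sub : `[x, y] `<=` [set c] `|` (\bigcup_n F1 n `|` \bigcup_n F2 n).
  move=> t; rewrite /= in_itv /= => /H; rewrite ler_norml => /andP[t1 t2].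
  have [tc|tc|->] := ltgtP t c; [right; right|right; left|by left].
    have [|n Hn] := ex (c - t); first lra.
    by exists n => //; rewrite /F2 /= in_itv /=; apply/andP; split; lra.
  have [|n Hn] := ex (t - c); first lra.
  by exists n => //; rewrite /F1 /= in_itv /=; apply/andP; split; lra.
have d12 : [disjoint \bigcup_n F1 n & \bigcup_n F2 n].
  apply/disj_setPS => t [[n _] + [m _]]; rewrite /F1 /F2 /= !in_itv /=.
  by move=> /andP[? _] /andP[_ ?]; have := Dn n; have := Dn m; lra.
have dc : [disjoint [set c] & \bigcup_n F1 n `|` \bigcup_n F2 n].
  apply/disj_setPS => t [-> [] [n _]]; rewrite /F1 /F2 /= !in_itv /= => /andP[? ?];
  by have := Dn n; lra.
apply: (@le_trans _ _ (\int[leb]_(t in [set c] `|` (\bigcup_n F1 n `|` \bigcup_n F2 n))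
   (pw a (t - c))%:E)%E).
  apply: ge0_subset_integral => //.
  - by apply: measurableU => //; exact: measurableU.
  - exact: measurable_funTS.
rewrite ge0_integral_setU//; [|exact: measurableU|exact: measurable_funTS].
rewrite integral_set1 add0e ge0_integral_setU//; last exact: measurable_funTS.
by rewrite EFinD; exact: leeD.
Qed.

End SingularKernel1D.

(** * A singular integral in the plane *)

Section SingularKernelPlane.
Context {R : realType}.
Local Notation leb := (@lebesgue_measure R).
Local Notation leb2 := (@lebesgue_measure R \x @lebesgue_measure R)%E.

Lemma weighted_young (a b t : R) : 0 < a -> 0 < b -> 0 <= t <= 1 ->
  a `^ t * b `^ (1 - t) <= a + b.
Proof.
move=> a0 b0 /andP[t0 t1].
have m0 : 0 < Num.max a b by rewrite lt_max a0.
apply: (@le_trans _ _ (Num.max a b)); last by rewrite ge_max; lra.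
have -> : Num.max a b = Num.max a b `^ t * Num.max a b `^ (1 - t).
  rewrite -powRD; last by rewrite (gt_eqF m0) implybT.
  by rewrite addrC subrK powRr1// ltW.
rewrite ler_pM ?powR_ge0// ge0_ler_powR ?nnegrE ?(ltW a0) ?(ltW b0) ?(ltW m0)//.
- by rewrite le_max lexx.
- by rewrite subr_ge0.
- by rewrite le_max lexx orbT.
Qed.

(** By [weighted_young], [K] is at most a constant times
    [|x - X y|^(- th) |y - y0|^(- 1 / 2)] for some [th < 1], and each factor has
    a bounded integral, uniformly in [X] and [y0]. *)
Lemma plane_singular_bound (p0 : R * R) (r c : R) (n : nat) : 0 < r -> 0 < c ->
  exists2 C : R, 0 <= C & forall (K : R * R -> R) (y0 : R) (X : R -> R),
    measurable_fun (closed_square p0 r) K ->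
    (forall p, closed_square p0 r p -> 0 <= K p) ->
    `|y0 - p0.2| <= r -> (forall y, `|X y - p0.1| <= r) ->
    (forall p, closed_square p0 r p -> p.1 != X p.2 -> p.2 != y0 ->
       c * (`|p.1 - X p.2| + `|p.2 - y0| ^+ n.+1) <= (K p)^-1) ->
    (\int[leb2]_(p in closed_square p0 r) (K p)%:E <= C%:E)%E.
Proof.
move=> r0 c0.
(* the exponent [th = 1 - 1 / N] is such that [(n + 1) (1 - th) = 1 / 2] *)
pose N : R := 2 * n.+1%:R.
have n1 : 1 <= n.+1%:R :> R by rewrite ler1n.
have N2 : 1 < N by rewrite /N; lra.
have N0 : 0 < N by lra.
pose th := 1 - N^-1.
have Ni : 0 < N^-1 < 1 by rewrite invr_gt0 N0 invf_lt1.
have th01 : 0 < th < 1 by rewrite /th; move: Ni => /andP[? ?]; apply/andP; split; lra.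
have hf : 0 < (2^-1 : R) < 1 by apply/andP; split; lra.
have r2 : 0 < 2 * r by lra.
have [B1 B10 HB1] := integral_pw th01 r2.
have [B2 B20 HB2] := integral_pw hf r2.
exists (c^-1 * B1 * B2); first by rewrite !mulr_ge0// invr_ge0 ltW.
move=> K y0 X mK K0 y0r Xr HK.
have ci : 0 <= c^-1 by rewrite invr_ge0 ltW.
pose I1 := `[p0.1 - r, p0.1 + r]%classic.
pose I2 := `[p0.2 - r, p0.2 + r]%classic.
have mI1 : measurable I1 by exact: measurable_itv.
have mI2 : measurable I2 by exact: measurable_itv.
have HKle x y : I1 x -> I2 y -> x != X y -> y != y0 ->
    K (x, y) <= c^-1 * pw th (x - X y) * pw 2^-1 (y - y0).
  move=> Ix Iy xX yy0.
  have Sp : closed_square p0 r (x, y) by [].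
  have a0 : 0 < `|x - X y| by rewrite normr_gt0 subr_eq0.
  have b0 : 0 < `|y - y0| by rewrite normr_gt0 subr_eq0.
  have H := HK _ Sp xX yy0; rewrite /= in H.
  have h : `|x - X y| `^ th * `|y - y0| `^ 2^-1 <= `|x - X y| + `|y - y0| ^+ n.+1.
    have -> : `|y - y0| `^ 2^-1 = (`|y - y0| ^+ n.+1) `^ (1 - th).
      rewrite -powR_mulrn ?(ltW b0)// -powRrM; congr (_ `^ _).
      by rewrite /th /N; field.
    apply: weighted_young => //; first exact: exprn_gt0.
    by move: th01 => /andP[? ?]; apply/andP; split; exact: ltW.
  have m0 : 0 < `|x - X y| `^ th * `|y - y0| `^ 2^-1 by rewrite mulr_gt0 ?powR_gt0.
  have -> : c^-1 * pw th (x - X y) * pw 2^-1 (y - y0) =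
      (c * (`|x - X y| `^ th * `|y - y0| `^ 2^-1))^-1.
    by rewrite /pw !powRN !invfM mulrA.
  rewrite -[leLHS]invrK; have D0 : 0 < (K (x, y))^-1.
    by apply: lt_le_trans H; rewrite mulr_gt0// addr_gt0// exprn_gt0.
  rewrite lef_pV2 ?posrE ?(mulr_gt0 c0 m0)//.
  by apply: le_trans H; rewrite ler_pM2l.
have mS := measurable_closed_square p0 r.
rewrite integral_mkcond.
set f := (X in (\int[leb2]_p X p)%E).
have mf : measurable_fun setT f.
  by apply/(measurable_restrictT _ mS); apply/measurable_EFinP.
have f0 p : (0 <= f p)%E.
  by rewrite /f patchE; case: ifPn => // /set_mem Sp; rewrite lee_fin K0.
rewrite (fubini_tonelli2 f mf f0).
have bnd y : y != y0 -> (fubini_G leb f y <=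
    ((fun y => (c^-1 * B1)%:E * (pw 2^-1 (y - y0))%:E) \_ I2) y)%E.
  move=> yy0; rewrite /fubini_G patchE; case: ifPn => [/set_mem Iy|/negP nIy]; last first.
    rewrite integral0_eq// => x _; rewrite /f patchE; case: ifPn => // /set_mem [_ Iy].
    by exfalso; apply: nIy; apply/mem_set.
  have mfy : measurable_fun setT (fun x : R => f (x, y)).
    apply: (measurableT_comp mf); exact: measurable_pair2.
  pose g := (fun x : R => ((c^-1 * pw 2^-1 (y - y0)) * pw th (x - X y))%:E) \_ I1.
  have mg : measurable_fun setT g.
    apply/(measurable_restrictT _ mI1)/measurable_EFinP; apply: measurable_funM => //.
    exact: measurable_funTS (measurable_pw _ _).
  have k0 : 0 <= c^-1 * pw 2^-1 (y - y0) by rewrite mulr_ge0 ?pw_ge0.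
  have g0 x : (0 <= g x)%E.
    by rewrite /g patchE; case: ifPn => // _; rewrite lee_fin mulr_ge0 ?pw_ge0.
  have fg : (\int[leb]_x f (x, y) <= \int[leb]_x g x)%E.
    apply: ae_ge0_le_integral => //; exists [set X y]; split => //.
      exact: lebesgue_measure_set1.
    move=> x /= /not_implyP[_ H]; apply: contrapT => /eqP xX; apply: H.
    rewrite /f /g !patchE; case: ifPn => [/set_mem[Ix _]|_]; last by case: ifPn; rewrite ?lee_fin ?mulr_ge0 ?pw_ge0.
    rewrite mem_set//= lee_fin mulrAC; exact: HKle.
  apply: (le_trans fg); rewrite /g -integral_mkcond.
  under eq_integral do rewrite EFinM.
  rewrite ge0_integralZl//; last 2 first.
  - apply/measurable_EFinP; exact: measurable_funTS (measurable_pw _ _).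
  - by move=> x _; rewrite lee_fin pw_ge0.
  have Hb : (\int[leb]_(x in I1) (pw th (x - X y))%:E <= B1%:E)%E.
    apply: HB1 => t /andP[t1 t2]; have := Xr y; clear -t1 t2; rewrite !ler_norml => /andP[? ?].
    by apply/andP; split; lra.
  apply: (le_trans (lee_wpmul2l _ Hb)); first by rewrite lee_fin.
  by rewrite -!EFinM lee_fin mulrAC.
have mg2 : measurable_fun setT ((fun y => (c^-1 * B1)%:E * (pw 2^-1 (y - y0))%:E) \_ I2)%E.
  apply/(measurable_restrictT _ mI2); apply: emeasurable_funM; first exact: measurable_cst.
  apply/measurable_EFinP; exact: measurable_funTS (measurable_pw _ _).
have cB : 0 <= c^-1 * B1 by rewrite mulr_ge0.
apply: (@le_trans _ _ (\int[leb]_y ((fun y => (c^-1 * B1)%:E * (pw 2^-1 (y - y0))%:E) \_ I2) y)%E).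
  apply: ae_ge0_le_integral => //.
  - by move=> y _; apply: integral_ge0.
  - exact: measurable_fun_fubini_tonelli_G.
  - by move=> y _; rewrite patchE; case: ifPn => // _; rewrite -EFinM lee_fin mulr_ge0 ?pw_ge0.
  exists [set y0]; split => //; first exact: lebesgue_measure_set1.
  move=> y /= /not_implyP[_ H]; apply: contrapT => /eqP yy; apply: H.
  exact: bnd.
rewrite -integral_mkcond ge0_integralZl//; last 2 first.
- by apply/measurable_EFinP; exact: measurable_funTS (measurable_pw _ _).
- by move=> x _; rewrite lee_fin pw_ge0.
rewrite [leRHS]EFinM; apply: lee_wpmul2l; first by rewrite lee_fin.
apply: HB2 => t /andP[t1 t2]; move: y0r; clear -t1 t2; rewrite !ler_norml => /andP[? ?].
by apply/andP; split; lra.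
Qed.

End SingularKernelPlane.

(** * Local integrability of the kernel *)

Section LocalKernel.
Context {R : realType}.
Local Notation leb := (@lebesgue_measure R).
Local Notation leb2 := (@lebesgue_measure R \x @lebesgue_measure R)%E.
Implicit Types (U : set (R * R)) (p q : R * R) (u v w : R * R -> R).

(** A norm of [Z p - Z q], for [Z = u + i v]. *)
Definition dist1 u v p q : R := `|u p - u q| + `|v p - v q|.

Lemma dist1_ge0 u v p q : 0 <= dist1 u v p q. Proof. exact: addr_ge0. Qed.

(** [1 / |Z p - Z q|] has a bounded integral in [p] over some square centred at
    [p0], uniformly for [q] in the same square. *)
Definition kernel_bounded u v U p0 : Prop :=
  exists r C : R, [/\ 0 < r, closed_square p0 r `<=` U &
    forall q, closed_square p0 r q ->
      (\int[leb2]_(p in closed_square p0 r) (dist1 u v p q)^-1%:E <= C%:E)%E].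

Lemma measurable_dist1 U u v q : open U ->
  (forall p, U p -> {for p, continuous u}) ->
  (forall p, U p -> {for p, continuous v}) ->
  measurable_fun U (fun p => dist1 u v p q).
Proof.
move=> oU cu cv.
have mu := open_continuous_measurable_plane oU cu.
have mv := open_continuous_measurable_plane oU cv.
by apply: measurable_funD; apply: measurableT_comp => //; apply: measurable_funB.
Qed.

Lemma measurable_invr : measurable_fun setT (@GRing.inv R).
Proof.
have oN0 : open [set x : R | x != 0] by exact: open_neq.
have -> : [set: R] = [set x : R | x != 0] `|` [set 0].
  by apply/seteqP; split=> // x _; have [->|] := eqVneq x 0; [right|left].
apply/measurable_funU => //; first exact: open_measurable.
split; last exact: measurable_fun_set1.
apply: open_continuous_measurable_fun => // x; rewrite inE /= => x0.
exact: inv_continuous.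
Qed.

Lemma measurable_funV d (T : measurableType d) (D : set T) (f : T -> R) :
  measurable_fun D f -> measurable_fun D (fun x => (f x)^-1).
Proof. exact: (measurableT_comp measurable_invr). Qed.

Lemma kernel_bounded_x U p0 (k : R) (n : nat) u ux uy v vx vy w wx wy :
  open U -> U p0 -> 0 < k ->
  C1on U u ux uy -> C1on U v vx vy -> C1on U w wx wy ->
  ux p0 != 0 -> ux p0 * wy p0 - uy p0 * wx p0 != 0 ->
  (forall p, U p -> k * `|w p| ^+ n <= ux p * vy p - uy p * vx p) ->
  kernel_bounded u v U p0.
Proof.
move=> oU Up k0 Cu Cv Cw ux0 uw0 J.
have [r [c [r0 c0 rU H]]] := kernel_pointwise oU Up k0 Cu Cv Cw ux0 uw0 J.
pose r' := r / 2; have r'0 : 0 < r' by rewrite divr_gt0.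
have r'r : r' < r by rewrite /r'; lra.
have Sr p : closed_square p0 r' p -> `|p - p0| < r.
  by rewrite closed_square_normE /= => /le_lt_trans; apply.
pose c1 := Num.min c 1.
have c10 : 0 < c1 by rewrite lt_min c0 ltr01.
pose c2 := c * (c1 / 2).
have c20 : 0 < c2 by rewrite mulr_gt0// divr_gt0.
have [C C0 HC] := plane_singular_bound p0 n r'0 c20.
exists r', C; split => // [p /Sr/rU//|q Sq].
have /Sr qr := Sq.
(* [X y] is a point of the horizontal segment at height [y] where [|u - u q|]
   is least *)
have ex y : exists x, `|x - p0.1| <= r' /\ (`|y - p0.2| <= r' ->
    forall t, `|t - p0.1| <= r' -> `|u (x, y) - u q| <= `|u (t, y) - u q|).
  have [yr|_] := leP `|y - p0.2| r'; last first.
    by exists p0.1; rewrite subrr normr0; split; [exact: ltW|].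
  have Ir t : (t \in `[p0.1 - r', p0.1 + r']) = (`|t - p0.1| <= r').
    by rewrite in_itv /= ler_distl.
  have [||x] := @EVT_min _ (fun t => `|u (t, y) - u q|) (p0.1 - r') (p0.1 + r').
  - by clear -r'0; lra.
  - have cu : {within `[p0.1 - r', p0.1 + r'], continuous (fun t => u (t, y))}.
      apply: derivable_within_continuous => t; rewrite Ir => tr.
      have tU : U (t, y) by apply: rU; apply: Sr; apply/closed_squareP.
      by have [[]] := Cu _ tU.
    by move=> t; apply: cvg_norm; apply: cvgB; [exact: cu|exact: cvg_cst].
  rewrite Ir => xr Hx; exists x; split => // _ t; rewrite -Ir; exact: Hx.
have [X HX] := choice ex.
have Ure p : closed_square p0 r' p -> U p by move=> /Sr/rU.
apply: (HC _ q.2 X).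
- apply: measurable_funV.
  apply: (@measurable_funS _ _ _ _ U) => //; first exact: open_measurable_plane.
  by apply: measurable_dist1 => // p Upp; [exact: (C1on_continuous oU Cu)|exact: (C1on_continuous oU Cv)].
- by move=> p _; rewrite invr_ge0 dist1_ge0.
- by move/closed_squareP : Sq => [].
- by move=> y; have [] := HX y.
move=> p Sp _ _; rewrite invrK.
have [/= H1 _] := H p q (Sr _ Sp) qr.
apply: le_trans H1; rewrite /c2 -mulrA ler_pM2l//.
have /closed_squareP[p1 p2] := Sp.
have [X1 X2] := HX p.2.
have Xp : `|(X p.2, p.2) - p0| < r by apply: Sr; apply/closed_squareP.
have [_ H2] := H p (X p.2, p.2) (Sr _ Sp) Xp.
have h2 := H2 erefl; rewrite /= in h2.
have h3 := X2 p2 p.1 p1; rewrite -surjective_pairing in h3.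
have h4 := ler_distD (u q) (u p) (u (X p.2, p.2)).
rewrite (distrC (u q)) in h4.
have h5 : c1 * `|p.1 - X p.2| <= c * `|p.1 - X p.2| by rewrite ler_wpM2r// ge_min lexx.
have h6 : c1 * `|p.2 - q.2| ^+ n.+1 <= `|p.2 - q.2| ^+ n.+1.
  by rewrite ler_piMl ?exprn_ge0// ge_min lexx orbT.
have h7 : 0 <= `|p.2 - q.2| ^+ n.+1 by rewrite exprn_ge0.
have -> : c1 / 2 * (`|p.1 - X p.2| + `|p.2 - q.2| ^+ n.+1) =
  (c1 * `|p.1 - X p.2| + c1 * `|p.2 - q.2| ^+ n.+1) / 2 by field.
by clear -h2 h3 h4 h5 h6 h7; lra.
Qed.

Lemma ge0_integral_swap (f : R * R -> \bar R) :
  measurable_fun setT f -> (forall p, 0 <= f p)%E ->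
  (\int[leb2]_p f p = \int[leb2]_p f (swap p))%E.
Proof.
move=> mf f0.
have ms : measurable_fun setT (@swap R).
  by apply/measurable_fun_pairP; split; [exact: measurable_snd|exact: measurable_fst].
have mfs : measurable_fun setT (f \o @swap R) by exact: measurableT_comp.
have E1 : (\int[leb2]_p f p = \int[leb]_x \int[leb]_y f (x, y))%E.
  exact: fubini_tonelli1.
have E2 : (\int[leb2]_p (f \o @swap R) p = \int[leb]_y \int[leb]_x f (y, x))%E.
  exact: (@fubini_tonelli2 _ _ _ _ _ leb leb (f \o @swap R) mfs (fun p => f0 (swap p))).
by rewrite E1 -E2.
Qed.

Lemma closed_square_swap p0 r p :
  closed_square (swap p0) r p <-> closed_square p0 r (swap p).
Proof. by rewrite !closed_squareP /=; split=> -[]. Qed.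

Lemma kernel_bounded_swap U p0 u v : open U ->
  (forall p, U p -> {for p, continuous u}) ->
  (forall p, U p -> {for p, continuous v}) ->
  kernel_bounded (u \o @swap R) (v \o @swap R) (@swap R @^-1` U) (swap p0) ->
  kernel_bounded u v U p0.
Proof.
move=> oU cu cv [r [C [r0 rU H]]].
have SU : closed_square p0 r `<=` U.
  by move=> p Sp; rewrite -(swapK p); apply: rU; apply/closed_square_swap; rewrite swapK.
exists r, C; split => // q Sq.
have Sq' : closed_square (swap p0) r (swap q) by apply/closed_square_swap; rewrite swapK.
apply: le_trans (H _ Sq').
have mS := measurable_closed_square p0 r.
rewrite integral_mkcond [in leRHS]integral_mkcond ge0_integral_swap.
- suff -> : (fun p => ((fun p => (dist1 u v p q)^-1%:E) \_ (closed_square p0 r)) (swap p)) =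
    (fun p => (dist1 (u \o @swap R) (v \o @swap R) p (swap q))^-1%:E) \_
      (closed_square (swap p0) r) by [].
  apply/funext => p; rewrite !patchE /dist1 /= swapK.
  congr (if _ then _ else _); apply/idP/idP => /set_mem h; apply/mem_set;
  exact/closed_square_swap.
- apply/(measurable_restrictT _ mS)/measurable_EFinP/measurable_funV.
  apply: (@measurable_funS _ _ _ _ U) => //; first exact: open_measurable_plane.
  exact: measurable_dist1.
- by move=> p; rewrite patchE; case: ifPn => // _; rewrite lee_fin invr_ge0 dist1_ge0.
Qed.

(** If [u_x] vanishes at [p0] then [u_y] does not, and the coordinates can be
    exchanged; this reverses the sign of Jacobians, whence the sign of [v]. *)
Lemma kernel_bounded_w U p0 (k : R) (n : nat) u ux uy v vx vy w wx wy :
  open U -> U p0 -> 0 < k ->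
  C1on U u ux uy -> C1on U v vx vy -> C1on U w wx wy ->
  ux p0 * wy p0 - uy p0 * wx p0 != 0 ->
  (forall p, U p -> k * `|w p| ^+ n <= ux p * vy p - uy p * vx p) ->
  kernel_bounded u v U p0.
Proof.
move=> oU Up k0 Cu Cv Cw uw0 J.
have [ux0|ux0] := eqVneq (ux p0) 0; last first.
  exact: (kernel_bounded_x oU Up k0 Cu Cv Cw ux0 uw0 J).
have uy0 : uy p0 != 0.
  by apply: contra_neq uw0 => uy0; rewrite ux0 uy0 !mul0r subrr.
apply: kernel_bounded_swap => //.
- by move=> p; exact: (C1on_continuous oU Cu).
- by move=> p; exact: (C1on_continuous oU Cv).
have [r [C [r0 rU H]]] := kernel_bounded_x (p0 := swap p0) (n := n) (open_swap oU)
  ltac:(by rewrite /preimage /= swapK) k0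
  (C1on_swap Cu) (C1on_swap (C1onN Cv)) (C1on_swap Cw)
  ltac:(by rewrite /= swapK)
  ltac:(by rewrite /= swapK -opprB oppr_eq0)
  ltac:(by move=> p /J; rewrite /= !mulrN; lra).
exists r, C; split => // q /H.
by under eq_integral do rewrite /dist1 /= -opprD normrN.
Qed.

Lemma kernel_bounded_sub U V p0 u v : V `<=` U ->
  kernel_bounded u v V p0 -> kernel_bounded u v U p0.
Proof.
by move=> VU [r [C [r0 rV H]]]; exists r, C; split => // p /rV/VU.
Qed.

(** The bound for [- i Z] gives the bound for [Z]. *)
Lemma kernel_bounded_rot U p0 u v :
  kernel_bounded v (fun p => - u p) U p0 -> kernel_bounded u v U p0.
Proof.
move=> [r [C [r0 rU H]]]; exists r, C; split => // q /H.
by under eq_integral do rewrite /dist1 -opprD normrN addrC.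
Qed.

(** The Jacobian of [Z = u + i v] is bounded below by a power of [|w|], and one
    of [{u, w}] and [{v, w}] is nonzero at [p0]. *)
Lemma kernel_bounded_transverse U p0 (k : R) (n : nat) u ux uy v vx vy w wx wy :
  open U -> U p0 -> 0 < k ->
  C1on U u ux uy -> C1on U v vx vy -> C1on U w wx wy ->
  ux p0 * wy p0 - uy p0 * wx p0 != 0 \/ vx p0 * wy p0 - vy p0 * wx p0 != 0 ->
  (forall p, U p -> k * `|w p| ^+ n <= ux p * vy p - uy p * vx p) ->
  kernel_bounded u v U p0.
Proof.
move=> oU Up k0 Cu Cv Cw [uw0|vw0] J.
  exact: (kernel_bounded_w oU Up k0 Cu Cv Cw uw0 J).
apply: kernel_bounded_rot.
apply: (kernel_bounded_w oU Up k0 Cv (C1onN Cu) Cw vw0 (n := n)).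
by move=> p /J; lra.
Qed.

Lemma C1on_fst U : C1on U (fun p : R * R => p.1) (fun=> 1) (fun=> 0).
Proof.
move=> p _; split => /=; [exact: is_derive_id|exact: is_derive_cst|exact: cst_continuous|exact: cst_continuous].
Qed.

Lemma C1on_snd U : C1on U (fun p : R * R => p.2) (fun=> 0) (fun=> 1).
Proof.
move=> p _; split => /=; [exact: is_derive_cst|exact: is_derive_id|exact: cst_continuous|exact: cst_continuous].
Qed.

(** Where the Jacobian is positive, a coordinate function can serve as [w],
    with exponent 0. *)
Lemma kernel_bounded_elliptic U p0 u ux uy v vx vy :
  open U -> U p0 -> C1on U u ux uy -> C1on U v vx vy ->
  0 < ux p0 * vy p0 - uy p0 * vx p0 -> kernel_bounded u v U p0.
Proof.
move=> oU Up Cu Cv J0.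
set k := (ux p0 * vy p0 - uy p0 * vx p0) in J0 *.
have [_ _ cux cuy] := Cu _ Up; have [_ _ cvx cvy] := Cv _ Up.
have cJ : {for p0, continuous (fun p => ux p * vy p - uy p * vx p)}.
  by apply: continuousB; apply: continuousM.
have k2 : 0 < k / 2 by rewrite divr_gt0.
have /cvg_plane_epsP/(_ _ k2)[d d0 Hd] := cJ.
have /open_ballP/(_ _ Up)[e e0 He] := oU.
pose r := Num.min d e.
have r0 : 0 < r by rewrite lt_min d0 e0.
pose V := [set p : R * R | `|p - p0| < r].
have oV : open V.
  exact: open_norm_ball.
have Vp : V p0 by rewrite /V /= subrr normr0.
have VU : V `<=` U by move=> p; rewrite /V /= lt_min => /andP[_ /He].
have J p : V p -> k / 2 <= ux p * vy p - uy p * vx p.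
  rewrite /V /= lt_min => /andP[/Hd + _]; rewrite -/k ltr_norml => /andP[? _].
  by lra.
apply: (kernel_bounded_sub VU).
have [ux0|ux0] := eqVneq (ux p0) 0; last first.
  apply: (kernel_bounded_w (n := 0) oV Vp k2 (C1on_sub VU Cu) (C1on_sub VU Cv) (@C1on_snd V)).
    by rewrite mulr1 mulr0 subr0.
  by move=> p /J; rewrite expr0 mulr1.
apply: (kernel_bounded_w (n := 0) oV Vp k2 (C1on_sub VU Cu) (C1on_sub VU Cv) (@C1on_fst V)).
  rewrite mulr1 mulr0 sub0r oppr_eq0; apply/negP => /eqP uy0.
  by move: J0; rewrite /k ux0 uy0 !mul0r subrr ltxx.
by move=> p /J; rewrite expr0 mulr1.
Qed.

End LocalKernel.

(** * Integrability of the kernel over compact sets *)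

Section CompactKernel.
Context {R : realType}.
Local Notation leb := (@lebesgue_measure R).
Local Notation leb2 := (@lebesgue_measure R \x @lebesgue_measure R)%E.
Implicit Types (U S K : set (R * R)) (p q : R * R) (u v w : R * R -> R).

Lemma plane_hausdorff : hausdorff_space (R * R)%type.
Proof. exact: norm_hausdorff. Qed.

Lemma compact_measurable_plane K : compact K -> measurable K.
Proof.
move=> /(compact_closed plane_hausdorff)/closed_openC/open_measurable_plane.
by move/measurableC; rewrite setCK.
Qed.

Lemma leb2_closed_square p0 (r : R) : (leb2 (closed_square p0 r) < +oo)%E.
Proof.
have h (a : R) : (leb [set` `[(a - r)%R, (a + r)%R]] < +oo)%E.
  rewrite lebesgue_measure_itv /=; case: ifP => _; last exact: ltry.
  by rewrite -EFinB ltry.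
rewrite /closed_square product_measure1E; [|exact: measurable_itv|exact: measurable_itv].
apply: lte_mul_pinfty; [exact: measure_ge0| |exact: h].
by rewrite ge0_fin_numE; [exact: h|exact: measure_ge0].
Qed.

(** [1 / |Z p - Z q|] has a bounded integral in [p] over [S], uniformly for [q]
    in [U]. *)
Definition kernel_bounded_on u v U S : Prop :=
  exists2 C : R, 0 <= C & forall q, U q ->
    (\int[leb2]_(p in S) (dist1 u v p q)^-1%:E <= C%:E)%E.

Lemma measurable_kernel U u v q : open U ->
  (forall p, U p -> {for p, continuous u}) ->
  (forall p, U p -> {for p, continuous v}) ->
  measurable_fun U (fun p => (dist1 u v p q)^-1%:E).
Proof.
move=> oU cu cv; apply/measurable_EFinP; apply: measurable_funV.
exact: measurable_dist1.
Qed.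

(** The local bound holds on a smaller square for all [q] in [U], since [Z q]
    stays away from [Z p0] when [q] is far from [p0]. *)
Lemma kernel_bounded_far U u v p0 : open U -> U p0 ->
  (forall p, U p -> {for p, continuous u}) ->
  (forall p, U p -> {for p, continuous v}) ->
  (forall e : R, 0 < e -> exists2 h : R, 0 < h & forall q, U q ->
     dist1 u v q p0 < h -> `|q - p0| < e) ->
  kernel_bounded u v U p0 ->
  exists r : R, [/\ 0 < r, closed_square p0 r `<=` U &
    kernel_bounded_on u v U (closed_square p0 r)].
Proof.
move=> oU Up cu cv inj [r [C [r0 rU H]]].
have [h h0 Hh] := inj r r0.
have h4 : 0 < h / 4 by rewrite divr_gt0.
have /cvg_plane_epsP/(_ _ h4)[d1 d10 Hd1] := cu _ Up.
have /cvg_plane_epsP/(_ _ h4)[d2 d20 Hd2] := cv _ Up.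
pose r' := Num.min r (Num.min d1 d2 / 2).
have m0 : 0 < Num.min d1 d2 by rewrite lt_min d10.
have r'0 : 0 < r' by rewrite lt_min r0 divr_gt0.
have rr : r' <= r by rewrite ge_min lexx.
have sub : closed_square p0 r' `<=` closed_square p0 r.
  by rewrite !closed_square_normE => p /= /le_trans; apply.
have near p : closed_square p0 r' p -> dist1 u v p p0 < h / 2.
  rewrite closed_square_normE /= => pr.
  have : `|p - p0| < Num.min d1 d2.
    apply: le_lt_trans pr _; apply: (@le_lt_trans _ _ (Num.min d1 d2 / 2)).
      by rewrite ge_min lexx orbT.
    by rewrite ltr_pdivrMr// ltr_pMr// ltr1n.
  by rewrite lt_min => /andP[/Hd1 ? /Hd2 ?]; rewrite /dist1; lra.
exists r'; split => //; first exact: subset_trans rU.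
have mS' := measurable_closed_square p0 r'.
have mk q := measurable_kernel q oU cu cv.
have k0 q p : (0 <= (dist1 u v p q)^-1%:E)%E by rewrite lee_fin invr_ge0 dist1_ge0.
pose A := fine (leb2 (closed_square p0 r')).
have A0 : 0 <= A by exact: fine_ge0.
have AE : (leb2 (closed_square p0 r') = A%:E)%E.
  by rewrite /A fineK// ge0_fin_numE// leb2_closed_square.
exists (`|C| + 2 / h * A); first by rewrite addr_ge0// mulr_ge0// divr_ge0// ltW.
move=> q Uq.
have [/H Hq|nSq] := pselect (closed_square p0 r q).
  apply: (@le_trans _ _ C%:E); last first.
    by rewrite lee_fin (le_trans (ler_norm _))// lerDl mulr_ge0// divr_ge0// ltW.
  apply: le_trans Hq; apply: ge0_subset_integral => //.
  - exact: measurable_closed_square.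
  - exact: measurable_funS (open_measurable_plane oU) rU (mk q).
have far : h <= dist1 u v q p0.
  rewrite leNgt; apply/negP => /(Hh _ Uq) /ltW qr; apply: nSq.
  by rewrite closed_square_normE.
apply: (@le_trans _ _ (\int[leb2]_(p in closed_square p0 r') (2 / h)%:E)%E).
  apply: ge0_le_integral => //.
  - exact: measurable_funS (open_measurable_plane oU) (subset_trans sub rU) (mk q).
  move=> p /near ph; rewrite lee_fin.
  have : h / 2 <= dist1 u v p q.
    have := ler_distD (u p) (u q) (u p0); have := ler_distD (v p) (v q) (v p0).
    move: far ph; rewrite /dist1 (distrC (u p) (u q)) (distrC (v p) (v q)); clear; lra.
  move=> hd; have h2 : 0 < h / 2 by rewrite divr_gt0.
  by rewrite -invf_div lef_pV2 ?posrE// (lt_le_trans h2).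
rewrite integral_cst// [X in (_ * X)%E]AE -EFinM lee_fin lerDr//.
Qed.

Lemma kernel_bounded_onU U u v S1 S2 : open U ->
  (forall p, U p -> {for p, continuous u}) ->
  (forall p, U p -> {for p, continuous v}) ->
  measurable S1 -> measurable S2 -> S1 `<=` U -> S2 `<=` U ->
  kernel_bounded_on u v U S1 -> kernel_bounded_on u v U S2 ->
  kernel_bounded_on u v U (S1 `|` S2).
Proof.
move=> oU cu cv m1 m2 S1U S2U [C1 C10 H1] [C2 C20 H2].
exists (C1 + C2); first exact: addr_ge0.
move=> q Uq; rewrite EFinD; apply: le_trans (leeD (H1 q Uq) (H2 q Uq)).
have k0 p : (0 <= (dist1 u v p q)^-1%:E)%E by rewrite lee_fin invr_ge0 dist1_ge0.
have mk := measurable_kernel q oU cu cv.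
have mU := open_measurable_plane oU.
have -> : S1 `|` S2 = S1 `|` (S2 `\` S1) by rewrite setUDr setDv setD0.
have mD : measurable (S2 `\` S1) by exact: measurableD.
rewrite ge0_integral_setU//; last 2 first.
- by apply: measurable_funS mk => //; rewrite subUset; split => // t [/S2U].
- by apply/disj_setPS => t [? []].
apply: leeD => //; apply: ge0_subset_integral => //.
  exact: measurable_funS mU S2U mk.
Qed.

Lemma compact_finite_balls K (r : R * R -> R) : compact K ->
  (forall p, K p -> 0 < r p) ->
  exists2 s : seq (R * R), (forall p, p \in s -> K p) &
    forall q, K q -> exists2 p, p \in s & `|q - p| < r p.
Proof.
move=> cK r0.
(* the open-cover characterization of compactness wants a pointed space *)
pose T : ptopologicalType := HB.pack (R * R)%type
  (Pointed.on (R * R)%type) (Topological.on (R * R)%type).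
have : @cover_compact (R * R)%type K by move: cK; rewrite (@compact_cover T).
clear T => /(_ _ K (fun p0 => [set p | `|p - p0| < r p0])); case.
- move=> p0 Kp; exact: open_norm_ball.
- by move=> p Kp; exists p => //=; rewrite subrr normr0 r0.
move=> D DK Kcov; exists (finmap.enum_fset D).
  by move=> p pD; apply: set_mem; exact: DK.
by move=> q /Kcov[p Dp] /= qp; exists p.
Qed.

Lemma compact_thicken K U : compact K -> open U -> K `<=` U ->
  exists2 d : R, 0 < d & forall p q, K p -> `|q - p| < d -> U q.
Proof.
move=> cK /open_ballP oU KU.
have ex p : exists e : R, K p -> 0 < e /\ forall q, `|q - p| < 2 * e -> U q.
  have [/KU/oU[e e0 He]|nKp] := pselect (K p); last by exists 0.
  exists (e / 2) => _; split; first by rewrite divr_gt0.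
  by move=> q qp; apply: He; lra.
have [e He] := choice ex.
have [s sK cov] := compact_finite_balls cK (fun p Kp => (He p Kp).1).
have [d d0 Hd] : exists2 d : R, 0 < d & forall p, p \in s -> d <= e p.
  elim: s sK {cov} => [_|p s IH sK]; first by exists 1.
  have [|d d0 Hd] := IH; first by move=> q qs; apply: sK; rewrite inE qs orbT.
  exists (Num.min d (e p)).
    by rewrite lt_min d0 (He p (sK p (mem_head _ _))).1.
  move=> q; rewrite inE ge_min => /orP[/eqP ->|/Hd ->//]; by rewrite lexx orbT.
exists d => // p q /cov[t ts pt] qp; apply: (He t (sK t ts)).2.
by have := ler_distD p q t; have := Hd t ts; lra.
Qed.

Lemma kernel_bounded_compact U u v K : open U ->
  (forall p, U p -> {for p, continuous u}) ->
  (forall p, U p -> {for p, continuous v}) ->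
  (forall p0, U p0 -> forall e : R, 0 < e -> exists2 h : R, 0 < h & forall q, U q ->
     dist1 u v q p0 < h -> `|q - p0| < e) ->
  (forall p0, U p0 -> kernel_bounded u v U p0) ->
  compact K -> K `<=` U -> kernel_bounded_on u v U K.
Proof.
move=> oU cu cv inj loc cK KU.
have ex p0 : exists r : R, U p0 -> [/\ 0 < r, closed_square p0 r `<=` U &
    kernel_bounded_on u v U (closed_square p0 r)].
  have [Up|nUp] := pselect (U p0); last by exists 0.
  have [r Hr] := kernel_bounded_far oU Up cu cv (inj _ Up) (loc _ Up).
  by exists r.
have [r Hr] := choice ex.
have [s0 sK Kcov] := compact_finite_balls cK (fun p Kp => let: And3 H _ _ := Hr p (KU p Kp) in H).
have DU (p : R * R) : p \in s0 -> U p by move=> /sK/KU.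
have key (s : seq (R * R)) : (forall p, p \in s -> U p) ->
    [/\ measurable (\bigcup_(p in [set` s]) closed_square p (r p)),
     \bigcup_(p in [set` s]) closed_square p (r p) `<=` U &
     kernel_bounded_on u v U (\bigcup_(p in [set` s]) closed_square p (r p))].
  elim: s => [_|p s IH sU].
    rewrite (_ : [set` [::]] = set0) ?bigcup_set0; last by apply/seteqP; split.
    by split => //; exists 0 => // q _; rewrite integral_set0.
  have [|m1 s1 k1] := IH; first by move=> t ts; apply: sU; rewrite inE ts orbT.
  have [r0 s2 k2] := Hr p (sU p (mem_head _ _)).
  rewrite (_ : [set` p :: s] = p |` [set` s]); last first.
    apply/seteqP; split=> t /=; rewrite inE; first by move=> /orP[/eqP|]; [left|right].
    by move=> [->|->]; rewrite ?eqxx ?orbT.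
  rewrite bigcup_setU1; split.
  - by apply: measurableU => //; exact: measurable_closed_square.
  - by move=> t [/s2|/s1].
  - by apply: kernel_bounded_onU => //; exact: measurable_closed_square.
have [mB BU [C C0 HC]] := key _ DU.
exists C => // q Uq; apply: le_trans (HC q Uq).
apply: ge0_subset_integral => //.
- exact: compact_measurable_plane.
- exact: measurable_funS (open_measurable_plane oU) BU (measurable_kernel q oU cu cv).
- by move=> p _; rewrite lee_fin invr_ge0 dist1_ge0.
- move=> p /Kcov[t Dt pt]; exists t => //.
  by rewrite closed_square_normE /=; exact: ltW.
Qed.

End CompactKernel.

(** * Lebesgue integration *)

Section Tools.
Context {R : realType}.
Local Notation leb2 := (@lebesgue_measure R \x @lebesgue_measure R)%E.

Lemma Rdominated_cvg d (T : measurableType d) (mu : {measure set T -> \bar R})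
    (D : set T) (f_ : nat -> T -> R) (f g : T -> R) :
  measurable D -> (forall n, measurable_fun D (f_ n)) -> measurable_fun D f ->
  {ae mu, forall x, D x -> f_ ^~ x @ \oo --> f x} ->
  mu.-integrable D (EFin \o g) ->
  (forall n x, D x -> `|f_ n x| <= g x) ->
  mu.-integrable D (EFin \o f) /\
  (fun n => \int[mu]_(x in D) f_ n x) @ \oo --> \int[mu]_(x in D) f x.
Proof.
move=> mD mf_ mf cf ig fg.
have [i1 _ i3] := @dominated_convergence _ _ _ mu D mD (fun n => EFin \o f_ n)
  (EFin \o f) (EFin \o g) (fun n => (measurable_EFinP D (f_ n)).2 (mf_ n)) ((measurable_EFinP D f).2 mf)
  ltac:(by apply: filterS cf => x H Dx; apply: cvg_EFin; [exact: nearW|exact: H])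
  ig ltac:(by apply: aeW => x n Dx; rewrite /= lee_fin fg).
split => //; apply: fine_cvg; rewrite fineK //.
exact: integrable_fin_num.
Qed.

Lemma ae_neq_plane (q : R * R) : {ae leb2, forall p, p != q}.
Proof.
have E : [set q] = [set q.1] `*` [set q.2].
  apply/seteqP; split=> [p ->|[a b] [/= -> ->]] //.
  by case: (q).
exists [set q]; split.
- by rewrite E; apply: measurableX; exact: measurable_set1.
- rewrite E [LHS]product_measure1E; [|exact: measurable_set1|exact: measurable_set1].
  by rewrite [X in (X * _)%E]lebesgue_measure_set1 mul0e.
- by move=> p /= /negP; rewrite negbK => /eqP.
Qed.

Lemma is_derive_epsP (f : R -> R) (x D : R) : is_derive x 1 f D ->
  forall e : R, 0 < e -> exists2 d : R, 0 < d & forall h, h != 0 -> `|h| < d ->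
    `|(f (x + h) - f x) / h - D| < e.
Proof.
move=> [H1 H2] e e0.
have C : (fun h : R => h^-1 *: ((f \o shift x) (h *: (1 : R)) - f x)) @ 0^' --> D.
  by rewrite -H2; exact: H1.
move/cvgrPdist_lt : C => /(_ e e0); rewrite near_withinE.
move=> /nbhs_ballP[d d0 Hd]; exists d => // h h0 hd.
have := Hd h; rewrite /ball /= sub0r normrN => /(_ hd h0).
by rewrite distrC [h *: 1]mulr1 /GRing.scale /= mulrC (addrC h).
Qed.

Lemma small_seq (d : R) : 0 < d -> exists2 h : nat -> R,
  (forall n, 0 < h n < d) & (forall e : R, 0 < e -> exists N, forall n, (N <= n)%N -> h n < e).
Proof.
move=> d0; exists (fun n => d / n.+2%:R).
  by move=> n; rewrite divr_gt0//= ltr_pdivrMr// ltr_pMr// ltr1n.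
move=> e e0; exists (Num.bound (d / e)) => n Nn.
have := archi_boundP (ltW (divr_gt0 d0 e0)); rewrite ltr_pdivrMr// => H1.
rewrite ltr_pdivrMr// (lt_le_trans H1)// mulrC ler_pM2l// ler_nat.
by rewrite (leq_trans Nn)// ltnW.
Qed.

Lemma cvgn_epsP (u : nat -> R) (l : R) :
  (forall e : R, 0 < e -> exists N, forall n, (N <= n)%N -> `|u n - l| < e) ->
  u @ \oo --> l.
Proof.
move=> H; apply/cvgrPdist_lt => e /H[N HN].
by exists N => // n /= /HN; rewrite distrC.
Qed.

Lemma bounded_leb2 (U : set (R * R)) : measurable U -> compact (closure U) -> (leb2 U < +oo)%E.
Proof.
move=> mU /compact_bounded[M [_ HM]].
have := HM (M + 1) ltac:(lra) => {}HM.
apply: (@le_lt_trans _ _ (leb2 (closed_square (0, 0) (M + 1)))); last exact: leb2_closed_square.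
apply: le_measure; rewrite ?inE//; first exact: measurable_closed_square.
move=> p Up; rewrite closed_square_normE /=.
rewrite (_ : p - (0, 0) = p) ?subr0//.
by apply: HM; exact: subset_closure.
Qed.

Lemma le_integrableR d (T : measurableType d) (mu : {measure set T -> \bar R})
    (D : set T) (f g : T -> R) :
  measurable D -> measurable_fun D f -> (forall x, D x -> `|f x| <= g x) ->
  mu.-integrable D (EFin \o g) -> mu.-integrable D (EFin \o f).
Proof.
move=> mD mf fg ig; apply: (le_integrable mD _ _ ig); first exact/measurable_EFinP.
by move=> x Dx; rewrite /= lee_fin (le_trans (fg x Dx))// ler_norm.
Qed.

Lemma integrable_bounded d (T : measurableType d) (mu : {measure set T -> \bar R})
    (D : set T) (f : T -> R) (M : R) :
  measurable D -> (mu D < +oo)%E -> measurable_fun D f ->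
  (forall x, D x -> `|f x| <= M) -> mu.-integrable D (EFin \o f).
Proof.
move=> mD fD mf fM; apply/integrableP; split; first exact/measurable_EFinP.
apply: (@le_lt_trans _ _ (\int[mu]_(x in D) (`|M|)%:E)%E).
  apply: ge0_le_integral => //.
  - by apply: measurableT_comp => //; exact/measurable_EFinP.
  - by move=> x Dx; rewrite /= lee_fin (le_trans (fM x Dx))// ler_norm.
by rewrite integral_cst// lte_mul_pinfty// ?lee_fin.
Qed.

Lemma integrable_bounded_support (S : set (R * R)) (f : R * R -> R) (M : R) :
  compact S -> measurable_fun setT f -> (forall p, ~ S p -> f p = 0) ->
  (forall p, `|f p| <= M) -> leb2.-integrable setT (EFin \o f).
Proof.
move=> cS mf f0 fM.
have mS := compact_measurable_plane cS.
have S_fin : (leb2 S < +oo)%E.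
  apply: bounded_leb2 => //; rewrite -(closure_id S).1//.
  exact: compact_closed plane_hausdorff cS.
have i1 : leb2.-integrable S (EFin \o f).
  apply: (integrable_bounded (M := M)) => //; exact: measurable_funTS.
have i2 := (@integrable_mkcond _ _ _ leb2 S (EFin \o f) mS).1 i1.
suff E : (EFin \o f) \_ S = EFin \o f by rewrite E in i2.
apply/funext => p; rewrite patchE; case: ifPn => //.
by rewrite notin_setE => /f0 /= ->.
Qed.

Lemma ae_eq_Rintegral d (T : measurableType d) (mu : {measure set T -> \bar R})
    (D : set T) (f g : T -> R) : measurable D ->
  measurable_fun D f -> measurable_fun D g ->
  {ae mu, forall x, D x -> f x = g x} ->
  \int[mu]_(x in D) f x = \int[mu]_(x in D) g x.
Proof.
move=> mD mf mg fg; congr fine; apply: ae_eq_integral => //.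
- exact/measurable_EFinP.
- exact/measurable_EFinP.
- by apply: filterS fg => x H Dx; rewrite (H Dx).
Qed.

Lemma ae_integrableR d (T : measurableType d) (mu : {measure set T -> \bar R})
    (D : set T) (f g : T -> R) : measurable D -> measurable_fun D f ->
  mu.-integrable D (EFin \o g) -> {ae mu, forall x, D x -> f x = g x} ->
  mu.-integrable D (EFin \o f).
Proof.
move=> mD mf /integrableP[mg ig] fg; apply/integrableP; split; first exact/measurable_EFinP.
apply: le_lt_trans ig.
have -> : (\int[mu]_(x in D) `|(EFin \o f) x| = \int[mu]_(x in D) `|(EFin \o g) x|)%E.
  apply: ae_eq_integral => //.
  - by apply: measurableT_comp => //; exact/measurable_EFinP.
  - exact: measurableT_comp.
  - by move: fg; apply: (filterS (F := almost_everywhere mu)) => x fgx Dx; rewrite /= fgx.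
exact: lexx.
Qed.

Lemma integrable_fine d (T : measurableType d) (mu : {measure set T -> \bar R})
    (D : set T) (G : T -> \bar R) : measurable D -> mu.-integrable D G ->
  mu.-integrable D (EFin \o (fine \o G)) /\
  \int[mu]_(x in D) fine (G x) = fine (\int[mu]_(x in D) G x)%E.
Proof.
move=> mD iG; have mG := measurable_int _ iG.
have mfG : measurable_fun D (EFin \o (fine \o G)).
  apply/measurable_EFinP; apply: measurableT_comp mG.
  exact: (@fine_measurable R setT measurableT).
split; last first.
  rewrite /Rintegral; congr fine; apply: ae_eq_integral => //.
  move: (integrable_ae mD iG); apply: (filterS (F := almost_everywhere mu)) => x h Dx.
  by rewrite /= fineK// h.
apply: (le_integrable mD mfG _ iG) => x _ /=.
by case: (G x) => [r| |] //=; rewrite normr0 leey.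
Qed.

End Tools.

(** * Exact forms are closed, in weak form *)

Section CurlFree.
Context {R : realType}.
Local Notation leb2 := (@lebesgue_measure R \x @lebesgue_measure R)%E.
Implicit Types (U S : set (R * R)) (p q : R * R).

(** Translation by [a]. *)
Definition tr (a p : R * R) : R * R := (p.1 + a.1, p.2 + a.2).
(** The vector [h e]. *)
Definition sc (h : R) (e : R * R) : R * R := (h * e.1, h * e.2).

Lemma measurable_tr a : measurable_fun setT (tr a).
Proof.
by apply/measurable_fun_pairP; split; apply: measurable_funD.
Qed.

Lemma affine1E a : affine a 1 = tr a.
Proof. by apply/funext => p; rewrite /affine /tr !mul1r ![_ + p.1]addrC ![_ + p.2]addrC. Qed.

Lemma integrable_tr a (f : R * R -> R) : leb2.-integrable setT (EFin \o f) ->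
  leb2.-integrable setT (EFin \o (f \o tr a)).
Proof. by move=> /(@integrable_affine R a 1%:pos); rewrite /= affine1E. Qed.

Lemma Rintegral_tr a (f : R * R -> R) : leb2.-integrable setT (EFin \o f) ->
  \int[leb2]_p f p = \int[leb2]_p f (tr a p).
Proof.
by move=> /(@Rintegral_affine R a 1%:pos) ->; rewrite /= affine1E expr1n mul1r.
Qed.

Lemma trD a b p : tr a (tr b p) = tr (b.1 + a.1, b.2 + a.2) p.
Proof. by rewrite /tr /= !addrA. Qed.

Lemma norm_tr p a (d : R) : 0 <= d -> `|a.1| <= d -> `|a.2| <= d -> `|tr a p - p| <= d.
Proof.
by move=> d0 a1 a2; apply/prod_leP; rewrite /tr /= [p.1 + _]addrC [p.2 + _]addrC !addrK.
Qed.

Lemma norm_sc (h : R) e : `|e.1| <= 1 -> `|e.2| <= 1 ->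
  `|(sc h e).1| <= `|h| /\ `|(sc h e).2| <= `|h|.
Proof. by move=> e1 e2; rewrite /sc /= !normrM !ler_piMr. Qed.

(** Dominated convergence for a product of difference quotients: [Ke] is the
    derivative of [K] along [e1], and [psie] that of [psi] along [e2], except
    perhaps at [q0]. As the quotients of [psi] vanish away from [S], those of
    [K] matter only inside [U], and [K] can be extended by 0. *)
Lemma difference_quotient_limit U S (q0 e1 e2 : R * R)
    (K Ke psi psie : R * R -> R) (M d : R) :
  open U -> (leb2 U < +oo)%E -> compact S -> S `<=` U ->
  `|e1.1| <= 1 -> `|e1.2| <= 1 -> `|e2.1| <= 1 -> `|e2.2| <= 1 ->
  measurable_fun U K -> measurable_fun U Ke ->
  measurable_fun setT psi -> measurable_fun U psie ->
  (forall p, ~ S p -> psi p = 0) ->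
  (forall p, U p -> forall e : R, 0 < e -> exists2 d, 0 < d & forall h, h != 0 -> `|h| < d ->
     `|(K (tr (sc h e1) p) - K p) / h - Ke p| < e) ->
  (forall p h, (forall t, `|t| <= `|h| -> U (tr (sc t e1) p)) ->
     `|K (tr (sc h e1) p) - K p| <= M * `|h|) ->
  (forall p, U p -> p != q0 -> forall e : R, 0 < e ->
     exists2 d, 0 < d & forall h, h != 0 -> `|h| < d ->
     `|(psi (tr (sc h e2) p) - psi p) / h - psie p| < e) ->
  0 < d -> (forall p h, `|h| < d -> `|psi (tr (sc h e2) p) - psi p| <= M * `|h|) ->
  exists2 d' : R, 0 < d' & forall h : nat -> R,
    (forall n, 0 < h n < d') ->
    (forall e : R, 0 < e -> exists N, forall n, (N <= n)%N -> h n < e) ->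
  leb2.-integrable U (EFin \o (fun p => Ke p * psie p)) /\
  (fun n => \int[leb2]_p
     ((((K \_ U) (tr (sc (h n) e1) p) - (K \_ U) p) / h n) *
      ((psi (tr (sc (- h n) e2) p) - psi p) / (- h n)))) @ \oo -->
  \int[leb2]_(p in U) (Ke p * psie p).
Proof.
move=> oU Ufin cS SU e11 e12 e21 e22 mK mKe mpsi mpsie psi0 HK HKl Hpsi d0 Hpsil.
have mU := open_measurable_plane oU.
have [d1 d10 Hd1] := compact_thicken cS oU SU.
exists (Num.min d (d1 / 2)); first by rewrite lt_min d0 divr_gt0.
move=> h hd hlim.
have hn0 n : 0 < h n by have /andP[] := hd n.
have hnd n : h n < d by have := hd n; rewrite lt_min => /and3P[].
have hnd1 n : 2 * h n < d1 by have := hd n; rewrite lt_min => /and3P[_ _]; clear; lra.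
have nh n (e : R * R) : `|e.1| <= 1 -> `|e.2| <= 1 -> forall t p, `|t| <= h n ->
    `|tr (sc t e) p - p| <= h n.
  move=> e1' e2' t p th; have [n1 n2] := norm_sc t e1' e2'.
  by apply: norm_tr; rewrite ?(ltW (hn0 n))//; exact: le_trans th.
have Nh n : `|- h n| = h n by rewrite normrN gtr0_norm.
pose A n p := (((K \_ U) (tr (sc (h n) e1) p) - (K \_ U) p) / h n) *
      ((psi (tr (sc (- h n) e2) p) - psi p) / (- h n)).
(* where the difference of [psi] does not vanish, [p] is close to [S] *)
have near_supp n p : psi (tr (sc (- h n) e2) p) - psi p != 0 ->
    forall t, `|t| <= h n -> U (tr (sc t e1) p).
  move=> psi_neq t th; have H1 := nh n e1 e11 e12 t p th.
  have [Sp|nSp] := pselect (S p).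
    by apply: (Hd1 p) => //; have := hn0 n; have := hnd1 n; clear -H1; lra.
  have [Sp'|nSp'] := pselect (S (tr (sc (- h n) e2) p)).
    apply: (Hd1 _ _ Sp').
    have H2 := nh n e2 e21 e22 (- h n) p ltac:(by rewrite Nh).
    have := ler_distD p (tr (sc t e1) p) (tr (sc (- h n) e2) p).
    by rewrite (distrC p); have := hnd1 n; clear -H1 H2; lra.
  by exfalso; move: psi_neq; rewrite !psi0// subrr eqxx.
have tr0 p (e : R * R) : tr (sc 0 e) p = p by rewrite /tr /sc /= !mul0r !addr0; case: p.
have A0 n p : ~ U p -> A n p = 0.
  move=> nUp; rewrite /A; have [->|/near_supp H] := eqVneq (psi (tr (sc (- h n) e2) p) - psi p) 0.
    by rewrite mul0r mulr0.
  by exfalso; apply: nUp; have := H 0; rewrite normr0 tr0; apply; exact: ltW.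
have mKU : measurable_fun setT (K \_ U) by apply/(measurable_restrictT _ mU).
have mA n : measurable_fun setT (A n).
  apply: measurable_funM; apply: measurable_funM => //; apply: measurable_funB => //;
  apply: measurableT_comp => //; exact: measurable_tr.
have AM n p : U p -> `|A n p| <= `|M| * `|M|.
  move=> Up; rewrite /A.
  have [->|psi_neq] := eqVneq (psi (tr (sc (- h n) e2) p) - psi p) 0.
    by rewrite mul0r mulr0 normr0 mulr_ge0.
  have H := near_supp n p psi_neq.
  have Uh : U (tr (sc (h n) e1) p) by apply: H; rewrite gtr0_norm.
  rewrite !patchE (mem_set Uh) (mem_set Up) normrM !normrM !normfV Nh (gtr0_norm (hn0 n)).
  have ME : forall x : R, x <= M * h n -> x / h n <= `|M|.
    move=> x xM; rewrite ler_pdivrMr// (le_trans xM)// ler_wpM2r ?ler_norm//.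
    exact: ltW.
  apply: ler_pM => //.
  - by rewrite divr_ge0// ltW.
  - by rewrite divr_ge0// ltW.
  - apply: ME; have := HKl p (h n); rewrite (gtr0_norm (hn0 n)); apply; exact: H.
  - by apply: ME; have := Hpsil p (- h n); rewrite Nh; apply.
have Acvg p : U p -> p != q0 -> A ^~ p @ \oo --> Ke p * psie p.
  move=> Up pq; apply: cvgM; apply: cvgn_epsP => e e0.
  - have [t1 t10 Ht1] := HK p Up e e0.
    have [t2 t20 Ht2] := (open_ballP U).1 oU p Up.
    have tm : 0 < Num.min t1 t2 by rewrite lt_min t10.
    have [N HN] := hlim _ tm; exists N => n /HN; rewrite lt_min => /andP[h1 h2].
    have Uh : U (tr (sc (h n) e1) p).
      by apply: Ht2; apply: le_lt_trans (nh n e1 e11 e12 (h n) p _) h2; rewrite gtr0_norm.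
    rewrite !patchE (mem_set Uh) (mem_set Up); apply: Ht1; first by rewrite gt_eqF.
    by rewrite gtr0_norm.
  - have [t1 t10 Ht1] := Hpsi p Up pq e e0.
    have [N HN] := hlim _ t10; exists N => n /HN h1.
    by apply: Ht1; rewrite ?Nh// oppr_eq0 gt_eqF.
have ae1 : {ae leb2, forall p, U p -> A ^~ p @ \oo --> Ke p * psie p}.
  have ap := ae_neq_plane q0; move: ap; apply: (filterS (F := almost_everywhere leb2)).
  by move=> p pq Up; exact: Acvg.
have [i1 i2] := @Rdominated_cvg R _ _ leb2 U A (fun p => Ke p * psie p)
  (fun=> `|M| * `|M|) mU (fun n => measurable_funTS (mA n)) (measurable_funM mKe mpsie)
  ae1
  ltac:(by apply: (integrable_bounded (M := `|M| * `|M|)) => // p _; rewrite ger0_norm// mulr_ge0)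
  AM.
split => //; apply: cvg_trans i2.
suff -> : (fun n => \int[leb2]_(p in U) A n p) = (fun n => \int[leb2]_p A n p) by [].
apply/funext => n; rewrite [LHS]Rintegral_mkcond.
suff -> : A n \_ U = A n by [].
by apply/funext => p; rewrite patchE; case: ifPn => //; rewrite notin_setE => /A0 ->.
Qed.

(** A discrete form of the vanishing of the integral of
    [K_x psi_y - K_y psi_x]: by translation invariance both sides are the same
    combination of integrals of [K p * psi (p + d)]. *)
Lemma discrete_curl (K psi : R * R -> R) (M : R) (a b : R * R) :
  measurable_fun setT K -> (forall p, `|K p| <= M) ->
  leb2.-integrable setT (EFin \o psi) ->
  \int[leb2]_p ((K (tr a p) - K p) * (psi (tr b p) - psi p)) =
  \int[leb2]_p ((K (tr (- b.1, - b.2) p) - K p) * (psi (tr (- a.1, - a.2) p) - psi p)).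
Proof.
move=> mK KM ipsi.
have itr (c d : R * R) : leb2.-integrable setT (EFin \o (fun p => K (tr c p) * psi (tr d p))).
  have i1 := integrableZl measurableT M (integrable_tr d ipsi).
  have mpsi : measurable_fun setT psi by exact: (measurable_EFinP _ _).1 (measurable_int _ ipsi).
  apply: (le_integrable measurableT _ _ i1).
    apply/measurable_EFinP; apply: measurable_funM; apply: measurableT_comp => //; exact: measurable_tr.
  move=> p _; rewrite /= lee_fin !normrM ler_wpM2r//.
  by rewrite (le_trans (KM _))// ler_norm.
have t0 p : tr (0, 0) p = p by rewrite /tr !addr0; case: p.
pose c d := \int[leb2]_p (K (tr (0, 0) p) * psi (tr d p)).
have cE e d : \int[leb2]_p (K (tr e p) * psi (tr d p)) = c (d.1 - e.1, d.2 - e.2).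
  rewrite /c [RHS](Rintegral_tr e (itr _ _)).
  apply: eq_Rintegral => p _; rewrite /= !trD /=.
  have -> : (e.1 + 0, e.2 + 0) = e by rewrite !addr0; case: e.
  have -> // : (e.1 + (d.1 - e.1), e.2 + (d.2 - e.2)) = d.
  by rewrite [e.1 + _]addrC [e.2 + _]addrC !subrK; case: d.
have expand (e d : R * R) : \int[leb2]_p ((K (tr e p) - K p) * (psi (tr d p) - psi p)) =
   c (d.1 - e.1, d.2 - e.2) - c (- e.1, - e.2) - (c (d.1, d.2) - c (0, 0)).
  transitivity (\int[leb2]_p ((K (tr e p) * psi (tr d p) - K (tr e p) * psi (tr (0, 0) p)) -
       (K (tr (0, 0) p) * psi (tr d p) - K (tr (0, 0) p) * psi (tr (0, 0) p)))).
    by apply: eq_Rintegral => p _; rewrite !t0; ring.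
  have iB (e1 d1 e2 d2 : R * R) : leb2.-integrable setT (EFin \o (fun p =>
      K (tr e1 p) * psi (tr d1 p) - K (tr e2 p) * psi (tr d2 p))).
    exact: (integrableB measurableT (itr e1 d1) (itr e2 d2)).
  rewrite (RintegralB measurableT (iB _ _ _ _) (iB _ _ _ _)).
  rewrite (RintegralB measurableT (itr _ _) (itr _ _)) (RintegralB measurableT (itr _ _) (itr _ _)).
  by rewrite !cE /= !subr0 !sub0r.
rewrite !expand /= !opprK.
by rewrite [- a.1 + _]addrC [- a.2 + _]addrC; ring.
Qed.

(** The weak form of [d (dK) = 0]: [dK] pairs to zero with [d psi] for Lipschitz
    [psi] with compact support, although [K] has only one derivative. *)
Lemma curl_free U S (q0 : R * R) (K Kx Ky psi psix psiy : R * R -> R) (M d : R) :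
  open U -> (leb2 U < +oo)%E -> compact S -> S `<=` U ->
  C1on U K Kx Ky ->
  (forall p, U p -> [/\ `|K p| <= M, `|Kx p| <= M & `|Ky p| <= M]) ->
  measurable_fun setT psi -> (forall p, ~ S p -> psi p = 0) ->
  (forall p, `|psi p| <= M) ->
  measurable_fun U psix -> measurable_fun U psiy ->
  (forall p, U p -> p != q0 ->
     is_derive p.1 1 (fun s => psi (s, p.2)) (psix p) /\
     is_derive p.2 1 (fun t => psi (p.1, t)) (psiy p)) ->
  0 < d ->
  (forall p h, `|h| < d -> `|psi (p.1 + h, p.2) - psi p| <= M * `|h| /\
                           `|psi (p.1, p.2 + h) - psi p| <= M * `|h|) ->
  [/\ leb2.-integrable U (EFin \o (fun p => Kx p * psiy p)),
      leb2.-integrable U (EFin \o (fun p => Ky p * psix p)) &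
      \int[leb2]_(p in U) (Kx p * psiy p) = \int[leb2]_(p in U) (Ky p * psix p)].
Proof.
move=> oU Ufin cS SU CK KM mpsi psi0 psiM mpsix mpsiy dpsi d0 Lpsi.
have mU := open_measurable_plane oU.
have mK : measurable_fun U K.
  by apply: open_continuous_measurable_plane => // p; exact: C1on_continuous oU CK.
have mKx : measurable_fun U Kx.
  by apply: open_continuous_measurable_plane => // p /CK[].
have mKy : measurable_fun U Ky.
  by apply: open_continuous_measurable_plane => // p /CK[].
have trx (h : R) p : tr (sc h (1, 0)) p = (p.1 + h, p.2).
  by rewrite /tr /sc /= mulr1 mulr0 addr0.
have try_ (h : R) p : tr (sc h (0, 1)) p = (p.1, p.2 + h).
  by rewrite /tr /sc /= mulr1 mulr0 addr0.
have n1 : `|1 : R| <= 1 by rewrite normr1.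
have n0 : `|0 : R| <= 1 by rewrite normr0.
have btw := @between_shift R.
have DKx p : U p -> forall e : R, 0 < e -> exists2 d, 0 < d & forall h, h != 0 -> `|h| < d ->
    `|(K (tr (sc h (1, 0)) p) - K p) / h - Kx p| < e.
  move=> Up e e0; have [H _ _ _] := CK p Up; have [dd dd0 Hd] := is_derive_epsP H e0.
  by exists dd => // h h0 hd; rewrite trx; have := Hd h h0 hd; rewrite /= -surjective_pairing.
have DKy p : U p -> forall e : R, 0 < e -> exists2 d, 0 < d & forall h, h != 0 -> `|h| < d ->
    `|(K (tr (sc h (0, 1)) p) - K p) / h - Ky p| < e.
  move=> Up e e0; have [_ H _ _] := CK p Up; have [dd dd0 Hd] := is_derive_epsP H e0.
  by exists dd => // h h0 hd; rewrite try_; have := Hd h h0 hd; rewrite /= -surjective_pairing.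
have Dpx p : U p -> p != q0 -> forall e : R, 0 < e -> exists2 d, 0 < d & forall h, h != 0 ->
    `|h| < d -> `|(psi (tr (sc h (1, 0)) p) - psi p) / h - psix p| < e.
  move=> Up pq e e0; have [H _] := dpsi p Up pq; have [dd dd0 Hd] := is_derive_epsP H e0.
  by exists dd => // h h0 hd; rewrite trx; have := Hd h h0 hd; rewrite /= -surjective_pairing.
have Dpy p : U p -> p != q0 -> forall e : R, 0 < e -> exists2 d, 0 < d & forall h, h != 0 ->
    `|h| < d -> `|(psi (tr (sc h (0, 1)) p) - psi p) / h - psiy p| < e.
  move=> Up pq e e0; have [_ H] := dpsi p Up pq; have [dd dd0 Hd] := is_derive_epsP H e0.
  by exists dd => // h h0 hd; rewrite try_; have := Hd h h0 hd; rewrite /= -surjective_pairing.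
have LKx p h : (forall t, `|t| <= `|h| -> U (tr (sc t (1, 0)) p)) ->
    `|K (tr (sc h (1, 0)) p) - K p| <= M * `|h|.
  move=> H; have HU s : between p.1 (p.1 + h) s -> U (s, p.2).
    by move=> /btw[t -> th]; have := H t th; rewrite trx.
  have [s /HU/KM[_ B _] E] := @MVT_between _ (fun s => K (s, p.2)) (fun s => Kx (s, p.2)) p.1 (p.1 + h)
     ltac:(by move=> s /HU/CK[]).
  rewrite trx; rewrite /= -surjective_pairing in E.
  by rewrite E [p.1 + h - p.1]addrAC subrr add0r normrM ler_wpM2r.
have LKy p h : (forall t, `|t| <= `|h| -> U (tr (sc t (0, 1)) p)) ->
    `|K (tr (sc h (0, 1)) p) - K p| <= M * `|h|.
  move=> H; have HU s : between p.2 (p.2 + h) s -> U (p.1, s).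
    by move=> /btw[t -> th]; have := H t th; rewrite try_.
  have [s /HU/KM[_ _ B] E] := @MVT_between _ (fun s => K (p.1, s)) (fun s => Ky (p.1, s)) p.2 (p.2 + h)
     ltac:(by move=> s /HU/CK[]).
  rewrite try_; rewrite /= -surjective_pairing in E.
  by rewrite E [p.2 + h - p.2]addrAC subrr add0r normrM ler_wpM2r.
have Lpx p h : `|h| < d -> `|psi (tr (sc h (1, 0)) p) - psi p| <= M * `|h|.
  by move=> /(Lpsi p)[+ _]; rewrite trx.
have Lpy p h : `|h| < d -> `|psi (tr (sc h (0, 1)) p) - psi p| <= M * `|h|.
  by move=> /(Lpsi p)[_]; rewrite try_.
have [dx dx0 Hx] := difference_quotient_limit (e1 := (1, 0)) (e2 := (0, 1))
  oU Ufin cS SU n1 n0 n0 n1 mK mKx mpsi mpsiy psi0 DKx LKx Dpy d0 Lpy.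
have [dy dy0 Hy] := difference_quotient_limit (e1 := (0, 1)) (e2 := (1, 0))
  oU Ufin cS SU n0 n1 n1 n0 mK mKy mpsi mpsix psi0 DKy LKy Dpx d0 Lpx.
have dm : 0 < Num.min dx dy by rewrite lt_min dx0.
have [h hd hlim] := small_seq dm.
have [ix lx] := Hx h ltac:(by move=> n; have := hd n; rewrite lt_min => /and3P[-> ->]) hlim.
have [iy ly] := Hy h ltac:(by move=> n; have := hd n; rewrite lt_min => /and3P[-> _ ->]) hlim.
split => //.
set K' := K \_ U in lx ly.
have mK' : measurable_fun setT K' by apply/(measurable_restrictT _ mU).
have M0 : 0 <= M by rewrite (le_trans _ (psiM q0)).
have K'M p : `|K' p| <= M.
  rewrite /K' patchE; case: ifPn; last by rewrite normr0.
  by rewrite inE => /KM[].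
have ipsi := integrable_bounded_support cS mpsi psi0 psiM.
suff E n : \int[leb2]_p ((K' (tr (sc (h n) (1, 0)) p) - K' p) / h n *
      ((psi (tr (sc (- h n) (0, 1)) p) - psi p) / - h n)) =
    \int[leb2]_p ((K' (tr (sc (h n) (0, 1)) p) - K' p) / h n *
      ((psi (tr (sc (- h n) (1, 0)) p) - psi p) / - h n)).
  have EE := funext E; rewrite EE in lx.
  exact: (cvg_unique _ lx ly).
have sx t : sc t (1, 0) = (t, 0) by rewrite /sc /= mulr1 mulr0.
have sy t : sc t (0, 1) = (0, t) by rewrite /sc /= mulr1 mulr0.
have ipsih : leb2.-integrable setT (EFin \o (fun p => psi p / - h n)).
  exact: (integrableZr measurableT (- h n)^-1 ipsi).
have mKh : measurable_fun setT (fun p => K' p / h n) by apply: measurable_funM.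
have KhM p : `|K' p / h n| <= M / `|h n|.
  by rewrite normrM normfV ler_wpM2r// invr_ge0.
(* the two products of difference quotients are the two sides of the discrete
   identity for the shifts [(h, 0)] and [(0, - h)] *)
have := discrete_curl (h n, 0) (0, - h n) mKh KhM ipsih.
rewrite /= oppr0 opprK !sx !sy.
by under eq_Rintegral do rewrite -!mulrBl; under [RHS]eq_Rintegral do rewrite -!mulrBl.
Qed.

End CurlFree.

(** * A regularization of the Cauchy kernel *)

Section Mollifier.
Context {R : realType}.

(** [mm l r = (1 - exp (- l r)) / r] is a smooth approximation of [1 / r] as
    [l] goes to infinity, for [r > 0]; its value at [r = 0] is 0.
    [mp l] is its derivative where [r] is nonzero. *)
Definition mm (l r : R) : R := (1 - expR (- (l * r))) / r.
Definition mp (l r : R) : R := (l * expR (- (l * r)) - mm l r) / r.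

Lemma mm_deriv (l r : R) : r != 0 -> is_derive r 1 (mm l) (mp l r).
Proof.
move=> r0.
have d1 : is_derive r 1 (fun t : R => - (l * t)) (- l).
  by apply: is_derive_eq; rewrite /GRing.scale /=; ring.
have d2 := @is_derive1_comp _ expR _ r _ _ (is_derive_expR _) d1.
have d3 : is_derive r 1 (fun t : R => t^-1) (- r ^- 2 *: 1) by apply: is_deriveV.
have d4 := is_deriveB (is_derive_cst (1 : R) r 1) d2.
have d5 := is_deriveM d4 d3.
apply: is_derive_eq; rewrite /mp /mm /GRing.scale /=.
change ((cst 1 - (expR \o (fun t : R => - (l * t)))) r) with (1 - expR (- (l * r))).
by field.
Qed.

Lemma expN_lip (x y : R) : 0 <= x -> 0 <= y -> `|expR (- x) - expR (- y)| <= `|x - y|.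
Proof.
wlog xy : x y / x <= y.
  move=> H x0 y0; have [xy|/ltW yx] := leP x y; first exact: H.
  by rewrite distrC (distrC x); exact: H.
move=> x0 _.
have e1 : expR (- y) <= expR (- x) by rewrite ler_expR; lra.
rewrite ger0_norm ?subr_ge0// distrC ger0_norm ?subr_ge0//.
have -> : expR (- y) = expR (- x) * expR (- (y - x)) by rewrite -expRD; congr expR; ring.
have := expR_ge1Dx (- (y - x)) => H.
have e0 := expR_gt0 (- x).
have e2 : expR (- x) <= 1 by rewrite -expR0 ler_expR; lra.
have : expR (- x) * (1 - expR (- (y - x))) <= 1 * (y - x).
  have h : 0 <= 1 - expR (- (y - x)) by rewrite subr_ge0 -expR0 ler_expR; lra.
  by apply: ler_pM => //; lra.
lra.
Qed.

Lemma mm_bound (l r : R) : 0 <= l -> 0 <= r -> 0 <= mm l r <= l /\ (0 < r -> mm l r <= r^-1).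
Proof.
move=> l0 r0; rewrite /mm.
have lr : 0 <= l * r by rewrite mulr_ge0.
have e1 : 0 <= 1 - expR (- (l * r)) by rewrite subr_ge0 -expR0 ler_expR; lra.
have e2 : 1 - expR (- (l * r)) <= l * r by have := expR_ge1Dx (- (l * r)); lra.
have [->|r_neq0] := eqVneq r 0; first by rewrite invr0 mulr0 lexx l0 ltxx.
have rp : 0 < r by rewrite lt_neqAle eq_sym r_neq0.
split.
  by rewrite divr_ge0//= ler_pdivrMr.
by move=> _; rewrite ler_pdivrMr// mulVf//; have := expR_gt0 (- (l * r)); lra.
Qed.

(** [(a, b) |-> a mm l (a^2 + b^2)] is Lipschitz, also across the origin. *)
Lemma mm_lip (l a b a' b' : R) : 0 <= l ->
  `|a * mm l (a ^+ 2 + b ^+ 2) - a' * mm l (a' ^+ 2 + b' ^+ 2)|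
  <= 9 * l * (`|a - a'| + `|b - b'|).
Proof.
move=> l0.
wlog nn : a b a' b' / `|a'| + `|b'| <= `|a| + `|b|.
  move=> H; have [nn|/ltW nn] := leP (`|a'| + `|b'|) (`|a| + `|b|); first exact: H.
  by rewrite distrC (distrC a) (distrC b); exact: H.
set r := a ^+ 2 + b ^+ 2; set r' := a' ^+ 2 + b' ^+ 2; set d := `|a - a'| + `|b - b'|.
set n := `|a| + `|b| in nn; set n' := `|a'| + `|b'| in nn.
have r0 : 0 <= r by rewrite addr_ge0 ?sqr_ge0.
have r'0 : 0 <= r' by rewrite addr_ge0 ?sqr_ge0.
have d0 : 0 <= d by exact: addr_ge0.
have [/andP[m0 ml] _] := mm_bound l0 r0.
have [/andP[m'0 m'l] _] := mm_bound l0 r'0.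
have -> : a * mm l r - a' * mm l r' = (a - a') * mm l r + a' * (mm l r - mm l r') by ring.
rewrite (le_trans (ler_normD _ _))// (normrM (a - a')) (normrM a').
have h1 : `|a - a'| * `|mm l r| <= d * l.
  by rewrite (ger0_norm m0) ler_pM// /d lerDl.
suff h2 : `|a'| * `|mm l r - mm l r'| <= 8 * l * d.
  have -> : 9 * l * d = d * l + 8 * l * d by ring.
  exact: lerD.
have ld : 0 <= l * d by rewrite mulr_ge0.
have [r'E|r'_neq0] := eqVneq r' 0.
  have a'0 : a' = 0.
    apply/eqP; rewrite -sqrf_eq0 eq_le sqr_ge0 andbT -[leRHS]r'E /r' lerDl; exact: sqr_ge0.
  by rewrite a'0 normr0 mul0r; lra.
have r'p : 0 < r' by rewrite lt_neqAle eq_sym r'_neq0.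
have n2r : n ^+ 2 <= 2 * r.
  have : 0 <= (`|a| - `|b|) ^+ 2 by exact: sqr_ge0.
  have -> : r = `|a| ^+ 2 + `|b| ^+ 2 by rewrite /r !real_normK// num_real.
  by rewrite /n sqrrB sqrrD; lra.
have r'n : r' <= n' ^+ 2.
  have -> : r' = `|a'| ^+ 2 + `|b'| ^+ 2 by rewrite /r' !real_normK// num_real.
  have : 0 <= `|a'| * `|b'| by rewrite mulr_ge0.
  by rewrite /n' sqrrD; lra.
have n'0 : 0 <= n' by exact: addr_ge0.
have rp : 0 < r.
  have h : n' ^+ 2 <= n ^+ 2 by rewrite ler_sqr ?nnegrE// (le_trans n'0).
  lra.
have rr : `|r - r'| <= 2 * n * d.
  have -> : r - r' = (a - a') * (a + a') + (b - b') * (b + b') by rewrite /r /r'; ring.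
  rewrite (le_trans (ler_normD _ _))// !normrM.
  have na : `|a + a'| <= 2 * n.
    have := ler_normD a a'; have : `|a'| <= n' by rewrite /n' lerDl.
    have : `|a| <= n by rewrite /n lerDl.
    by lra.
  have nb : `|b + b'| <= 2 * n.
    have := ler_normD b b'; have : `|b'| <= n' by rewrite /n' lerDr.
    have : `|b| <= n by rewrite /n lerDr.
    by lra.
  have h3 := ler_wpM2l (normr_ge0 (a - a')) na.
  have h4 := ler_wpM2l (normr_ge0 (b - b')) nb.
  by rewrite /d; lra.
(* the difference of the two quotients, over the common denominator [r r'] *)
have mE : mm l r - mm l r' = ((expR (- (l * r')) - expR (- (l * r))) + mm l r' * (r' - r)) / r.
  by rewrite /mm; field; rewrite !gt_eqF.
have h5 : `|mm l r - mm l r'| <= 2 * l * `|r - r'| / r.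
  rewrite mE normrM normfV (gtr0_norm rp) ler_pM2r ?invr_gt0//.
  rewrite (le_trans (ler_normD _ _))// normrM (ger0_norm m'0).
  have e1 := expN_lip (mulr_ge0 l0 r'0) (mulr_ge0 l0 r0).
  rewrite -mulrBr normrM (ger0_norm l0) in e1.
  have e2 : mm l r' * `|r' - r| <= l * `|r' - r| by rewrite ler_wpM2r.
  by rewrite (distrC r r'); lra.
have a'n : `|a'| <= n by rewrite (le_trans _ nn)// /n' lerDl.
have n0 : 0 <= n by exact: addr_ge0.
have h6 : `|a'| * `|mm l r - mm l r'| <= n * (2 * l * (2 * n * d) / r).
  apply: ler_pM => //; apply: (le_trans h5).
  by rewrite ler_pM2r ?invr_gt0// ler_wpM2l// mulr_ge0.
apply: (le_trans h6).
have -> : n * (2 * l * (2 * n * d) / r) = 4 * (l * d) * n ^+ 2 / r by ring.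
rewrite ler_pdivrMr//.
have := ler_wpM2l ld n2r; lra.
Qed.

End Mollifier.

(** * The regularized identity *)

Section RegularizedIdentity.
Context {R : realType}.
Local Notation leb2 := (@lebesgue_measure R \x @lebesgue_measure R)%E.
Implicit Types (U S : set (R * R)) (p q : R * R) (a b phi : R * R -> R).

(** The square of the modulus of [a + i b]. *)
Definition sq2 a b p : R := a p ^+ 2 + b p ^+ 2.

(** [phi a mm l (a^2 + b^2)] and its derivative in a direction along which the
    derivatives of [phi], [a], [b] are [phi'], [a'], [b']. *)
Definition mprod (l : R) a b phi p : R := phi p * (a p * mm l (sq2 a b p)).
Definition mprod' (l : R) a b phi a' b' phi' p : R :=
  phi' p * (a p * mm l (sq2 a b p)) +
  phi p * (a' p * mm l (sq2 a b p) +
           a p * (mp l (sq2 a b p) * (2 * (a p * a' p) + 2 * (b p * b' p)))).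

Lemma mprod_derive (l x : R) (A B F : R -> R) (A' B' F' : R) :
  A x ^+ 2 + B x ^+ 2 != 0 ->
  is_derive x 1 A A' -> is_derive x 1 B B' -> is_derive x 1 F F' ->
  is_derive x 1 (fun s => F s * (A s * mm l (A s ^+ 2 + B s ^+ 2)))
    (F' * (A x * mm l (A x ^+ 2 + B x ^+ 2)) +
     F x * (A' * mm l (A x ^+ 2 + B x ^+ 2) +
     A x * (mp l (A x ^+ 2 + B x ^+ 2) * (2 * (A x * A') + 2 * (B x * B'))))).
Proof.
move=> r0 dA dB dF.
have d1 : is_derive x 1 (A ^+ 2 + B ^+ 2) (2 * (A x * A') + 2 * (B x * B')).
  have dX := is_deriveD (is_deriveX 2 dA) (is_deriveX 2 dB).
  by apply: is_derive_eq; rewrite /GRing.scale /= !expr1 -!mulrA.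
have d2 := @is_derive1_comp _ (mm l) (A ^+ 2 + B ^+ 2) x _ _ (mm_deriv l r0) d1.
have d3 := is_deriveM dF (is_deriveM dA d2).
apply: is_derive_eq; rewrite /GRing.scale /=.
change ((A * (mm l \o (A ^+ 2 + B ^+ 2))) x) with (A x * mm l (A x ^+ 2 + B x ^+ 2)).
change ((mm l \o (A ^+ 2 + B ^+ 2)) x) with (mm l (A x ^+ 2 + B x ^+ 2)).
change ((A ^+ 2 + B ^+ 2) x) with (A x ^+ 2 + B x ^+ 2).
ring.
Qed.

Lemma measurable_mm (l : R) (U : set (R * R)) (r : R * R -> R) :
  measurable_fun U r -> measurable_fun U (fun p => mm l (r p)).
Proof.
move=> mr; apply: measurable_funM; last exact: measurable_funV.
apply: measurable_funB => //; apply: measurableT_comp; first exact: measurable_expR.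
by apply: measurableT_comp => //; apply: measurable_funM.
Qed.

Lemma measurable_mp (l : R) (U : set (R * R)) (r : R * R -> R) :
  measurable_fun U r -> measurable_fun U (fun p => mp l (r p)).
Proof.
move=> mr; apply: measurable_funM; last exact: measurable_funV.
apply: measurable_funB; last exact: measurable_mm.
apply: measurable_funM => //; apply: measurableT_comp; first exact: measurable_expR.
by apply: measurableT_comp => //; apply: measurable_funM.
Qed.

Lemma measurable_sq2 U a b : measurable_fun U a -> measurable_fun U b ->
  measurable_fun U (sq2 a b).
Proof. by move=> ma mb; apply: measurable_funD; apply: measurable_funX. Qed.

Lemma measurable_mprod' l U a b phi a' b' phi' :
  measurable_fun U a -> measurable_fun U b -> measurable_fun U phi ->
  measurable_fun U a' -> measurable_fun U b' -> measurable_fun U phi' ->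
  measurable_fun U (mprod' l a b phi a' b' phi').
Proof.
move=> ma mb mphi ma' mb' mphi'.
have mr := measurable_sq2 ma mb.
have m1 := measurable_mm l mr; have m2 := measurable_mp l mr.
apply: measurable_funD; first by apply: measurable_funM => //; apply: measurable_funM.
apply: measurable_funM => //; apply: measurable_funD; first exact: measurable_funM.
apply: measurable_funM => //; apply: measurable_funM => //.
by apply: measurable_funD; apply: measurable_funM => //; apply: measurable_funM.
Qed.

Lemma mprod_lipschitz U S (l M : R) a ax ay b bx by_ phi px py :
  open U -> compact S -> S `<=` U -> 0 <= l ->
  C1on U a ax ay -> C1on U b bx by_ -> C1on setT phi px py ->
  (forall p, U p -> [/\ `|a p| <= M, `|ax p| <= M & `|ay p| <= M]) ->
  (forall p, U p -> [/\ `|b p| <= M, `|bx p| <= M & `|by_ p| <= M]) ->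
  (forall p, [/\ `|phi p| <= M, `|px p| <= M & `|py p| <= M]) ->
  (forall p, ~ S p -> phi p = 0) ->
  measurable_fun setT (mprod l a b phi) /\
  exists M' d : R, [/\ 0 < d, M <= M', forall p, `|mprod l a b phi p| <= M' &
    forall p h, `|h| < d ->
      `|mprod l a b phi (p.1 + h, p.2) - mprod l a b phi p| <= M' * `|h| /\
      `|mprod l a b phi (p.1, p.2 + h) - mprod l a b phi p| <= M' * `|h|].
Proof.
move=> oU cS SU l0 Ca Cb Cphi aM bM phiM phi0.
have mU := open_measurable_plane oU.
have M0 : 0 <= M by have [h _ _] := phiM (0, 0); rewrite (le_trans _ h).
have mu_a : measurable_fun U a.
  by apply: open_continuous_measurable_plane => // p; exact: C1on_continuous oU Ca.
have mu_b : measurable_fun U b.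
  by apply: open_continuous_measurable_plane => // p; exact: C1on_continuous oU Cb.
have oT : open [set: R * R] by exact: openT.
have mphi : measurable_fun U phi.
  apply: open_continuous_measurable_plane => // p _; exact: C1on_continuous oT Cphi I.
set psi := mprod l a b phi.
have psi0 p : ~ S p -> psi p = 0 by move=> /phi0 H; rewrite /psi /mprod H mul0r.
split.
  have -> : psi = psi \_ U.
    apply/funext => p; rewrite patchE; case: ifPn => //.
    by rewrite notin_setE => nU; apply: psi0 => /SU.
  apply/(measurable_restrictT _ mU); apply: measurable_funM => //; apply: measurable_funM => //.
  by apply: measurable_mm; exact: measurable_sq2.
have [d d0 Hd] := compact_thicken cS oU SU.
pose P p := a p * mm l (sq2 a b p).
have PM p : U p -> `|P p| <= 18 * l * M.
  move=> Up; have := @mm_lip R l (a p) (b p) 0 0 l0; rewrite mul0r !subr0.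
  have [h1 _ _] := aM p Up; have [h2 _ _] := bM p Up.
  move=> /le_trans; apply; have -> : 18 * l * M = 9 * l * (M + M) by ring.
  by rewrite ler_wpM2l ?mulr_ge0// lerD.
pose M' := M + 36 * l * M * M.
have M'0 : 0 <= 36 * l * M * M by rewrite !mulr_ge0.
exists M', (d / 2); split => //.
- by rewrite divr_gt0.
- by rewrite /M' lerDl.
- move=> p; have [Up|nU] := pselect (U p); last first.
    by rewrite psi0 ?normr0 ?addr_ge0// => /SU.
  rewrite /psi /mprod normrM.
  have [h1 _ _] := phiM p; have h2 := PM p Up.
  apply: (@le_trans _ _ (M * (18 * l * M))); first exact: ler_pM.
  rewrite /M'; have -> : M * (18 * l * M) = 36 * l * M * M / 2 by field.
  lra.
(* a common bound for the increments of [phi] and of [P] along a segment in [U] *)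
have key p p' (h : R) : U p -> U p' -> `|phi p' - phi p| <= M * `|h| ->
    `|a p' - a p| <= M * `|h| -> `|b p' - b p| <= M * `|h| ->
    `|psi p' - psi p| <= M' * `|h|.
  move=> Up Up' h1 h2 h3.
  have -> : psi p' - psi p = (phi p' - phi p) * P p' + phi p * (P p' - P p).
    by rewrite /psi /mprod /P; ring.
  rewrite (le_trans (ler_normD _ _))// (normrM (phi p' - phi p)) (normrM (phi p)).
  have k1 : `|phi p' - phi p| * `|P p'| <= M * `|h| * (18 * l * M).
    by apply: ler_pM => //; exact: PM.
  have k2 : `|P p' - P p| <= 18 * l * (M * `|h|).
    apply: (le_trans (@mm_lip R l (a p') (b p') (a p) (b p) l0)).
    have -> : 18 * l * (M * `|h|) = 9 * l * (M * `|h| + M * `|h|) by ring.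
    by rewrite ler_wpM2l ?mulr_ge0// lerD.
  have [h4 _ _] := phiM p.
  have k3 : `|phi p| * `|P p' - P p| <= M * (18 * l * (M * `|h|)) by exact: ler_pM.
  apply: (le_trans (lerD k1 k3)).
  have -> : M' * `|h| = M * `|h| * (18 * l * M) + M * (18 * l * (M * `|h|)) + M * `|h|.
    by rewrite /M'; ring.
  by rewrite lerDl mulr_ge0.
have btw := @between_shift R.
have incx V f fx fy p h : C1on V f fx fy -> (forall t, `|t| <= `|h| -> V (p.1 + t, p.2)) ->
    (forall p, V p -> `|fx p| <= M) -> `|f (p.1 + h, p.2) - f p| <= M * `|h|.
  move=> Cf HV fM; have HV' s : between p.1 (p.1 + h) s -> V (s, p.2).
    by move=> /btw[t -> th]; exact: HV.
  have [s /HV'/fM B E] := @MVT_between _ (fun s => f (s, p.2)) (fun s => fx (s, p.2)) p.1 (p.1 + h)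
     ltac:(by move=> s /HV'/Cf[]).
  rewrite /= -surjective_pairing in E.
  by rewrite E [p.1 + h - p.1]addrAC subrr add0r normrM ler_wpM2r.
have incy V f fx fy p h : C1on V f fx fy -> (forall t, `|t| <= `|h| -> V (p.1, p.2 + t)) ->
    (forall p, V p -> `|fy p| <= M) -> `|f (p.1, p.2 + h) - f p| <= M * `|h|.
  move=> Cf HV fM; have HV' s : between p.2 (p.2 + h) s -> V (p.1, s).
    by move=> /btw[t -> th]; exact: HV.
  have [s /HV'/fM B E] := @MVT_between _ (fun s => f (p.1, s)) (fun s => fy (p.1, s)) p.2 (p.2 + h)
     ltac:(by move=> s /HV'/Cf[]).
  rewrite /= -surjective_pairing in E.
  by rewrite E [p.2 + h - p.2]addrAC subrr add0r normrM ler_wpM2r.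
have PT (f fx fy : R * R -> R) : (forall p, [/\ `|f p| <= M, `|fx p| <= M & `|fy p| <= M]) ->
    (forall p, setT p -> `|fx p| <= M) /\ (forall p, setT p -> `|fy p| <= M).
  by move=> H; split=> p _; have [] := H p.
have [phix phiy] := PT _ _ _ phiM.
have ax_ p : U p -> `|ax p| <= M by move=> /aM[].
have ay_ p : U p -> `|ay p| <= M by move=> /aM[].
have bx_ p : U p -> `|bx p| <= M by move=> /bM[].
have bY_ p : U p -> `|by_ p| <= M by move=> /bM[].
have h2d (h : R) : `|h| < d / 2 -> forall t : R, `|t| <= `|h| -> `|t - h| < d /\ `|t| < d.
  by move=> hd t th; have := ler_normB t h; have := normr_ge0 h; clear -hd th; split; lra.
move=> p h hd; split.
  have [[Sp|Sp']|/not_orP[nS nS']] := pselect (S p \/ S (p.1 + h, p.2)); last first.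
  - by rewrite !psi0// subrr normr0 mulr_ge0// addr_ge0.
  - have HU t : `|t| <= `|h| -> U (p.1 + t, p.2).
      move=> /(h2d h hd t)[t1 _]; apply: (Hd _ _ Sp'); apply/prod_ltP => /=.
      by rewrite opprD addrACA subrr add0r subrr normr0.
    apply: (key _ _ h).
    + by have := HU 0; rewrite normr0 addr0 -surjective_pairing; apply.
    + exact: HU.
    + exact: incx Cphi _ phix.
    + exact: incx Ca HU ax_.
    + exact: incx Cb HU bx_.
  have HU t : `|t| <= `|h| -> U (p.1 + t, p.2).
    move=> /(h2d h hd t)[_ t1]; apply: (Hd _ _ Sp); apply/prod_ltP => /=.
    by rewrite [p.1 + t]addrC addrK subrr normr0.
  apply: (key _ _ h).
  - exact: SU.
  - exact: HU.
  - exact: incx Cphi _ phix.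
  - exact: incx Ca HU ax_.
  - exact: incx Cb HU bx_.
have [[Sp|Sp']|/not_orP[nS nS']] := pselect (S p \/ S (p.1, p.2 + h)); last first.
- by rewrite !psi0// subrr normr0 mulr_ge0// addr_ge0.
- have HU t : `|t| <= `|h| -> U (p.1, p.2 + t).
    move=> /(h2d h hd t)[t1 _]; apply: (Hd _ _ Sp'); apply/prod_ltP => /=.
    by split; [rewrite subrr normr0|rewrite opprD addrACA subrr add0r].
  apply: (key _ _ h).
  + by have := HU 0; rewrite normr0 addr0 -surjective_pairing; apply.
  + exact: HU.
  + exact: incy Cphi _ phiy.
  + exact: incy Ca HU ay_.
  + exact: incy Cb HU bY_.
have HU t : `|t| <= `|h| -> U (p.1, p.2 + t).
  move=> /(h2d h hd t)[_ t1]; apply: (Hd _ _ Sp); apply/prod_ltP => /=.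
  by split; [rewrite subrr normr0|rewrite [p.2 + t]addrC addrK].
apply: (key _ _ h).
- exact: SU.
- exact: HU.
- exact: incy Cphi _ phiy.
- exact: incy Ca HU ay_.
- exact: incy Cb HU bY_.
Qed.

Lemma C1on_subcst U (u ux uy : R * R -> R) (c : R) :
  C1on U u ux uy -> C1on U (fun p => u p - c) ux uy.
Proof.
move=> Cu p /Cu[h1 h2 h3 h4]; split => //.
- by have := is_deriveB h1 (is_derive_cst c p.1 1); rewrite subr0.
- by have := is_deriveB h2 (is_derive_cst c p.2 1); rewrite subr0.
Qed.

(** The two real components of the integral of [F (Z - Z q) L phi], where
    [L phi = {Z, phi}] and [F z = (1 - exp (- l |z|^2)) / z]. They follow from
    [curl_free] with [K] one of [u], [v] and [psi] the product of [phi] with the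
    real or imaginary part of [F (Z - Z q)], up to sign, which is Lipschitz; the right-hand
    side comes from the derivative [l exp (- l |z|^2)] of [F] with respect to the
    conjugate of [z]. *)
Lemma regularized_identity U S q (u ux uy v vx vy phi px py : R * R -> R) (M l : R) :
  open U -> (leb2 U < +oo)%E -> compact S -> S `<=` U -> U q -> 0 < l ->
  C1on U u ux uy -> C1on U v vx vy -> C1on setT phi px py ->
  (forall p, U p -> [/\ `|u p| <= M, `|ux p| <= M & `|uy p| <= M]) ->
  (forall p, U p -> [/\ `|v p| <= M, `|vx p| <= M & `|vy p| <= M]) ->
  (forall p, [/\ `|phi p| <= M, `|px p| <= M & `|py p| <= M]) ->
  (forall p, ~ S p -> phi p = 0) ->
  (forall p, U p -> p != q -> (u p - u q) ^+ 2 + (v p - v q) ^+ 2 != 0) ->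
  let a p := u p - u q in let b p := v p - v q in
  \int[leb2]_(p in U) (mm l (sq2 a b p) *
    (a p * (ux p * py p - uy p * px p) + b p * (vx p * py p - vy p * px p))) = 0 /\
  \int[leb2]_(p in U) (mm l (sq2 a b p) *
    (a p * (vx p * py p - vy p * px p) - b p * (ux p * py p - uy p * px p))) =
  2 * \int[leb2]_(p in U) (phi p * (ux p * vy p - uy p * vx p) *
                           (l * expR (- (l * sq2 a b p)))).
Proof.
move=> oU Ufin cS SU Uq l0 Cu Cv Cphi uM vM phiM phi0 inj a b.
have mU : @measurable _ (measurableTypeR R * measurableTypeR R)%type U.
  exact: open_measurable_plane.
have [M0 M00 _] := phiM q; have {M00} M0 : 0 <= M by rewrite (le_trans _ M0).
have Ca : C1on U a ux uy by exact: C1on_subcst.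
have Cb : C1on U b vx vy by exact: C1on_subcst.
have tw (x : R) : `|x| <= M -> `|x| <= 2 * M by move=> h; lra.
have aM p : U p -> [/\ `|a p| <= 2 * M, `|ux p| <= 2 * M & `|uy p| <= 2 * M].
  move=> /uM[h1 h2 h3]; have [h4 _ _] := uM _ Uq.
  by split; [have := ler_normB (u p) (u q); rewrite /a; lra|exact: tw|exact: tw].
have bM p : U p -> [/\ `|b p| <= 2 * M, `|vx p| <= 2 * M & `|vy p| <= 2 * M].
  move=> /vM[h1 h2 h3]; have [h4 _ _] := vM _ Uq.
  by split; [have := ler_normB (v p) (v q); rewrite /b; lra|exact: tw|exact: tw].
have phiM2 p : [/\ `|phi p| <= 2 * M, `|px p| <= 2 * M & `|py p| <= 2 * M].
  by have [? ? ?] := phiM p; split; exact: tw.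
have oT : open [set: R * R] by exact: openT.
have [ma mux muy] := C1on_measurable oU Ca; have [mb mvx mvy] := C1on_measurable oU Cb.
have [mphi mpx mpy] := C1on_measurable oU (C1on_sub (fun p _ => I) Cphi : C1on U phi px py).
have [mpa [M1 [d1 [d10 MM1 paM1 paL]]]] :=
  mprod_lipschitz oU cS SU (ltW l0) Ca Cb Cphi aM bM phiM2 phi0.
have [mpb [M2 [d2 [d20 MM2 pbM2 pbL]]]] :=
  mprod_lipschitz oU cS SU (ltW l0) Cb Ca Cphi bM aM phiM2 phi0.
have psi0 c d p : ~ S p -> mprod l c d phi p = 0.
  by move=> /phi0 H; rewrite /mprod H mul0r.
have sqC p : sq2 b a p = sq2 a b p by rewrite /sq2 addrC.
have Da p : U p -> p != q ->
   is_derive p.1 1 (fun s => mprod l a b phi (s, p.2)) (mprod' l a b phi ux vx px p) /\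
   is_derive p.2 1 (fun t => mprod l a b phi (p.1, t)) (mprod' l a b phi uy vy py p).
  move=> Up pq; have [a1 a2 _ _] := Ca p Up; have [b1 b2 _ _] := Cb p Up.
  have [f1 f2 _ _] := Cphi p Logic.I.
  have pE : (p.1, p.2) = p by case: (p).
  have H1 := @mprod_derive l p.1 (fun s => a (s, p.2)) (fun s => b (s, p.2)) (fun s => phi (s, p.2)) _ _ _.
  have H2 := @mprod_derive l p.2 (fun s => a (p.1, s)) (fun s => b (p.1, s)) (fun s => phi (p.1, s)) _ _ _.
  rewrite /= pE in H1; rewrite /= pE in H2.
  by split; [exact: (H1 _ _ _ (inj p Up pq) a1 b1 f1)|exact: (H2 _ _ _ (inj p Up pq) a2 b2 f2)].
have Db p : U p -> p != q ->
   is_derive p.1 1 (fun s => mprod l b a phi (s, p.2)) (mprod' l b a phi vx ux px p) /\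
   is_derive p.2 1 (fun t => mprod l b a phi (p.1, t)) (mprod' l b a phi vy uy py p).
  move=> Up pq; have [a1 a2 _ _] := Ca p Up; have [b1 b2 _ _] := Cb p Up.
  have [f1 f2 _ _] := Cphi p Logic.I.
  have pE : (p.1, p.2) = p by case: (p).
  have H1 := @mprod_derive l p.1 (fun s => b (s, p.2)) (fun s => a (s, p.2)) (fun s => phi (s, p.2)) _ _ _.
  have H2 := @mprod_derive l p.2 (fun s => b (p.1, s)) (fun s => a (p.1, s)) (fun s => phi (p.1, s)) _ _ _.
  rewrite /= pE in H1; rewrite /= pE in H2.
  have inj' : b p ^+ 2 + a p ^+ 2 != 0 by rewrite addrC; exact: inj.
  by split; [exact: (H1 _ _ _ inj' b1 a1 f1)|exact: (H2 _ _ _ inj' b2 a2 f2)].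
have m_ax := measurable_mprod' l ma mb mphi mux mvx mpx.
have m_ay := measurable_mprod' l ma mb mphi muy mvy mpy.
have m_bx := measurable_mprod' l mb ma mphi mvx mux mpx.
have m_by := measurable_mprod' l mb ma mphi mvy muy mpy.
have le1 (N : R) (f fx fy : R * R -> R) : 2 * M <= N -> (forall p, U p -> [/\ `|f p| <= M, `|fx p| <= M & `|fy p| <= M]) ->
    forall p, U p -> [/\ `|f p| <= N, `|fx p| <= N & `|fy p| <= N].
  move=> MN H p /H[? ? ?]; have MN' : M <= N by rewrite (le_trans _ MN)// mulr_natl mulr2n lerDl.
  by split; exact: le_trans MN'.
have [i1 j1 E1] := curl_free (q0 := q) oU Ufin cS SU Cu (le1 _ _ _ _ MM1 uM) mpa (psi0 a b) paM1 m_ax m_ay Da d10 paL.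
have [i2 j2 E2] := curl_free (q0 := q) oU Ufin cS SU Cv (le1 _ _ _ _ MM2 vM) mpb (psi0 b a) pbM2 m_bx m_by Db d20 pbL.
have [i3 j3 E3] := curl_free (q0 := q) oU Ufin cS SU Cu (le1 _ _ _ _ MM2 uM) mpb (psi0 b a) pbM2 m_bx m_by Db d20 pbL.
have [i4 j4 E4] := curl_free (q0 := q) oU Ufin cS SU Cv (le1 _ _ _ _ MM1 vM) mpa (psi0 a b) paM1 m_ax m_ay Da d10 paL.
have comb (A B C D : R * R -> R) : leb2.-integrable U (EFin \o A) -> leb2.-integrable U (EFin \o B) ->
    leb2.-integrable U (EFin \o C) -> leb2.-integrable U (EFin \o D) ->
    \int[leb2]_(p in U) A p = \int[leb2]_(p in U) B p ->
    \int[leb2]_(p in U) C p = \int[leb2]_(p in U) D p ->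
    leb2.-integrable U (EFin \o (fun p => (A p - B p) + (C p - D p))) /\
    \int[leb2]_(p in U) ((A p - B p) + (C p - D p)) = 0.
  move=> iA iB iC iD AB CD.
  have iAB : leb2.-integrable U (EFin \o (fun p => A p - B p)) by exact: (integrableB mU iA iB).
  have iCD : leb2.-integrable U (EFin \o (fun p => C p - D p)) by exact: (integrableB mU iC iD).
  split; first exact: (integrableD mU iAB iCD).
  by rewrite (RintegralD mU iAB iCD) (RintegralB mU iA iB) (RintegralB mU iC iD) AB CD !subrr addr0.
have [iX1 X1] := comb _ _ _ _ i1 j1 i2 j2 E1 E2.
have [iX2 X2] := comb _ _ _ _ j3 i3 i4 j4 (esym E3) E4.
have mr := measurable_sq2 ma mb.
have mmr := measurable_mm l mr.
have mW1 : measurable_fun U (fun p => mm l (sq2 a b p) *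
    (a p * (ux p * py p - uy p * px p) + b p * (vx p * py p - vy p * px p))).
  apply: measurable_funM => //; apply: measurable_funD; apply: measurable_funM => //;
  by apply: measurable_funB; apply: measurable_funM.
have mW2 : measurable_fun U (fun p => mm l (sq2 a b p) *
    (a p * (vx p * py p - vy p * px p) - b p * (ux p * py p - uy p * px p))).
  apply: measurable_funM => //; apply: measurable_funB; apply: measurable_funM => //;
  by apply: measurable_funB; apply: measurable_funM.
pose Y p := phi p * (ux p * vy p - uy p * vx p) * (l * expR (- (l * sq2 a b p))).
have mY : measurable_fun U Y.
  apply: measurable_funM; first apply: measurable_funM => //.
    by apply: measurable_funB; apply: measurable_funM.
  apply: measurable_funM => //; apply: measurableT_comp; first exact: measurable_expR.
  by apply: measurableT_comp => //; apply: measurable_funM.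
have iY : leb2.-integrable U (EFin \o Y).
  apply: (integrable_bounded (M := M * (M * M + M * M) * l)) => // p Up.
  have [_ h1 h2] := uM p Up; have [_ h3 h4] := vM p Up; have [h5 _ _] := phiM p.
  rewrite /Y normrM normrM; apply: ler_pM => //.
    apply: ler_pM => //; apply: (le_trans (ler_normB _ _)).
    by rewrite !normrM lerD// ler_pM.
  rewrite normrM (gtr0_norm l0) ler_piMr ?(ltW l0)//.
  rewrite ger0_norm ?expR_ge0// -[leRHS]expR0 ler_expR oppr_le0 mulr_ge0 ?(ltW l0)//.
  by rewrite addr_ge0 ?sqr_ge0.
have aeq := ae_neq_plane q.
split.
  rewrite -X1; apply: ae_eq_Rintegral => //.
    exact: (measurable_EFinP _ _).1 (measurable_int _ iX1).
  move: aeq; apply: (filterS (F := almost_everywhere leb2)) => p pq Up.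
  rewrite /mprod' sqC; ring.
have i2Y : leb2.-integrable U (EFin \o (fun p => 2 * Y p)) by exact: (integrableZl mU 2 iY).
have -> : 2 * \int[leb2]_(p in U) Y p = \int[leb2]_(p in U) (2 * Y p).
  by rewrite (RintegralZl 2 mU iY).
rewrite -[RHS]add0r -X2 -(RintegralD mU iX2 i2Y).
apply: ae_eq_Rintegral => //.
  exact: (measurable_EFinP _ _).1 (measurable_int _ (integrableD mU iX2 i2Y)).
move: aeq; apply: (filterS (F := almost_everywhere leb2)) => p pq Up.
rewrite /mprod' sqC /Y.
have r0 : sq2 a b p != 0 by exact: inj.
have -> : l * expR (- (l * sq2 a b p)) = mm l (sq2 a b p) + (a p ^+ 2 + b p ^+ 2) * mp l (sq2 a b p).
  have rE : (a p ^+ 2 + b p ^+ 2) * mp l (sq2 a b p) =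
      l * expR (- (l * sq2 a b p)) - mm l (sq2 a b p).
    by rewrite /mp [LHS]mulrC divfK.
  by rewrite rE addrC subrK.
ring.
Qed.

End RegularizedIdentity.

(** * Gaussian integrals and concentration *)

Section Gaussian.
Context {R : realType}.
Local Notation leb := (@lebesgue_measure R).
Local Notation leb2 := (@lebesgue_measure R \x @lebesgue_measure R)%E.

Lemma gauss1Zl (A m k : R) : 0 <= k ->
  (\int[leb]_y (k%:E * (expR (- (A * (y - m) ^+ 2)))%:E) =
   k%:E * \int[leb]_y (expR (- (A * (y - m) ^+ 2)))%:E)%E.
Proof.
move=> k0.
have mE : measurable_fun setT (fun y : R => (expR (- (A * (y - m) ^+ 2)))%:E).
  apply/measurable_EFinP; apply: measurableT_comp; first exact: measurable_expR.
  apply: measurableT_comp => //; apply: measurable_funM => //; apply: measurable_funX.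
  exact: measurable_funB.
apply: (@ge0_integralZl _ _ _ leb _ measurableT _ mE k%:E).
- by move=> y _; rewrite lee_fin expR_ge0.
- by rewrite lee_fin.
Qed.

(** Obtained from the normal density of mean [m] and variance [1 / (2 A)]. *)
Lemma gauss1 (A m : R) : 0 < A ->
  (\int[leb]_y (expR (- (A * (y - m) ^+ 2)))%:E = (Num.sqrt (pi / A))%:E)%E.
Proof.
move=> A0.
have A2 : 0 < (2 * A)^-1 by rewrite invr_gt0 mulr_gt0.
pose s := Num.sqrt (2 * A)^-1.
have s0 : s != 0 by rewrite gt_eqF// sqrtr_gt0.
have s2 : s ^+ 2 = (2 * A)^-1 by rewrite sqr_sqrtr// ltW.
have P0 : 0 < Num.sqrt (pi / A) by rewrite sqrtr_gt0 divr_gt0// pi_gt0.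
have E y : normal_pdf m s y = (Num.sqrt (pi / A))^-1 * expR (- (A * (y - m) ^+ 2)).
  rewrite normal_pdfE// /normal_peak /normal_fun s2; congr (_^-1 * expR _).
    by congr Num.sqrt; field; rewrite gt_eqF.
  by field; rewrite gt_eqF.
have := integral_normal_pdf m s.
under eq_integral do rewrite E EFinM.
rewrite gauss1Zl ?invr_ge0 ?(ltW P0)//.
set I := (X in (_ * X)%E) => H.
have : ((Num.sqrt (pi / A))%:E * ((Num.sqrt (pi / A))^-1%:E * I) = (Num.sqrt (pi / A))%:E)%E.
  by rewrite H mule1.
by rewrite muleA -EFinM mulfV ?gt_eqF// mul1e.
Qed.

(** Completion of the square in the second variable. *)
Lemma gauss2 (a b c d : R) : a * d - b * c != 0 ->
  (\int[leb2]_p (expR (- ((a * p.1 + b * p.2) ^+ 2 + (c * p.1 + d * p.2) ^+ 2)))%:E =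
   (pi / `|a * d - b * c|)%:E)%E.
Proof.
set D := a * d - b * c => D0.
have D2 : 0 < D ^+ 2 by rewrite exprn_even_gt0.
pose A := b ^+ 2 + d ^+ 2; pose B := a * b + c * d.
have A0 : 0 < A.
  rewrite lt_neqAle addr_ge0 ?sqr_ge0// andbT eq_sym paddr_eq0 ?sqr_ge0// !sqrf_eq0.
  by apply: contra D0 => /andP[/eqP b0 /eqP d0]; rewrite /D b0 d0 mulr0 mul0r subrr.
pose g (p : R * R) := expR (- ((a * p.1 + b * p.2) ^+ 2 + (c * p.1 + d * p.2) ^+ 2)).
have ml (k l : R) : measurable_fun setT (fun p : R * R => k * p.1 + l * p.2).
  by apply: measurable_funD; apply: measurable_funM.
have mg : measurable_fun setT (EFin \o g).
  apply/measurable_EFinP; apply: measurableT_comp; first exact: measurable_expR.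
  by apply: measurableT_comp => //; apply: measurable_funD; apply: measurable_funX; exact: ml.
have g0 p : (0 <= (EFin \o g) p)%E by rewrite lee_fin expR_ge0.
have -> : (\int[leb2]_p (EFin \o g) p = \int[leb]_x \int[leb]_y (g (x, y))%:E)%E.
  exact: (@fubini_tonelli1 _ _ _ _ _ leb leb (EFin \o g) mg g0).
have inner x : (\int[leb]_y (g (x, y))%:E =
    (Num.sqrt (pi / A))%:E * (expR (- (D ^+ 2 / A * (x - 0) ^+ 2)))%:E)%E.
  have E y : g (x, y) = expR (- (D ^+ 2 / A * (x - 0) ^+ 2)) *
      expR (- (A * (y - (- (B * x / A))) ^+ 2)).
    by rewrite /g -expRD /=; congr expR; rewrite /D /B; move: A0; rewrite /A => A0; field; rewrite gt_eqF.
  under eq_integral do rewrite E EFinM.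
  rewrite gauss1Zl ?expR_ge0//.
  by rewrite gauss1// muleC.
under eq_integral do rewrite inner.
rewrite gauss1Zl ?sqrtr_ge0//.
have DA : 0 < D ^+ 2 / A by rewrite divr_gt0.
rewrite gauss1// -EFinM; congr (_%:E).
rewrite -sqrtrM ?divr_ge0 ?pi_ge0 ?(ltW A0)//.
have -> : pi / A * (pi / (D ^+ 2 / A)) = (pi / `|D|) ^+ 2.
  by rewrite expr_div_n real_normK ?num_real//; field; rewrite D0 gt_eqF.
by rewrite sqrtr_sqr ger0_norm// divr_ge0// pi_ge0.
Qed.

Lemma integrable_gauss2 (a b c d : R) : a * d - b * c != 0 ->
  leb2.-integrable setT (EFin \o (fun p : R * R =>
    expR (- ((a * p.1 + b * p.2) ^+ 2 + (c * p.1 + d * p.2) ^+ 2)))).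
Proof.
move=> D0.
have ml (k l : R) : measurable_fun setT (fun p : R * R => k * p.1 + l * p.2).
  by apply: measurable_funD; apply: measurable_funM.
apply/integrableP; split.
  apply/measurable_EFinP; apply: measurableT_comp; first exact: measurable_expR.
  by apply: measurableT_comp => //; apply: measurable_funD; apply: measurable_funX; exact: ml.
under eq_integral do rewrite /= ger0_norm ?expR_ge0//.
by rewrite gauss2// ltry.
Qed.

(** With [N = n + 1], the densities [N^2 exp (- N^2 |Z p - Z q|^2)] concentrate
    at [q]: substitute [p = q + s / N]; the lower bound for [|Z p - Z q|]
    provides a dominating Gaussian. *)
Lemma blowup_limit (U : set (R * R)) (q : R * R) (H u ux uy v vx vy : R * R -> R) (M c : R) :
  open U -> (leb2 U < +oo)%E -> U q -> C1on U u ux uy -> C1on U v vx vy ->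
  measurable_fun U H -> {for q, continuous H} -> (forall p, U p -> `|H p| <= M) ->
  0 < c ->
  (forall p, U p -> c * ((p.1 - q.1) ^+ 2 + (p.2 - q.2) ^+ 2) <=
     (u p - u q) ^+ 2 + (v p - v q) ^+ 2) ->
  ux q * vy q - uy q * vx q != 0 ->
  let r p := (u p - u q) ^+ 2 + (v p - v q) ^+ 2 in
  (fun n : nat => \int[leb2]_(p in U)
     (H p * (n.+1%:R ^+ 2 * expR (- (n.+1%:R ^+ 2 * r p))))) @ \oo -->
  H q * (pi / `|ux q * vy q - uy q * vx q|).
Proof.
move=> oU Ufin Uq Cu Cv mH cH HM c0 low D0 r.
have mU : @measurable _ (measurableTypeR R * measurableTypeR R)%type U.
  exact: open_measurable_plane.
have mu : measurable_fun U u.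
  by apply: open_continuous_measurable_plane => // p; exact: C1on_continuous oU Cu.
have mv : measurable_fun U v.
  by apply: open_continuous_measurable_plane => // p; exact: C1on_continuous oU Cv.
have mr : measurable_fun U r.
  by apply: measurable_funD; apply: measurable_funX; apply: measurable_funB.
pose l (n : nat) : R := n.+1%:R ^+ 2.
have l0 n : 0 < l n by rewrite exprn_gt0.
have r0 p : 0 <= r p by rewrite addr_ge0 ?sqr_ge0.
pose F n p := H p * (l n * expR (- (l n * r p))).
have mF n : measurable_fun U (F n).
  apply: measurable_funM => //; apply: measurable_funM => //.
  apply: measurableT_comp; first exact: measurable_expR.
  by apply: measurableT_comp => //; apply: measurable_funM.
have M0 : 0 <= M by rewrite (le_trans _ (HM q Uq)).
have exp1 (x : R) : 0 <= x -> expR (- x) <= 1.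
  by move=> x0; rewrite -expR0 ler_expR oppr_le0.
have iF n : leb2.-integrable U (EFin \o F n).
  apply: (integrable_bounded (M := M * l n)) => //; [exact: mF|move=> p Up].
  rewrite /F normrM; apply: ler_pM => //; first exact: HM.
  rewrite normrM (gtr0_norm (l0 n)) ler_piMr ?(ltW (l0 n))//.
  by rewrite ger0_norm ?expR_ge0// exp1// mulr_ge0// ltW.
have ep (n : nat) : 0 < n.+1%:R^-1 :> R by rewrite invr_gt0.
pose e (n : nat) := PosNum (ep n).
have e0 n : 0 < (e n)%:num by [].
have el n : (e n)%:num ^+ 2 * l n = 1.
  by rewrite /= /l -exprMn mulVf ?expr1n// pnatr_eq0.
pose x n s := affine q (e n)%:num s.
pose G n s := (e n)%:num ^+ 2 * (F n \_ U) (x n s).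
have iFU n : leb2.-integrable setT (EFin \o (F n \_ U)).
  have := (@integrable_mkcond _ _ _ leb2 U (EFin \o F n) mU).1 (iF n).
  suff -> : (EFin \o F n) \_ U = EFin \o (F n \_ U) by [].
  by apply/funext => p; rewrite /= !patchE; case: ifP.
have FG n : \int[leb2]_(p in U) F n p = \int[leb2]_s G n s.
  rewrite [LHS]Rintegral_mkcond (Rintegral_affine q (e n) (iFU n)).
  by rewrite [RHS](RintegralZl _ measurableT (integrable_affine q (e n) (iFU n))).
pose sc_ := Num.sqrt c.
have sc0 : sc_ * sc_ - 0 * 0 != 0.
  by rewrite mulr0 subr0 mulf_neq0// gt_eqF// sqrtr_gt0.
pose g (s : R * R) := M * expR (- ((sc_ * s.1 + 0 * s.2) ^+ 2 + (0 * s.1 + sc_ * s.2) ^+ 2)).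
have ig : leb2.-integrable setT (EFin \o g).
  exact: (integrableZl measurableT M (integrable_gauss2 sc0)).
pose f (s : R * R) := H q * expR (- ((ux q * s.1 + uy q * s.2) ^+ 2 + (vx q * s.1 + vy q * s.2) ^+ 2)).
have i_f := integrable_gauss2 D0.
have mf : measurable_fun setT f.
  apply: measurable_funM => //; exact: (measurable_EFinP _ _).1 (measurable_int _ i_f).
have mG n : measurable_fun setT (G n).
  apply: measurable_funM => //; apply: measurableT_comp; last exact: measurable_affine2.
  exact: (measurable_EFinP _ _).1 (measurable_int _ (iFU n)).
have Gg n s : setT s -> `|G n s| <= g s.
  move=> _; rewrite /G /g patchE; case: ifPn => [|_]; last first.
    by rewrite mulr0 normr0 mulr_ge0 ?expR_ge0.
  rewrite inE => Ux; rewrite /F mulrCA normrM; apply: ler_pM => //; first exact: HM.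
  rewrite mulrA el mul1r ger0_norm ?expR_ge0// ler_expR lerN2.
  apply: le_trans (ler_wpM2l (ltW (l0 n)) (low _ Ux)).
  rewrite !mul0r addr0 add0r !exprMn sqr_sqrtr ?(ltW c0)//.
  rewrite /x /affine /= [q.1 + _]addrC [q.2 + _]addrC !addrK !exprMn.
  have -> : l n * (c * ((n.+1%:R^-1) ^+ 2 * s.1 ^+ 2 + (n.+1%:R^-1) ^+ 2 * s.2 ^+ 2)) =
    ((n.+1%:R^-1) ^+ 2 * l n) * (c * s.1 ^+ 2 + c * s.2 ^+ 2) by ring.
  by have /= -> := el n; rewrite mul1r.
have esmall (s : R * R) d : 0 < d -> exists N, forall n, (N <= n)%N -> `|x n s - q| < d.
  move=> d0; pose B := `|s.1| + `|s.2| + 1.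
  have B0 : 0 < B by rewrite ltr_wpDl// addr_ge0.
  have dB : 0 < d / B by rewrite divr_gt0.
  exists (Num.bound (d / B)^-1) => n Nn.
  have := archi_boundP (ltW (_ : 0 < (d / B)^-1)); rewrite invr_gt0 => /(_ dB) H1.
  have eB : (e n)%:num * B < d.
    rewrite /= mulrC ltr_pdivrMr//; apply: (@lt_le_trans _ _ (d * (Num.bound (d / B)^-1)%:R)).
      by move: H1; rewrite invf_div ltr_pdivrMr// mulrC.
    by rewrite ler_pM2l// ler_nat (leq_trans Nn).
  have t1 : (e n)%:num * `|s.1| <= (e n)%:num * B.
    by rewrite ler_pM2l// /B -addrA lerDl addr_ge0.
  have t2 : (e n)%:num * `|s.2| <= (e n)%:num * B.
    by rewrite ler_pM2l// /B [_ + `|s.2|]addrC -addrA lerDl addr_ge0.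
  apply/prod_ltP; rewrite /x /affine /= [q.1 + _]addrC [q.2 + _]addrC !addrK !normrM.
  by rewrite (gtr0_norm (e0 n)); split; exact: le_lt_trans eB.
have quot (s : R * R) k kx ky : C1on U k kx ky ->
   (fun n => (k (x n s) - k q) / (e n)%:num) @ \oo --> kx q * s.1 + ky q * s.2.
  move=> Ck; apply: cvgn_epsP => d d0.
  pose B := `|s.1| + `|s.2| + 1.
  have B0 : 0 < B by rewrite ltr_wpDl// addr_ge0.
  have dB : 0 < d / B by rewrite divr_gt0.
  have [t t0 Ht] := strict_differentiable oU Ck Uq dB.
  have [N HN] := esmall s t t0; exists N => n /HN xt.
  have := Ht q (x n s); rewrite subrr normr0 => /(_ t0 xt).
  rewrite {2 3 4 5}/x /affine /= [q.1 + _]addrC [q.2 + _]addrC !addrK !normrM (gtr0_norm (e0 n)).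
  set E := k (x n s) - k q; set a := n.+1%:R^-1 => h.
  have a0 : 0 < a by exact: e0.
  have -> : E / a - (kx q * s.1 + ky q * s.2) =
     (E - (kx q * (a * s.1) + ky q * (a * s.2))) / a by field; rewrite gt_eqF.
  rewrite normrM normfV (gtr0_norm a0) ltr_pdivrMr//; apply: (le_lt_trans h).
  have -> : d / B * ((e n)%:num * `|s.1| + (e n)%:num * `|s.2|) =
    a * (d / B * (`|s.1| + `|s.2|)) by rewrite -[(e n)%:num]/a; ring.
  have -> : d * a = a * (d / B * B) by rewrite divfK ?gt_eqF// mulrC.
  by rewrite ltr_pM2l// ltr_pM2l// /B ltrDl.
have Gcvg s : setT s -> G ^~ s @ \oo --> f s.
  move=> _.
  have c1 : (fun n => H (x n s)) @ \oo --> H q.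
    apply: cvgn_epsP => d d0; have /cvg_plane_epsP/(_ d d0)[t t0 Ht] := cH.
    by have [N HN] := esmall s t t0; exists N => n /HN/Ht.
  pose A n := (u (x n s) - u q) / (e n)%:num; pose B n := (v (x n s) - v q) / (e n)%:num.
  have c6 : (fun n => H (x n s) * expR (- (A n * A n + B n * B n))) @ \oo --> f s.
    rewrite /f !expr2; apply: cvgM => //.
    have c5 : (fun n => - (A n * A n + B n * B n)) @ \oo -->
        - ((ux q * s.1 + uy q * s.2) * (ux q * s.1 + uy q * s.2) +
           (vx q * s.1 + vy q * s.2) * (vx q * s.1 + vy q * s.2)).
      by apply: cvgN; apply: cvgD; apply: cvgM; apply: quot.
    exact: (cvg_comp _ _ c5 (@continuous_expR R _)).
  apply: cvg_trans c6; apply: near_eq_cvg.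
  have [d d0 Hd] := (open_ballP U).1 oU q Uq.
  have [N HN] := esmall s d d0; exists N => // n /= /HN/Hd Ux.
  rewrite /G patchE (mem_set Ux) /F [RHS]mulrCA; congr (_ * _).
  rewrite [RHS]mulrA el mul1r; congr expR; congr (- _).
  have a0 : n.+1%:R != 0 :> R by rewrite pnatr_eq0.
  by rewrite /A /B /l /r /=; move: a0; set a : R := n.+1%:R => a0; field.
have aeG : {ae leb2, forall s, setT s -> G ^~ s @ \oo --> f s} by exact: aeW.
have [_ lim] := Rdominated_cvg (mu := leb2) measurableT mG mf aeG ig Gg.
have fE : \int[leb2]_s f s = H q * (pi / `|ux q * vy q - uy q * vx q|).
  rewrite (RintegralZl (H q) measurableT i_f); congr (_ * _).
  by rewrite /Rintegral gauss2.
rewrite fE in lim; apply: cvg_trans lim.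
suff -> : (fun n => \int[leb2]_(p in U) F n p) = (fun n => \int[leb2]_s G n s) by [].
by apply/funext.
Qed.

End Gaussian.

(** * The Cauchy kernel against L phi *)

Section KernelIdentity.
Context {R : realType}.
Local Notation leb2 := (@lebesgue_measure R \x @lebesgue_measure R)%E.
Implicit Types (U S : set (R * R)) (p q : R * R) (a b phi : R * R -> R).

Lemma mm_cvg (r : R) : 0 < r -> (fun n : nat => mm (n.+1%:R ^+ 2) r) @ \oo --> r^-1.
Proof.
move=> r0; apply: cvgn_epsP => e e0.
have er : 0 < e * r ^+ 2 by rewrite mulr_gt0// exprn_gt0.
exists (Num.bound (e * r ^+ 2)^-1) => n Nn.
set l := n.+1%:R ^+ 2.
have n1 : 1 <= n.+1%:R :> R by rewrite ler1n.
have l1 : n.+1%:R <= l by rewrite /l expr2 ler_peMl// (le_trans _ n1).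
have l0 : 0 < l by rewrite (lt_le_trans _ l1).
have B : (e * r ^+ 2)^-1 < l.
  apply: lt_le_trans l1; apply: (@lt_le_trans _ _ (Num.bound (e * r ^+ 2)^-1)%:R).
    by apply: archi_boundP; rewrite invr_ge0 ltW.
  by rewrite ler_nat (leq_trans Nn).
have -> : mm l r - r^-1 = - (expR (- (l * r)) / r) by rewrite /mm; field; rewrite gt_eqF.
rewrite normrN ger0_norm ?divr_ge0 ?expR_ge0 ?(ltW r0)//.
rewrite ltr_pdivrMr// expRN -[ltRHS]invrK ltf_pV2 ?posrE ?expR_gt0 ?invr_gt0 ?mulr_gt0//.
have := expR_ge1Dx (l * r) => H.
apply: (@lt_le_trans _ _ (l * r)); last lra.
rewrite -ltr_pdivrMr//; apply: le_lt_trans B.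
by rewrite expr2 -invfM mulrA.
Qed.

Lemma dist1_sq2 (x y : R) : 0 < x ^+ 2 + y ^+ 2 ->
  (x ^+ 2 + y ^+ 2)^-1 * (`|x| + `|y|) <= 2 * (`|x| + `|y|)^-1.
Proof.
move=> r0.
have s0 : 0 < `|x| + `|y|.
  rewrite lt_neqAle addr_ge0// andbT eq_sym paddr_eq0// !normr_eq0.
  by apply/negP => /andP[/eqP x0 /eqP y0]; move: r0; rewrite x0 y0 !expr0n addr0 ltxx.
rewrite mulrC ler_pdivrMr// mulrAC ler_pdivlMr//.
rewrite -[x ^+ 2]real_normK ?num_real// -[y ^+ 2]real_normK ?num_real//.
have : 0 <= (`|x| - `|y|) ^+ 2 by exact: sqr_ge0.
by rewrite sqrrB; set X := `|x|; set Y := `|y|; lra.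
Qed.

(** The two real components of the integral of [L phi / (Z - Z q)], at a point
    [q] of positive Jacobian. They are limits, for [l = (n + 1)^2], of those of
    [regularized_identity]: the integrals with the kernel converge by
    domination by a multiple of [1 / |Z p - Z q|], the other one by
    [blowup_limit]. *)
Lemma kernel_identity U S q (u ux uy v vx vy phi px py : R * R -> R) (M c : R) :
  open U -> (leb2 U < +oo)%E -> compact S -> S `<=` U -> U q ->
  C1on U u ux uy -> C1on U v vx vy -> C1on setT phi px py ->
  (forall p, U p -> [/\ `|u p| <= M, `|ux p| <= M & `|uy p| <= M]) ->
  (forall p, U p -> [/\ `|v p| <= M, `|vx p| <= M & `|vy p| <= M]) ->
  (forall p, [/\ `|phi p| <= M, `|px p| <= M & `|py p| <= M]) ->
  (forall p, ~ S p -> [/\ phi p = 0, px p = 0 & py p = 0]) ->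
  0 < c ->
  (forall p, U p -> c * ((p.1 - q.1) ^+ 2 + (p.2 - q.2) ^+ 2) <=
     (u p - u q) ^+ 2 + (v p - v q) ^+ 2) ->
  0 < ux q * vy q - uy q * vx q ->
  kernel_bounded_on u v U S ->
  let a p := u p - u q in let b p := v p - v q in
  [/\ leb2.-integrable U (EFin \o (fun p => (sq2 a b p)^-1 *
       (a p * (ux p * py p - uy p * px p) + b p * (vx p * py p - vy p * px p)))),
      leb2.-integrable U (EFin \o (fun p => (sq2 a b p)^-1 *
       (a p * (vx p * py p - vy p * px p) - b p * (ux p * py p - uy p * px p)))),
      \int[leb2]_(p in U) ((sq2 a b p)^-1 *
       (a p * (ux p * py p - uy p * px p) + b p * (vx p * py p - vy p * px p))) = 0 &
      \int[leb2]_(p in U) ((sq2 a b p)^-1 *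
       (a p * (vx p * py p - vy p * px p) - b p * (ux p * py p - uy p * px p))) =
      2 * pi * phi q].
Proof.
move=> oU Ufin cS SU Uq Cu Cv Cphi uM vM phiM phi0 c0 low J0 [C C0 HC] a b.
have mU : @measurable _ (measurableTypeR R * measurableTypeR R)%type U.
  exact: open_measurable_plane.
have inj p : U p -> p != q -> (u p - u q) ^+ 2 + (v p - v q) ^+ 2 != 0.
  move=> Up pq; rewrite gt_eqF//; apply: lt_le_trans (low p Up).
  rewrite mulr_gt0// lt_neqAle addr_ge0 ?sqr_ge0// andbT eq_sym.
  rewrite paddr_eq0 ?sqr_ge0// !sqrf_eq0 !subr_eq0; apply: contra pq => /andP[/eqP h1 /eqP h2].
  by rewrite [p]surjective_pairing [q]surjective_pairing h1 h2.
have phi00 p : ~ S p -> phi p = 0 by move=> /phi0[].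
pose l (n : nat) : R := n.+1%:R ^+ 2.
have l0 n : 0 < l n by rewrite exprn_gt0.
have reg n := regularized_identity oU Ufin cS SU Uq (l0 n) Cu Cv Cphi uM vM phiM phi00 inj.
have [M00 _ _] := phiM q; have {M00} M0 : 0 <= M by rewrite (le_trans _ M00).
have oT : open [set: R * R] by exact: openT.
have [ma mux muy] := C1on_measurable oU (C1on_subcst (u q) Cu : C1on U a ux uy).
have [mb mvx mvy] := C1on_measurable oU (C1on_subcst (v q) Cv : C1on U b vx vy).
have [mphi mpx mpy] := C1on_measurable oU (C1on_sub (fun p _ => I) Cphi : C1on U phi px py).
have mr := measurable_sq2 ma mb.
pose W1 p := a p * (ux p * py p - uy p * px p) + b p * (vx p * py p - vy p * px p).
pose W2 p := a p * (vx p * py p - vy p * px p) - b p * (ux p * py p - uy p * px p).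
have mW1 : measurable_fun U W1.
  by apply: measurable_funD; apply: measurable_funM => //; apply: measurable_funB; apply: measurable_funM.
have mW2 : measurable_fun U W2.
  by apply: measurable_funB; apply: measurable_funM => //; apply: measurable_funB; apply: measurable_funM.
pose N : R := M * M + M * M.
have N0 : 0 <= N by rewrite addr_ge0 ?mulr_ge0.
have brk (x y z w : R) : `|x| <= M -> `|y| <= M -> `|z| <= M -> `|w| <= M ->
    `|x * y - z * w| <= N.
  by move=> ? ? ? ?; rewrite (le_trans (ler_normB _ _))// !normrM lerD// ler_pM.
have W1N p : U p -> `|W1 p| <= (`|a p| + `|b p|) * N.
  move=> Up; have [_ h1 h2] := uM p Up; have [_ h3 h4] := vM p Up; have [_ h5 h6] := phiM p.
  rewrite (le_trans (ler_normD _ _))// !normrM mulrDl lerD// ler_wpM2l//; exact: brk.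
have W2N p : U p -> `|W2 p| <= (`|a p| + `|b p|) * N.
  move=> Up; have [_ h1 h2] := uM p Up; have [_ h3 h4] := vM p Up; have [_ h5 h6] := phiM p.
  rewrite (le_trans (ler_normB _ _))// !normrM mulrDl lerD// ler_wpM2l//; exact: brk.
have W0 p : ~ S p -> W1 p = 0 /\ W2 p = 0.
  by move=> /phi0[_ h1 h2]; rewrite /W1 /W2 h1 h2 !mulr0 !subr0 !mulr0 subrr addr0.
have mS : @measurable _ (measurableTypeR R * measurableTypeR R)%type S.
  exact: compact_measurable_plane.
pose k p := (dist1 u v p q)^-1.
have k0 p : 0 <= k p by rewrite invr_ge0 dist1_ge0.
have mk : measurable_fun U (EFin \o k).
  apply: measurable_kernel => // p; [exact: C1on_continuous oU Cu|exact: C1on_continuous oU Cv].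
have ik : leb2.-integrable S (EFin \o k).
  apply/integrableP; split; first exact: (measurable_funS _ SU mk).
  under eq_integral do rewrite /= ger0_norm ?k0//.
  by rewrite (le_lt_trans (HC q Uq))// ltry.
have ikS : leb2.-integrable U (EFin \o (k \_ S)).
  have h := (@integrable_mkcond _ _ _ leb2 S (EFin \o k) mS).1 ik.
  have E : (EFin \o k) \_ S = EFin \o (k \_ S).
    by apply/funext => p; rewrite /= !patchE; case: ifP.
  by rewrite E in h; apply: (@integrableS _ _ _ leb2 setT).
pose g p := 2 * N * (k \_ S) p.
have ig : leb2.-integrable U (EFin \o g) by exact: (integrableZl mU (2 * N) ikS).
have r0 p : 0 <= sq2 a b p by rewrite addr_ge0 ?sqr_ge0.
have dom (W : R * R -> R) : (forall p, U p -> `|W p| <= (`|a p| + `|b p|) * N) ->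
    (forall p, ~ S p -> W p = 0) -> forall n p, U p -> `|mm (l n) (sq2 a b p) * W p| <= g p.
  move=> WN W00 n p Up; rewrite /g patchE; case: ifPn => [_|]; last first.
    by rewrite notin_setE => /W00 ->; rewrite !mulr0 normr0.
  have [/andP[m1 _] m2] := mm_bound (ltW (l0 n)) (r0 p).
  rewrite normrM (ger0_norm m1).
  have [r0E|r_neq0] := eqVneq (sq2 a b p) 0.
    have /eqP := r0E; rewrite /sq2 paddr_eq0 ?sqr_ge0// !sqrf_eq0 => /andP[/eqP a0 /eqP b0].
    have := WN p Up; rewrite a0 b0 normr0 addr0 mul0r => w0.
    have -> : `|W p| = 0 by apply/eqP; rewrite eq_le w0 normr_ge0.
    by rewrite mulr0 !mulr_ge0.
  have rp : 0 < sq2 a b p by rewrite lt_neqAle eq_sym r_neq0 r0.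
  apply: (@le_trans _ _ ((sq2 a b p)^-1 * ((`|a p| + `|b p|) * N))).
    by apply: ler_pM => //; [exact: m2|exact: WN].
  have -> : 2 * N * k p = 2 * k p * N by ring.
  by rewrite mulrA ler_wpM2r//; exact: dist1_sq2.
have aeq := ae_neq_plane q.
have lim (W : R * R -> R) : measurable_fun U W ->
    (forall p, U p -> `|W p| <= (`|a p| + `|b p|) * N) -> (forall p, ~ S p -> W p = 0) ->
    leb2.-integrable U (EFin \o (fun p => (sq2 a b p)^-1 * W p)) /\
    (fun n => \int[leb2]_(p in U) (mm (l n) (sq2 a b p) * W p)) @ \oo -->
    \int[leb2]_(p in U) ((sq2 a b p)^-1 * W p).
  move=> mW WN W00.
  have mf_ n : measurable_fun U (fun p => mm (l n) (sq2 a b p) * W p).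
    by apply: measurable_funM => //; exact: measurable_mm.
  have mf : measurable_fun U (fun p => (sq2 a b p)^-1 * W p).
    by apply: measurable_funM => //; exact: measurable_funV.
  apply: (Rdominated_cvg (mu := leb2) mU mf_ mf _ ig (dom W WN W00)).
  move: aeq; apply: (filterS (F := almost_everywhere leb2)) => p pq Up.
  apply: cvgM; last exact: cvg_cst.
  by apply: mm_cvg; rewrite lt_neqAle eq_sym (inj p Up pq) r0.
have [i1 l1] := lim W1 mW1 W1N (fun p nS => (W0 p nS).1).
have [i2 l2] := lim W2 mW2 W2N (fun p nS => (W0 p nS).2).
split => //.
- have E : (fun n => \int[leb2]_(p in U) (mm (l n) (sq2 a b p) * W1 p)) = (fun=> 0).
    by apply/funext => n; exact: (reg n).1.
  rewrite E in l1; apply/esym; exact: (cvg_unique _ (cvg_cst 0) l1).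
have E : (fun n => \int[leb2]_(p in U) (mm (l n) (sq2 a b p) * W2 p)) =
   (fun n => 2 * \int[leb2]_(p in U) (phi p * (ux p * vy p - uy p * vx p) *
                           (l n * expR (- (l n * sq2 a b p))))).
  by apply/funext => n; exact: (reg n).2.
rewrite E in l2.
have mJ : measurable_fun U (fun p => phi p * (ux p * vy p - uy p * vx p)).
  by apply: measurable_funM => //; apply: measurable_funB; apply: measurable_funM.
have [_ _ cux cuy] := Cu _ Uq; have [_ _ cvx cvy] := Cv _ Uq.
have cphi : {for q, continuous phi} by exact: C1on_continuous oT Cphi Logic.I.
have cJ : {for q, continuous (fun p => phi p * (ux p * vy p - uy p * vx p))}.
  by apply: continuousM => //; apply: continuousB; apply: continuousM.
have JM p : U p -> `|phi p * (ux p * vy p - uy p * vx p)| <= M * N.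
  move=> Up; have [_ h1 h2] := uM p Up; have [_ h3 h4] := vM p Up; have [h5 _ _] := phiM p.
  by rewrite normrM ler_pM// brk.
have J_neq0 : ux q * vy q - uy q * vx q != 0 by rewrite gt_eqF.
have l3 := blowup_limit oU Ufin Uq Cu Cv mJ cJ JM c0 low J_neq0.
have l4 : (fun n => 2 * \int[leb2]_(p in U) (phi p * (ux p * vy p - uy p * vx p) *
    (l n * expR (- (l n * sq2 a b p))))) @ \oo -->
  2 * (phi q * (ux q * vy q - uy q * vx q) * (pi / `|ux q * vy q - uy q * vx q|)).
  by apply: cvgM; [exact: cvg_cst|exact: l3].
rewrite -(cvg_unique _ l4 l2) // gtr0_norm//.
by field.
Qed.

End KernelIdentity.

(** * Defining functions of curves *)

Section DefiningFunctions.
Context {R : realType}.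
Local Notation leb := (@lebesgue_measure R).
Local Notation leb2 := (@lebesgue_measure R \x @lebesgue_measure R)%E.
Implicit Types (U W : set (R * R)) (p q : R * R).

(** Near [p0] the function [g] increases along horizontal lines with slope at
    least some [m > 0], so each point [p] is at horizontal distance at most
    [|g p| / m] from a zero of [g], which is also a zero of [f]. *)
Lemma defining_compare_x W p0 (f fx fy g gx gy : R * R -> R) :
  open W -> W p0 -> C1on W f fx fy -> C1on W g gx gy ->
  (forall p, W p -> g p = 0 -> f p = 0) -> g p0 = 0 -> 0 < gx p0 ->
  exists r c : R, [/\ 0 < r, 0 < c, (forall p, `|p - p0| < r -> W p) &
    forall p, `|p - p0| < r -> c * `|f p| <= `|g p|].
Proof.
move=> oW Wp Cf Cg gf g0 gx0.
have [_ _ cgx _] := Cg _ Wp; have [_ _ cfx _] := Cf _ Wp.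
pose m := gx p0 / 2; have m0 : 0 < m by rewrite divr_gt0.
have /cvg_plane_epsP/(_ _ m0)[d1 d10 Hd1] := cgx.
have /cvg_plane_epsP/(_ _ ltr01)[d2 d20 Hd2] := cfx.
have [d3 d30 Hd3] := (open_ballP W).1 oW p0 Wp.
pose r := Num.min d1 (Num.min d2 d3).
have r0 : 0 < r by rewrite !lt_min d10 d20 d30.
pose M := `|fx p0| + 1; have M0 : 0 < M by rewrite ltr_wpDl.
have B p : `|p - p0| < r -> [/\ W p, m <= gx p & `|fx p| <= M].
  rewrite !lt_min => /and3P[/Hd1 h1 /Hd2 h2 /Hd3 h3]; split => //.
    by move: h1; rewrite ltr_norml /m => /andP[? _]; lra.
  by have := ler_distD (fx p0) (fx p) 0; rewrite !subr0 /M; lra.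
have mr : 0 < m * (r / 2) by rewrite mulr_gt0// divr_gt0.
have /cvg_plane_epsP/(_ _ mr)[d4 d40 Hd4] : {for p0, continuous g}.
  exact: C1on_continuous oW Cg Wp.
exists (Num.min (r / 2) d4), (m / M); split.
- by rewrite lt_min d40 divr_gt0.
- by rewrite divr_gt0.
- by move=> p; rewrite lt_min => /andP[pr _]; have [] := B p ltac:(lra).
move=> p; rewrite lt_min => /andP[pr /Hd4]; rewrite g0 subr0 => gp.
pose d := `|g p| / m.
have d0 : 0 <= d by rewrite divr_ge0// ltW.
have dr : d < r / 2 by rewrite ltr_pdivrMr// mulrC.
have /prod_ltP[p1 p2] := pr.
have I x : p.1 - d <= x <= p.1 + d -> `|(x, p.2) - p0| < r.
  move=> /andP[x1 x2]; apply/prod_ltP => /=; split; last by clear -p2 r0; lra.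
  clear -x1 x2 p1 dr; move: p1; rewrite !ltr_norml => /andP[? ?].
  by apply/andP; split; lra.
have [pm pp pmp] : [/\ p.1 - d <= p.1, p.1 <= p.1 + d & p.1 - d <= p.1 + d].
  by clear -d0; split; lra.
have slope x y : p.1 - d <= x -> x <= y -> y <= p.1 + d -> m * (y - x) <= g (y, p.2) - g (x, p.2).
  move=> xd xy yd.
  have st s : x <= s <= y -> `|(s, p.2) - p0| < r.
    by move=> /andP[? ?]; apply: I; rewrite (le_trans xd)// (le_trans _ yd).
  have [s /st/B[_ B1 _] ->] := @MVT_le _ (fun s => g (s, p.2)) (fun s => gx (s, p.2)) x y xy
    ltac:(by move=> s /st/B[/Cg[]]).
  by rewrite ler_wpM2r// subr_ge0.
have md : m * d = `|g p| by rewrite /d mulrC divfK// gt_eqF.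
have pE : (p.1, p.2) = p by case: (p).
have [||| x] := @IVT R (fun x => g (x, p.2)) (p.1 - d) (p.1 + d) 0.
- exact: pmp.
- apply: derivable_within_continuous => x; rewrite in_itv /= => /I/B[/Cg[h _ _ _] _ _].
  by case: h.
- have s1 := slope (p.1 - d) p.1 (lexx _) pm pp.
  have s2 := slope p.1 (p.1 + d) pm pp (lexx _).
  rewrite /= pE in s1 s2.
  have e1 : m * (p.1 - (p.1 - d)) = `|g p| by rewrite -md; congr (_ * _); ring.
  have e2 : m * (p.1 + d - p.1) = `|g p| by rewrite -md; congr (_ * _); ring.
  rewrite e1 in s1; rewrite e2 in s2.
  have := ler_norm (g p); have := ler_norm (- g p); rewrite normrN => n1 n2.
  clear -s1 s2 n1 n2.
  by rewrite ge_min le_max; apply/andP; split; apply/orP; [left|right]; lra.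
rewrite in_itv /= => xI gx_.
have [Wx _ _] := B _ (I x xI).
have fx_ := gf _ Wx gx_.
have btw s : between x p.1 s -> `|(s, p.2) - p0| < r.
  move=> /betweenP h; apply: I; clear -h xI pm pp; move: xI => /andP[? ?].
  by case: h => /andP[? ?]; apply/andP; split; lra.
have [s /btw/B[_ _ B3] E] := @MVT_between _ (fun s => f (s, p.2)) (fun s => fx (s, p.2)) x p.1
  ltac:(by move=> s /btw/B[/Cf[]]).
rewrite /= pE fx_ subr0 in E.
have xd : `|p.1 - x| <= d 
  by clear -xI; rewrite ler_norml; move: xI => /andP[? ?]; apply/andP; split; lra.
rewrite E normrM.
have h1 : `|fx (s, p.2)| * `|p.1 - x| <= M * d by exact: ler_pM.
have h2 := ler_wpM2l (ltW (divr_gt0 m0 M0)) h1; apply: (le_trans h2).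
by rewrite -md mulrA divfK// gt_eqF.
Qed.

(** Of two functions defining the same curve, the one with nonzero gradient
    dominates the other. *)
Lemma defining_compare W p0 (f fx fy g gx gy : R * R -> R) :
  open W -> W p0 -> C1on W f fx fy -> C1on W g gx gy ->
  (forall p, W p -> g p = 0 -> f p = 0) -> g p0 = 0 -> (gx p0, gy p0) != (0, 0) ->
  exists r c : R, [/\ 0 < r, 0 < c, (forall p, `|p - p0| < r -> W p) &
    forall p, `|p - p0| < r -> c * `|f p| <= `|g p|].
Proof.
move=> oW Wp Cf Cg gf g0.
suff pos (V : set (R * R)) (q0 : R * R) (h hx hy k kx ky : R * R -> R) :
    open V -> V q0 -> C1on V h hx hy -> C1on V k kx ky ->
    (forall p, V p -> k p = 0 -> h p = 0) -> k q0 = 0 -> kx q0 != 0 ->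
    exists r c : R, [/\ 0 < r, 0 < c, (forall p, `|p - q0| < r -> V p) &
      forall p, `|p - q0| < r -> c * `|h p| <= `|k p|].
  have [gx0|gx0 _] := eqVneq (gx p0) 0; last exact: (pos W p0 f fx fy g gx gy).
  have [->|gy0 _] := eqVneq (gy p0) 0; first by rewrite gx0 eqxx.
  have Ws : (@swap R @^-1` W) (swap p0) by rewrite /preimage /= swapK.
  have [|||r [c [r0 c0 rV H]]] := pos _ (swap p0) _ _ _ _ _ _ (open_swap oW) Ws (C1on_swap Cf) (C1on_swap Cg).
  - by move=> p /gf; apply.
  - by rewrite /= swapK.
  - by rewrite /= swapK.
  - exists r, c; split => // p.
      by rewrite -norm_swap => /rV; rewrite /preimage /= swapK.
    by rewrite -norm_swap => /H; rewrite /= swapK.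
move=> oV Vq Ch Ck kh k0 kx0.
have [kx1|] := ltP 0 (kx q0); first exact: (defining_compare_x oV Vq Ch Ck).
rewrite le_eqVlt (negbTE kx0) /= => kx1.
have [||| r [c [r0 c0 rV H]]] := defining_compare_x oV Vq Ch (C1onN Ck).
- by move=> p Vp /eqP; rewrite oppr_eq0 => /eqP; exact: kh.
- by rewrite k0 oppr0.
- by rewrite oppr_gt0.
by exists r, c; split => // p /H; rewrite normrN.
Qed.

(** The zero set of a function with nonvanishing [x]-derivative meets each
    horizontal line in at most one point. *)
Lemma null_zero_set_x W p0 (f fx fy : R * R -> R) :
  open W -> W p0 -> C1on W f fx fy -> fx p0 != 0 ->
  exists2 r : R, 0 < r & (forall p, `|p - p0| < r -> W p) /\
    forall A : set (R * R), measurable A ->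
      (forall p, A p -> `|p - p0| < r /\ f p = 0) -> leb2 A = 0%E.
Proof.
move=> oW Wp Cf fx0.
have [_ _ cfx _] := Cf _ Wp.
have n0 : 0 < `|fx p0| by rewrite normr_gt0.
have /cvg_plane_epsP/(_ _ n0)[d1 d10 Hd1] := cfx.
have [d3 d30 Hd3] := (open_ballP W).1 oW p0 Wp.
pose r := Num.min d1 d3.
have r0 : 0 < r by rewrite lt_min d10 d30.
have rW p : `|p - p0| < r -> W p by rewrite lt_min => /andP[_ /Hd3].
exists r => //; split => // A mA HA.
have mA' : measurable_fun setT (fun p : R * R => (\1_A p)%:E : \bar R).
  by apply/measurable_EFinP; exact: measurable_indic.
have -> : (leb2 A = \int[leb2]_p (\1_A p)%:E)%E.
  by rewrite integral_indic ?setIT.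
have E : (\int[leb2]_p (\1_A p)%:E = \int[leb]_y \int[leb]_x (\1_A (x, y))%:E)%E.
  by apply: (@fubini_tonelli2 _ _ _ _ _ leb leb (fun p : R * R => (\1_A p)%:E) mA') => p; rewrite lee_fin.
rewrite E; apply: integral0_eq => y _.
have [[x0 Ax0]|none] := pselect (exists x0, A (x0, y)); last first.
  apply: integral0_eq => x _; rewrite indicE memNset// => Ax; apply: none; by exists x.
have sub x : A (x, y) -> x = x0.
  move=> Ax; have [xr fx_] := HA _ Ax; have [x0r fx0_] := HA _ Ax0.
  have /prod_ltP[/= x1 y1] := xr; have /prod_ltP[/= x2 _] := x0r.
  have btw s : between x x0 s -> `|(s, y) - p0| < r.
    by move=> /between_dist/(_ x1 x2) h; apply/prod_ltP.
  have [s /btw sr] := @MVT_between _ (fun s => f (s, y)) (fun s => fx (s, y)) x x0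
    ltac:(by move=> s /btw/rW/Cf[]).
  rewrite /= fx_ fx0_ subrr => /esym/eqP; rewrite mulf_eq0 subr_eq0 => /orP[/eqP fs0|/eqP //].
  move: sr; rewrite lt_min => /andP[/Hd1 + _].
  by rewrite fs0 sub0r normrN ltxx.
have -> : (\int[leb]_x (\1_A (x, y))%:E = \int[leb]_(x in [set x0]) (\1_A (x, y))%:E)%E.
  rewrite [RHS]integral_mkcond; apply: eq_integral => x _.
  rewrite patchE; case: ifPn => //; rewrite notin_setE /= => xx0.
  by rewrite indicE memNset// => /sub.
by rewrite integral_set1.
Qed.

Lemma leb2_swap (A : set (R * R)) : measurable A -> leb2 A = leb2 (@swap R @^-1` A).
Proof.
move=> mA.
have ms : measurable_fun setT (@swap R).
  by apply/measurable_fun_pairP; split; [exact: measurable_snd|exact: measurable_fst].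
have mB : measurable (@swap R @^-1` A) by rewrite -[X in measurable X]setTI; exact: ms.
have mA' : measurable_fun setT (fun p : R * R => (\1_A p)%:E : \bar R).
  by apply/measurable_EFinP; exact: measurable_indic.
have -> : (leb2 A = \int[leb2]_p (\1_A p)%:E)%E by rewrite integral_indic ?setIT.
rewrite (ge0_integral_swap mA') => [|p]; last by rewrite lee_fin.
have -> : (leb2 (@swap R @^-1` A) = \int[leb2]_p (\1_(@swap R @^-1` A) p)%:E)%E.
  by rewrite integral_indic ?setIT.
by [].
Qed.

Lemma null_zero_set W p0 (f fx fy : R * R -> R) :
  open W -> W p0 -> C1on W f fx fy -> (fx p0, fy p0) != (0, 0) ->
  exists2 r : R, 0 < r & (forall p, `|p - p0| < r -> W p) /\
    forall A : set (R * R), measurable A ->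
      (forall p, A p -> `|p - p0| < r /\ f p = 0) -> leb2 A = 0%E.
Proof.
move=> oW Wp Cf.
have [fx0|fx0 _] := eqVneq (fx p0) 0; last exact: (null_zero_set_x oW Wp Cf).
have [->|fy0 _] := eqVneq (fy p0) 0; first by rewrite fx0 eqxx.
have [||r r0 [rW H]] := null_zero_set_x (p0 := swap p0) (open_swap oW) _ (C1on_swap Cf).
- by rewrite /preimage /= swapK.
- by rewrite /= swapK.
exists r => //; split.
  by move=> p; rewrite -norm_swap => /rW; rewrite /preimage /= swapK.
move=> A mA HA; rewrite leb2_swap//; apply: H.
  have ms : measurable_fun setT (@swap R).
    by apply/measurable_fun_pairP; split; [exact: measurable_snd|exact: measurable_fst].
  by rewrite -[X in measurable X]setTI; exact: ms.
by move=> p /HA; rewrite -[X in `|_ - X|]swapK norm_swap.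
Qed.

(** [|Z p - Z q|] is at least a constant times [|p - q|]: for [p] near [q]
    because the differential of [Z] at [q] is invertible, for other [p] because
    [Z p] stays away from [Z q]. *)
Lemma lower_quadratic U q (u ux uy v vx vy : R * R -> R) (D : R) :
  open U -> U q -> C1on U u ux uy -> C1on U v vx vy ->
  ux q * vy q - uy q * vx q != 0 ->
  (forall p, U p -> `|p - q| <= D) ->
  (forall e : R, 0 < e -> exists2 h : R, 0 < h & forall p, U p ->
     dist1 u v p q < h -> `|p - q| < e) ->
  exists2 c : R, 0 < c & forall p, U p ->
    c * ((p.1 - q.1) ^+ 2 + (p.2 - q.2) ^+ 2) <= (u p - u q) ^+ 2 + (v p - v q) ^+ 2.
Proof.
move=> oU Uq Cu Cv J0 UD inj.
set J := ux q * vy q - uy q * vx q in J0.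
have nJ : 0 < `|J| by rewrite normr_gt0.
pose K := `|ux q| + `|uy q| + `|vx q| + `|vy q| + 1.
have K0 : 0 < K by rewrite ltr_wpDl// !addr_ge0.
have e0 : 0 < `|J| / (4 * K) by rewrite divr_gt0// mulr_gt0.
set e := `|J| / (4 * K) in e0.
have eK : 4 * (K * e) = `|J| by rewrite /e; field; rewrite gt_eqF.
have [d1 d10 Hd1] := strict_differentiable oU Cu Uq e0.
have [d2 d20 Hd2] := strict_differentiable oU Cv Uq e0.
have d0 : 0 < Num.min d1 d2 by rewrite lt_min d10.
have [h h0 Hh] := inj _ d0.
have D0 : 0 < `|D| + 1 by rewrite ltr_wpDl.
pose c1 := Num.min (2 * e) (h / (2 * (`|D| + 1))).
have c10 : 0 < c1 by rewrite lt_min !(divr_gt0, mulr_gt0).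
have lin p : U p -> c1 * (`|p.1 - q.1| + `|p.2 - q.2|) <= dist1 u v p q.
  move=> Up; set s1 := p.1 - q.1; set s2 := p.2 - q.2.
  have [near|far] := ltP (dist1 u v p q) h; last first.
    have /prod_leP[b1 b2] := UD p Up.
    have DD := ler_norm D.
    apply: le_trans far; apply: (@le_trans _ _ (h / (2 * (`|D| + 1)) * (2 * (`|D| + 1)))).
      apply: ler_pM => //; rewrite ?addr_ge0 ?(ltW c10)//.
        by rewrite ge_min lexx orbT.
      by rewrite /s1 /s2; clear -b1 b2 DD; lra.
    by rewrite divfK// gt_eqF// mulr_gt0.
  have := Hh p Up near; rewrite lt_min => /andP[p1 p2].
  have q0 : `|q - q| = 0 by rewrite subrr normr0.
  have := Hd1 q p; rewrite q0 => /(_ d10 p1); rewrite -/s1 -/s2 => H1.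
  have := Hd2 q p; rewrite q0 => /(_ d20 p2); rewrite -/s1 -/s2 => H2.
  set U1 := ux q * s1 + uy q * s2 in H1; set V1 := vx q * s1 + vy q * s2 in H2.
  have Js1 : J * s1 = vy q * U1 - uy q * V1 by rewrite /J /U1 /V1; ring.
  have Js2 : J * s2 = ux q * V1 - vx q * U1 by rewrite /J /U1 /V1; ring.
  have n1 : `|J| * `|s1| <= `|vy q| * `|U1| + `|uy q| * `|V1|.
    by rewrite -normrM Js1 (le_trans (ler_normB _ _))// !normrM.
  have n2 : `|J| * `|s2| <= `|ux q| * `|V1| + `|vx q| * `|U1|.
    by rewrite -normrM Js2 (le_trans (ler_normB _ _))// !normrM.
  have n3 : `|J| * (`|s1| + `|s2|) <= K * (`|U1| + `|V1|).
    have k1 : 0 <= (`|ux q| + `|uy q| + 1) * `|U1| by rewrite mulr_ge0// !addr_ge0.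
    have k2 : 0 <= (`|vx q| + `|vy q| + 1) * `|V1| by rewrite mulr_ge0// !addr_ge0.
    have -> : K * (`|U1| + `|V1|) = (`|vy q| * `|U1| + `|uy q| * `|V1|) +
      (`|ux q| * `|V1| + `|vx q| * `|U1|) + (`|ux q| + `|uy q| + 1) * `|U1| +
      (`|vx q| + `|vy q| + 1) * `|V1| - `|U1| * 0 by rewrite /K; ring.
    by rewrite mulrDr mulr0 subr0; clear -n1 n2 k1 k2; lra.
  have n4 : 4 * e * (`|s1| + `|s2|) <= `|U1| + `|V1|.
    rewrite -(ler_pM2l K0); apply: le_trans n3.
    have -> : K * (4 * e * (`|s1| + `|s2|)) = 4 * (K * e) * (`|s1| + `|s2|) by ring.
    by rewrite eK.
  have t1 : `|U1| <= `|u p - u q| + e * (`|s1| + `|s2|).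
    by have := ler_distD (u p - u q) U1 0; rewrite !subr0 (distrC U1); clear -H1; lra.
  have t2 : `|V1| <= `|v p - v q| + e * (`|s1| + `|s2|).
    by have := ler_distD (v p - v q) V1 0; rewrite !subr0 (distrC V1); clear -H2; lra.
  apply: (@le_trans _ _ (2 * e * (`|s1| + `|s2|))).
    by rewrite ler_wpM2r ?addr_ge0// ge_min lexx.
  move: n4 t1 t2; rewrite /dist1; set T := `|s1| + `|s2|.
  have -> : 4 * e * T = 4 * (e * T) by ring.
  have -> : 2 * e * T = 2 * (e * T) by ring.
  by clear; lra.
exists (c1 ^+ 2 / 2); first by rewrite divr_gt0// exprn_gt0.
move=> p Up; have := lin p Up; rewrite /dist1.
set s1 := p.1 - q.1; set s2 := p.2 - q.2; set x := u p - u q; set y := v p - v q.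
clearbody s1 s2 x y => H.
have H2 : (c1 * (`|s1| + `|s2|)) ^+ 2 <= (`|x| + `|y|) ^+ 2.
  by rewrite ler_sqr ?nnegrE ?addr_ge0// mulr_ge0 ?addr_ge0// ltW.
have xy : (`|x| + `|y|) ^+ 2 <= 2 * (x ^+ 2 + y ^+ 2).
  have := sqr_ge0 (`|x| - `|y|); rewrite sqrrB sqrrD !real_normK ?num_real//.
  by clear; set X := _ * _; lra.
have ss : s1 ^+ 2 + s2 ^+ 2 <= (`|s1| + `|s2|) ^+ 2.
  rewrite sqrrD !real_normK ?num_real// -addrA lerD2l lerDr.
  by rewrite mulrn_wge0// mulr_ge0.
have c2 : 0 <= c1 ^+ 2 by exact: sqr_ge0.
have := ler_wpM2l c2 ss; rewrite exprMn in H2.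
have -> : c1 ^+ 2 / 2 * (s1 ^+ 2 + s2 ^+ 2) = c1 ^+ 2 * (s1 ^+ 2 + s2 ^+ 2) / 2 by ring.
lra.
Qed.

End DefiningFunctions.

(** * Hoelder regularity, homeomorphisms and test functions *)

Section Regularity.
Context {R : realType}.
Local Notation leb2 := (@lebesgue_measure R \x @lebesgue_measure R)%E.
Implicit Types (U W S D : set (R * R)) (p q : R * R) (f : R * R -> R).

Lemma hoelder_continuous (eps : R) U S f p : 0 < eps -> open U -> U `<=` S -> U p ->
  hoelder_on eps S f -> {for p, continuous f}.
Proof.
move=> eps0 oU US Up [C HC]; apply/cvg_plane_epsP => e e0.
have [d d0 Hd] := (open_ballP U).1 oU p Up.
have C1 : 0 < `|C| + 1 by rewrite ltr_wpDl.
pose d1 := (e / (`|C| + 1)) `^ eps^-1.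
have d10 : 0 < d1 by rewrite powR_gt0// divr_gt0.
exists (Num.min d d1); first by rewrite lt_min d0.
move=> q; rewrite lt_min => /andP[/Hd/US Sq qd].
apply: (le_lt_trans (HC q p Sq (US _ Up))).
apply: (@le_lt_trans _ _ (`|C| * `|q - p| `^ eps)).
  by rewrite ler_wpM2r ?powR_ge0// ler_norm.
have h : `|q - p| `^ eps <= e / (`|C| + 1).
  have -> : e / (`|C| + 1) = d1 `^ eps.
    by rewrite /d1 -powRrM mulVf ?gt_eqF// powRr1// divr_ge0// ltW.
  by rewrite ge0_ler_powR ?nnegrE ?(ltW d10) ?(ltW eps0)// ltW.
apply: (@le_lt_trans _ _ (`|C| * (e / (`|C| + 1)))); first by rewrite ler_wpM2l.
by rewrite mulrCA gtr_pMr// ltr_pdivrMr// mul1r ltrDl.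
Qed.

Lemma hoelder_bounded (eps D : R) S f : 0 < eps ->
  (forall p q, S p -> S q -> `|p - q| <= D) -> hoelder_on eps S f ->
  exists M : R, forall p, S p -> `|f p| <= M.
Proof.
move=> eps0 HD [C HC].
have [[p0 Sp0]|none] := pselect (exists p0, S p0); last first.
  by exists 0 => p Sp; case: none; exists p.
exists (`|f p0| + `|C| * D `^ eps) => p Sp.
have := ler_distD (f p0) (f p) 0; rewrite !subr0 => H1; apply: (le_trans H1).
rewrite addrC lerD2l; apply: (le_trans (HC _ _ Sp Sp0)).
have D0 := HD _ _ Sp Sp0.
apply: (@le_trans _ _ (`|C| * `|p - p0| `^ eps)).
  by rewrite ler_wpM2r ?powR_ge0// ler_norm.
by rewrite ler_wpM2l// ge0_ler_powR ?nnegrE ?(ltW eps0)// (le_trans _ D0).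
Qed.

Lemma C1_plus_C1on U f : open U -> C1_plus U f -> C1on U f (dx f) (dy f).
Proof.
move=> oU [e e0 [Df [hx hy]]] p Up; have [d1 d2] := Df p Up; split.
- exact: ((is_derive_lineX _ _ _).1 (DeriveDef d1 erefl)).
- exact: ((is_derive_lineY _ _ _).1 (DeriveDef d2 erefl)).
- exact: (hoelder_continuous e0 oU (fun _ => id) Up hx).
- exact: (hoelder_continuous e0 oU (fun _ => id) Up hy).
Qed.

Lemma C1_hoelder_closure_C1on (eps : R) D f fx fy : 0 < eps -> open D ->
  C1_hoelder_closure eps D f fx fy -> C1on D f fx fy.
Proof.
move=> e0 oD [cf [df [hx hy]]] p Dp; have [d1 d2] := df p Dp; split.
- exact/is_derive_lineX.
- exact/is_derive_lineY.
- exact: (hoelder_continuous e0 oD (@subset_closure _ D) Dp hx).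
- exact: (hoelder_continuous e0 oD (@subset_closure _ D) Dp hy).
Qed.

Lemma compact_diameter S : compact S ->
  exists D : R, forall p q, S p -> S q -> `|p - q| <= D.
Proof.
move=> /compact_bounded[M [_ HM]]; have {}HM := HM (M + 1) ltac:(lra).
exists ((M + 1) + (M + 1)) => p q Sp Sq.
by rewrite (le_trans (ler_normB _ _))// lerD// HM.
Qed.

Lemma C1_hoelder_closure_bounded (eps : R) D f fx fy : 0 < eps ->
  compact (closure D) -> C1_hoelder_closure eps D f fx fy ->
  exists M : R, forall p, closure D p -> [/\ `|f p| <= M, `|fx p| <= M & `|fy p| <= M].
Proof.
move=> e0 cD [cf [_ [hx hy]]].
have [d Hd] := compact_diameter cD.
have [Mx HMx] := hoelder_bounded e0 Hd hx.
have [My HMy] := hoelder_bounded e0 Hd hy.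
have /compact_bounded[M [_ HM]] := continuous_compact cf cD.
have {}HM := HM (M + 1) ltac:(lra).
exists (`|M + 1| + `|Mx| + `|My|) => p cp; split.
- have h : `|f p| <= M + 1 := HM (f p) (ex_intro2 _ _ p cp erefl).
  have := ler_norm (M + 1); have := normr_ge0 Mx; have := normr_ge0 My; lra.
- have := HMx p cp; have := ler_norm Mx; have := normr_ge0 (M+1); have := normr_ge0 My; lra.
- have := HMy p cp; have := ler_norm My; have := normr_ge0 (M+1); have := normr_ge0 Mx; lra.
Qed.

Lemma homeomorphism_inverse_continuous S (h : R * R -> R[i]) p0 :
  homeomorphism_onto_image S h -> S p0 -> forall e : R, 0 < e ->
  exists2 d : R, 0 < d & forall q, S q ->
    dist1 (re_part h) (im_part h) q p0 < d -> `|q - p0| < e.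
Proof.
move=> [_ [g [gK cg]]] Sp e e0.
have := (subspace_continuousP _ _).1 cg (C_to_plane (h p0)) (ex_intro2 _ _ p0 Sp erefl).
move/cvgrPdist_lt => /(_ e e0); rewrite near_withinE => /nbhs_ballP[d d0 Hd].
exists d => // q Sq qd.
have := Hd (C_to_plane (h q)).
rewrite -ball_normE /= distrC => H.
have {}H := H _ (ex_intro2 _ _ q Sq erefl).
rewrite /from_subspace /= !gK// in H; rewrite distrC; apply: H.
apply/prod_ltP; rewrite /C_to_plane /=; move: qd; rewrite /dist1 /re_part /im_part.
have := normr_ge0 (complex.Re (h q) - complex.Re (h p0)).
by have := normr_ge0 (complex.Im (h q) - complex.Im (h p0)); split; lra.
Qed.

Lemma Cn2_C1on f : Cn 2 f -> C1on setT f (dx f) (dy f).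
Proof.
move=> [_ [df [[cx _] [cy _]]]] p _; have [d1 d2] := df p; split.
- exact: ((is_derive_lineX _ _ _).1 (DeriveDef d1 erefl)).
- exact: ((is_derive_lineY _ _ _).1 (DeriveDef d2 erefl)).
- exact: cx.
- exact: cy.
Qed.

Lemma C1on_zero f fx fy V p : C1on setT f fx fy -> open V -> V p ->
  (forall q, V q -> f q = 0) -> fx p = 0 /\ fy p = 0.
Proof.
move=> Cf oV Vp f0; have [h1 h2 _ _] := Cf p I.
have [d d0 Hd] := (open_ballP V).1 oV p Vp.
have c0 (x v : R) : is_derive x v (fun=> 0 : R) 0 by exact: is_derive_cst.
split.
- have h3 := c0 p.1 1.
  rewrite -(@derive_val _ _ _ _ _ _ _ h1) -(@derive_val _ _ _ _ _ _ _ h3).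
  apply: near_eq_derive.
  apply/nbhs_ballP; exists d => //= s; rewrite /ball /= => sd.
  by apply: f0; apply: Hd; apply/prod_ltP => /=; rewrite subrr normr0 distrC.
- have h3 := c0 p.2 1.
  rewrite -(@derive_val _ _ _ _ _ _ _ h2) -(@derive_val _ _ _ _ _ _ _ h3).
  apply: near_eq_derive.
  apply/nbhs_ballP; exists d => //= s; rewrite /ball /= => sd.
  by apply: f0; apply: Hd; apply/prod_ltP => /=; rewrite subrr normr0 distrC.
Qed.

Lemma compact_support_bounded S f : compact S -> (forall p, {for p, continuous f}) ->
  (forall p, ~ S p -> f p = 0) -> exists M : R, forall p, `|f p| <= M.
Proof.
move=> cS cf f0.
have cfS : {within S, continuous f} by apply: continuous_subspaceT => p; exact: cf.
have /compact_bounded[M [_ HM]] := continuous_compact cfS cS.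
have {}HM := HM (M + 1) ltac:(lra).
exists (`|M + 1|) => p.
have [Sp|/f0 ->] := pselect (S p); last by rewrite normr0.
by rewrite (le_trans _ (ler_norm _))//; apply: HM; exists p.
Qed.

(** [f] is of class C^1 with partial derivatives [fx] and [fy]; the three
    functions are bounded and vanish off [S]. *)
Definition real_test S (f fx fy : R * R -> R) : Prop :=
  [/\ C1on setT f fx fy, (forall p, ~ S p -> [/\ f p = 0, fx p = 0 & fy p = 0]) &
      exists M : R, forall p, [/\ `|f p| <= M, `|fx p| <= M & `|fy p| <= M]].

Lemma real_test_Cn S f : compact S -> Cn 2 f -> (forall p, ~ S p -> f p = 0) ->
  real_test S f (dx f) (dy f).
Proof.
move=> cS Cf f0; have C := Cn2_C1on Cf.
have oS : open (~` S) by apply: closed_openC; exact: compact_closed plane_hausdorff cS.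
have z p : ~ S p -> [/\ f p = 0, dx f p = 0 & dy f p = 0].
  by move=> nS; have [? ?] := C1on_zero C oS nS f0; split => //; exact: f0.
split => //.
have [M0 H0] := @compact_support_bounded S f cS Cf.1 f0.
have [M1 H1] := @compact_support_bounded S (dx f) cS Cf.2.2.1.1 (fun p nS => let: And3 _ h _ := z p nS in h).
have [M2 H2] := @compact_support_bounded S (dy f) cS Cf.2.2.2.1 (fun p nS => let: And3 _ _ h := z p nS in h).
exists (`|M0| + `|M1| + `|M2|) => p.
split.
- by rewrite (le_trans (H0 p))// (le_trans (ler_norm _))// -addrA lerDl addr_ge0.
- by rewrite (le_trans (H1 p))// (le_trans (ler_norm _))// addrAC lerDr addr_ge0.
- by rewrite (le_trans (H2 p))// (le_trans (ler_norm _))// lerDr addr_ge0.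
Qed.

Lemma test_function_real D (phi : R * R -> R[i]) : test_function D phi ->
  exists2 S, compact S /\ S `<=` D &
    (real_test S (re_part phi) (dx (re_part phi)) (dy (re_part phi)) /\
     real_test S (im_part phi) (dx (im_part phi)) (dy (im_part phi))) /\
     forall p, ~ S p -> phi p = 0.
Proof.
move=> [C [cS SD]]; exists (closure [set p | phi p != 0]); first exact: (conj cS SD).
have z p : ~ closure [set p | phi p != 0] p -> phi p = 0.
  by move=> nS; apply/eqP; rewrite -[_ == _]negbK; apply/negP => h; apply: nS; exact: subset_closure.
split; last exact: z.
split.
  by apply: (real_test_Cn cS (C 2%N).1) => p /z; rewrite /re_part => ->.
by apply: (real_test_Cn cS (C 2%N).2) => p /z; rewrite /im_part => ->.
Qed.

End Regularity.

(** * Exchange of integrals for a kernel *)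

Section FubiniKernel.
Context {R : realType}.

Lemma measurable_Rintegral_param d (T : measurableType d)
    (mu : {sigma_finite_measure set T -> \bar R}) (g : T * T -> R) :
  measurable_fun setT g -> measurable_fun setT (fun p => \int[mu]_q g (q, p)).
Proof.
move=> mg; have mG : measurable_fun setT (EFin \o g) by exact/measurable_EFinP.
have E : (fun p => \int[mu]_q g (q, p)) =
    fine \o ((fun p => \int[mu]_q ((EFin \o g)^\+ (q, p)))%E \-
             (fun p => \int[mu]_q ((EFin \o g)^\- (q, p)))%E)%E.
  apply/funext => p; rewrite /Rintegral integralE /=; congr (fine (_ - _)%E).
    by under eq_integral do rewrite (funepos_comp (EFin \o g) (fun q => (q, p))) /=.
  by under eq_integral do rewrite (funeneg_comp (EFin \o g) (fun q => (q, p))) /=.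
rewrite E; apply: measurableT_comp; first exact: (@fine_measurable R setT measurableT).
apply: emeasurable_funB.
- apply: (@measurable_fun_fubini_tonelli_G _ _ _ _ _ mu (EFin \o g)^\+)%E => //.
  exact: measurable_funepos.
- apply: (@measurable_fun_fubini_tonelli_G _ _ _ _ _ mu (EFin \o g)^\-)%E => //.
  exact: measurable_funeneg.
Qed.

(** Exchange of integrals for [f q * k (q, p) * h p], which is integrable because
    the integral of [|k (q, p) h p|] in [p] is bounded. *)
Lemma fubini_kernel d (T : measurableType d)
    (mu : {sigma_finite_measure set T -> \bar R}) (f h : T -> R) (k : T * T -> R) (C : R) :
  mu.-integrable setT (EFin \o f) -> measurable_fun setT h -> measurable_fun setT k ->
  0 <= C ->
  (forall q, f q != 0 -> (\int[mu]_p (`|k (q, p) * h p|)%:E <= C%:E)%E) ->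
  [/\ {ae mu, forall p, h p != 0 -> mu.-integrable setT (EFin \o (fun q => f q * k (q, p)))},
      mu.-integrable setT (EFin \o (fun p => (\int[mu]_q (f q * k (q, p))) * h p)),
      mu.-integrable setT (EFin \o (fun q => f q * \int[mu]_p (k (q, p) * h p))) &
      \int[mu]_p ((\int[mu]_q (f q * k (q, p))) * h p) =
      \int[mu]_q (f q * \int[mu]_p (k (q, p) * h p))].
Proof.
move=> intf mh mk C0 HC.
have mf : measurable_fun setT f := (measurable_EFinP _ _).1 (measurable_int _ intf).
pose H (z : T * T) : R := f z.1 * (k z * h z.2).
have mkh : measurable_fun setT (fun z : T * T => k z * h z.2).
  by apply: measurable_funM => //; exact: measurableT_comp mh measurable_snd.
have mfk : measurable_fun setT (fun z : T * T => f z.1 * k z).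
  by apply: measurable_funM => //; exact: measurableT_comp mf measurable_fst.
have mH : measurable_fun setT (EFin \o H).
  apply/measurable_EFinP; apply: measurable_funM => //.
  exact: measurableT_comp mf measurable_fst.
have mfh z : measurable_fun setT (fun p => k (z, p) * h p).
  by apply: measurable_funM => //; exact: measurableT_comp mk (measurable_pair1 z).
have iH : (mu \x mu)%E.-integrable setT (EFin \o H).
  apply: (integrable12ltyP mu mu mH).2.
  apply: (@le_lt_trans _ _ (\int[mu]_q (C%:E * (`|f q|)%:E))%E).
    apply: ge0_le_integral => //.
    - by move=> q _; apply: integral_ge0.
    - apply: (measurable_fun_fubini_tonelli_F (abse \o (EFin \o H))) => [|q].
        exact: measurableT_comp.
      exact: abse_ge0.
    - by apply/measurable_EFinP; apply: measurable_funM => //; exact: measurableT_comp.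
    move=> q _; have [f0|fq] := eqVneq (f q) 0.
      rewrite f0 normr0 mule0 integral0_eq// => p _.
      by rewrite /= /H /= f0 mul0r normr0.
    have -> : (\int[mu]_p `|(EFin \o H) (q, p)| = (`|f q|)%:E * \int[mu]_p (`|k (q, p) * h p|)%:E)%E.
      rewrite -ge0_integralZl//; first by apply: eq_integral => p _; rewrite /= /H /= normrM.
      by apply/measurable_EFinP; exact: measurableT_comp.
    by rewrite muleC; apply: lee_wpmul2r => //; exact: HC.
  rewrite ge0_integralZl//; last by apply/measurable_EFinP; exact: measurableT_comp.
  by rewrite lte_mul_pinfty//; have /integrableP[] := intf.
have ae2 := ae_integrable2 iH.
have ae1 := ae_integrable1 iH.
have A : {ae mu, forall p, h p != 0 -> mu.-integrable setT (EFin \o (fun q => f q * k (q, p)))}.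
  move: ae2; apply: (filterS (F := almost_everywhere mu)) => p ip hp.
  have := integrableZl measurableT (h p)^-1 ip.
  apply: eq_integrable => // q _; rewrite /= /H /=; congr EFin.
  by rewrite mulrC -mulrA mulfK.
have mF := measurable_Rintegral_param mu mfk.
have mG : measurable_fun setT (fun q => \int[mu]_p (k (q, p) * h p)).
  apply: (@measurable_Rintegral_param _ _ mu (fun z => k (z.2, z.1) * h z.1)).
  apply: measurable_funM; last exact: measurableT_comp mh measurable_fst.
  apply: (measurableT_comp mk (g := fun z : T * T => (z.2, z.1))).
  by apply/measurable_fun_pairP; split; [exact: measurable_snd|exact: measurable_fst].
have FG p : (h p != 0 -> mu.-integrable setT (EFin \o (fun q => f q * k (q, p)))) ->
    (\int[mu]_q (f q * k (q, p))) * h p = \int[mu]_q H (q, p).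
  have [hp _|hp] := eqVneq (h p) 0.
    rewrite hp mulr0 /Rintegral integral0_eq// => q _.
    by rewrite /H /= hp !mulr0.
  move=> /(_ isT) ip; rewrite -RintegralZr//; apply: eq_Rintegral => q _.
  by rewrite /H /= mulrA.
have GG q : mu.-integrable setT (EFin \o (fun p => H (q, p))) ->
    f q * (\int[mu]_p (k (q, p) * h p)) = \int[mu]_p H (q, p).
  have [f0 _|fq ip] := eqVneq (f q) 0.
    rewrite f0 mul0r /Rintegral integral0_eq// => p _.
    by rewrite /H /= f0 mul0r.
  rewrite -RintegralZl//.
  have := integrableZl measurableT (f q)^-1 ip.
  apply: eq_integrable => // p _; rewrite /= /H /=; congr EFin.
  by rewrite mulKf.
have e1 : {ae mu, forall p, (\int[mu]_q (f q * k (q, p))) * h p = \int[mu]_q H (q, p)}.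
  by move: A; apply: (filterS (F := almost_everywhere mu)) => p; exact: FG.
have e2 : {ae mu, forall q, f q * (\int[mu]_p (k (q, p) * h p)) = \int[mu]_p H (q, p)}.
  by move: ae1; apply: (filterS (F := almost_everywhere mu)) => q; exact: GG.
have mL : measurable_fun setT (fun p => (\int[mu]_q (f q * k (q, p))) * h p).
  exact: measurable_funM.
have mR : measurable_fun setT (fun q => f q * (\int[mu]_p (k (q, p) * h p))).
  exact: measurable_funM.
pose H' (z : T * T) := H (z.2, z.1).
have mH' : measurable_fun setT (EFin \o H').
  apply/measurable_EFinP.
  apply: (measurableT_comp ((measurable_EFinP _ _).1 mH) (g := fun z : T * T => (z.2, z.1))).
  by apply/measurable_fun_pairP; split; [exact: measurable_snd|exact: measurable_fst].
have mH1 : measurable_fun setT (fun p => \int[mu]_q H (q, p)).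
  by apply: (measurable_Rintegral_param mu); exact/measurable_EFinP.
have mH2 : measurable_fun setT (fun q => \int[mu]_p H (q, p)).
  by apply: (measurable_Rintegral_param mu (g := H')); exact/measurable_EFinP.
have iH' : (mu \x mu)%E.-integrable setT (EFin \o H').
  apply: (integrable21ltyP mu mu mH').2; exact: ((integrable12ltyP mu mu mH).1 iH).
have [j1 k1] := integrable_fine measurableT (integrable_fubini_F iH').
have [j2 k2] := integrable_fine measurableT (integrable_fubini_F iH).
split => //.
- apply: (ae_integrableR measurableT mL j1).
  by move: e1; apply: (filterS (F := almost_everywhere mu)) => p ep _.
- apply: (ae_integrableR measurableT mR j2).
  by move: e2; apply: (filterS (F := almost_everywhere mu)) => p ep _.
have -> : \int[mu]_p ((\int[mu]_q (f q * k (q, p))) * h p) = \int[mu]_p \int[mu]_q H (q, p).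
  apply: ae_eq_Rintegral => //.
  by move: e1; apply: (filterS (F := almost_everywhere mu)) => p ep _.
have -> : \int[mu]_q (f q * \int[mu]_p (k (q, p) * h p)) = \int[mu]_q \int[mu]_p H (q, p).
  apply: ae_eq_Rintegral => //.
  by move: e2; apply: (filterS (F := almost_everywhere mu)) => p ep _.
apply: (etrans k1); apply/esym; apply: (etrans k2).
exact: (congr1 fine (Fubini iH)).
Qed.

End FubiniKernel.

(** * Finite order of vanishing and locally null sets *)

Section FiniteOrder.
Context {R : realType}.
Local Notation leb2 := (@lebesgue_measure R \x @lebesgue_measure R)%E.
Implicit Types (U W S D : set (R * R)) (p q : R * R) (f : R * R -> R).

(** The absolute Jacobian is [|rho|^s |g|], and [w] vanishes where [rho] does.
    By [defining_compare], [|rho|] dominates [|w|]; since [|rho| <= 1] near [p0],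
    the Jacobian dominates [|w|^n] for any integer [n >= s]. Two functions are
    needed because transversality to [Z] is known for [w], and the order of
    vanishing for [rho]. *)
Lemma kernel_bounded_order W p0 (s : R)
    (u ux uy v vx vy w wx wy rho rx ry g : R * R -> R) :
  open W -> W p0 -> C1on W u ux uy -> C1on W v vx vy ->
  C1on W w wx wy -> C1on W rho rx ry -> {for p0, continuous g} -> g p0 != 0 ->
  (forall p, W p -> 0 <= ux p * vy p - uy p * vx p) ->
  (forall p, W p -> `|ux p * vy p - uy p * vx p| = `|rho p| `^ s * `|g p|) ->
  (forall p, W p -> rho p = 0 -> w p = 0) -> rho p0 = 0 -> (rx p0, ry p0) != (0, 0) ->
  ux p0 * wy p0 - uy p0 * wx p0 != 0 \/ vx p0 * wy p0 - vy p0 * wx p0 != 0 ->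
  kernel_bounded u v W p0.
Proof.
move=> oW Wp Cu Cv Cw Crho cg g0 J0 JE rw r0 rn0 trans.
have [r [c [rpos c0 rW Hr]]] := defining_compare oW Wp Cw Crho rw r0 rn0.
have g2 : 0 < `|g p0| / 2 by rewrite divr_gt0// normr_gt0.
have /cvg_plane_epsP/(_ _ g2)[d1 d10 Hd1] := cg.
have /cvg_plane_epsP/(_ _ ltr01)[d2 d20 Hd2] : {for p0, continuous rho}.
  exact: C1on_continuous oW Crho Wp.
pose n := (Num.bound s).+1.
have sn : s <= n%:R.
  have := ler_norm s; have := archi_boundP (normr_ge0 s).
  have : (Num.bound `|s|)%:R = (Num.bound s)%:R :> R by rewrite /Num.bound normr_id.
  by move=> -> h1 h2; rewrite /n -natr1; lra.
pose e := Num.min r (Num.min d1 d2).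
have e0 : 0 < e by rewrite !lt_min rpos d10 d20.
pose V := [set p : R * R | `|p - p0| < e].
have oV : open V by exact: open_norm_ball.
have Vp : V p0 by rewrite /V /= subrr normr0.
have VW : V `<=` W by move=> p; rewrite /V /= lt_min => /andP[/rW].
apply: (kernel_bounded_sub VW).
pose k := `|g p0| / 2 * c ^+ n.
have k0 : 0 < k by rewrite mulr_gt0// exprn_gt0.
apply: (kernel_bounded_transverse oV Vp k0 (C1on_sub VW Cu) (C1on_sub VW Cv) (C1on_sub VW Cw) trans (n := n)).
move=> p Vp'; have Wp' := VW p Vp'.
move: Vp'; rewrite /V /= !lt_min => /and3P[pr /Hd1 pd1 /Hd2 pd2].
rewrite -[leRHS]ger0_norm ?J0// JE//.
have hg : `|g p0| / 2 <= `|g p|.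
  have := ler_distD (g p) (g p0) 0; rewrite !subr0 (distrC (g p0)); clear -pd1; lra.
have hr : `|rho p| <= 1 by move: pd2; rewrite r0 subr0 => /ltW.
have hn : `|rho p| ^+ n <= `|rho p| `^ s.
  have [->|rp] := eqVneq (rho p) 0; first by rewrite normr0 expr0n /= powR_ge0.
  rewrite -powR_mulrn//; apply: ger_powR => //.
  by rewrite normr_gt0 rp.
have hc := Hr p pr.
rewrite mulrC [leLHS](_ : _ = (c * `|w p|) ^+ n * (`|g p0| / 2)); last first.
  by rewrite exprMn /k; ring.
apply: ler_pM => //.
  by rewrite exprn_ge0// mulr_ge0// ltW.
apply: le_trans hn; rewrite lerXn2r ?nnegrE//.
by rewrite mulr_ge0// ltW.
Qed.

(** A set that is null near each of its points is null: rational squares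
    provide a countable cover. *)
Lemma locally_null (N : set (R * R)) :
  @measurable _ (measurableTypeR R * measurableTypeR R)%type N ->
  (forall p, N p -> exists2 r : R, 0 < r & forall A : set (R * R), measurable A ->
     (forall q, A q -> N q /\ `|q - p| < r) -> leb2 A = 0%E) ->
  leb2 N = 0%E.
Proof.
move=> mN loc.
pose sq (i : rat * rat * rat) : set (R * R) := closed_square (ratr i.1.1, ratr i.1.2) (ratr i.2).
have msq i : @measurable _ (measurableTypeR R * measurableTypeR R)%type (sq i).
  exact: measurable_closed_square.
pose F (n : nat) : set (R * R) := if @unpickle (rat * rat * rat)%type n is Some i then
  if `[< leb2 (N `&` sq i) = 0%E >] then N `&` sq i else set0 else set0.
have nF n : leb2.-negligible (F n).
  rewrite /F; case: unpickle => [i|]; last exact: negligible_set0.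
  case: asboolP => [h|_]; last exact: negligible_set0.
  by apply/negligibleP => //; exact: measurableI.
apply/negligibleP => //.
apply: negligibleS (negligible_bigcup nF) => p Np.
have [r r0 H] := loc p Np.
pose V := [set q : R * R | `|q - p| < r].
have oV : open V by exact: open_norm_ball.
have Vp : V p by rewrite /V /= subrr normr0.
have [a [b [c [pin sub]]]] := open_rat_square oV Vp.
have Z0 : leb2 (N `&` sq (a, b, c)) = 0%E.
  by apply: H; [exact: (@measurableI _ (measurableTypeR R * measurableTypeR R)%type _ _ mN (msq _))|move=> q [Nq /sub]].
have [n nE] : exists n : nat, @unpickle (rat * rat * rat)%type n = Some (a, b, c).
  by eexists; exact: pickleK.
have FE : F n = N `&` sq (a, b, c).
  rewrite /F nE; case: (asboolP (_ = _)) => [_|nz]; first reflexivity.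
  exact: (False_rect _ (nz Z0)).
by exists n; [exact: I|rewrite FE; split].
Qed.

End FiniteOrder.

(** * The characteristic set *)

Section CharacteristicSet.
Context {R : realType}.
Local Notation leb2 := (@lebesgue_measure R \x @lebesgue_measure R)%E.
Implicit Types (D U W : set (R * R)) (p q : R * R) (A B Z Zx Zy : R * R -> R[i]).

(** The Jacobian determinant of [Z]. *)
Definition jac Zx Zy p : R := re_part Zx p * im_part Zy p - re_part Zy p * im_part Zx p.

Lemma Im_normalized A B Zx Zy p : A p = - Zy p -> B p = Zx p ->
  complex.Im (A p * ((B p)^*)%C) = - jac Zx Zy p.
Proof.
rewrite /jac /re_part /im_part => -> ->.
by case: (Zx p) => a b; case: (Zy p) => c d /=; ring.
Qed.

(** One of [{Re Z, w}] and [{Im Z, w}] is nonzero if [L] is not tangent to the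
    level curve of [w]. *)
Lemma not_tangent A B Zx Zy (w : R * R -> R) p : A p = - Zy p -> B p = Zx p ->
  ~ complexification (tangent_line w p) (A p, B p) ->
  re_part Zx p * dy w p - re_part Zy p * dx w p != 0 \/
  im_part Zx p * dy w p - im_part Zy p * dx w p != 0.
Proof.
rewrite /complexification /tangent_line /re_part /im_part /= => -> -> nT.
have [h1|] := eqVneq (complex.Re (Zx p) * dy w p - complex.Re (Zy p) * dx w p) 0; last by left.
have [h2|] := eqVneq (complex.Im (Zx p) * dy w p - complex.Im (Zy p) * dx w p) 0; last by right.
case: nT; move: h1 h2; case: (Zx p) => a b; case: (Zy p) => c d /= h1 h2.
by split; [rewrite -h1|rewrite -h2]; ring.
Qed.

(** At a point of the characteristic set, the function [w] transverse to [L] and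
    the function [rho] measuring the order of vanishing, restricted to a
    neighbourhood on which both define the characteristic set. *)
Lemma char_set_local tO D A B Zx Zy p0 :
  open D -> D p0 ->
  (forall p, closure D p -> A p = - Zy p /\ B p = Zx p) ->
  nontangent_curve tO (closure D) (char_set D A B) A B ->
  finite_order_along tO (closure D) (char_set D A B) A B ->
  jac Zx Zy p0 = 0 ->
  exists W (w rho g : R * R -> R) (s : R),
    [/\ open W, W p0 & W `<=` D] /\
    [/\ C1on W w (dx w) (dy w), C1on W rho (dx rho) (dy rho),
        {for p0, continuous g} & g p0 != 0] /\
    [/\ forall p, W p -> `|jac Zx Zy p| = `|rho p| `^ s * `|g p|,
        forall p, W p -> rho p = 0 -> w p = 0, rho p0 = 0 &
        (dx rho p0, dy rho p0) != (0, 0)] /\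
    [/\ forall p, W p -> jac Zx Zy p = 0 -> w p = 0,
        (dx w p0, dy w p0) != (0, 0) &
        re_part Zx p0 * dy w p0 - re_part Zy p0 * dx w p0 != 0 \/
        im_part Zx p0 * dy w p0 - im_part Zy p0 * dx w p0 != 0].
Proof.
move=> oD Dp AB nt [sigma [fo _]] J0.
have DC := @subset_closure _ D.
have chE p : D p -> jac Zx Zy p = 0 <-> char_set D A B p.
  move=> Dp'; have [hA hB] := AB p (DC _ Dp'); rewrite /char_set /= (Im_normalized hA hB).
  split=> [->|[_ /eqP]]; first by rewrite oppr0; split => //; exact: DC.
  by rewrite oppr_eq0 => /eqP.
have Sp : char_set D A B p0 by apply/chE.
have [U1 [w [oU1 U1p _ [C1w zw dw] tw]]] := nt p0 Sp.
have [_ [U2 [rho [g [oU2 U2p _ [C1r zr dr] [cg [g0 gE]]]]]]] := fo p0 Sp.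
pose W := D `&` (U1 `&` U2).
have oW : open W by apply: openI => //; exact: openI.
have in1 p : W p -> char_set D A B p -> w p = 0.
  move=> [Dp' [u1 _]] Sp'; have : (char_set D A B `&` U1) p by split.
  by rewrite zw => -[_ []].
have in2 p : W p -> rho p = 0 -> char_set D A B p.
  move=> [Dp' [_ u2]] r0.
  have : (char_set D A B `&` U2) p by rewrite zr; split => //; exact: DC.
  by case.
have [hA hB] := AB p0 (DC _ Dp).
have C1W : C1on W w (dx w) (dy w).
  exact: C1on_sub (fun p (h : W p) => h.2.1) (C1_plus_C1on oU1 C1w).
have C1R : C1on W rho (dx rho) (dy rho).
  exact: C1on_sub (fun p (h : W p) => h.2.2) (C1_plus_C1on oU2 C1r).
have cg0 : {for p0, continuous g}.
  by move: cg; rewrite continuous_open_subspace// => /(_ p0); apply; exact: mem_set.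
have r0 : rho p0 = 0.
  have : (char_set D A B `&` U2) p0 by split.
  by rewrite zr => -[_ []].
have JE p : W p -> `|jac Zx Zy p| = `|rho p| `^ sigma p0 * `|g p|.
  move=> [Dp' [_ u2]]; have [hA' hB'] := AB p (DC _ Dp').
  by rewrite -normrN -(Im_normalized hA' hB') gE// normrM ger0_norm// powR_ge0.
have rw p : W p -> rho p = 0 -> w p = 0 by move=> Wp h; exact: in1 Wp (in2 _ Wp h).
have Jw p : W p -> jac Zx Zy p = 0 -> w p = 0.
  by move=> Wp h; apply: in1 (Wp) _; apply/chE => //; case: Wp.
exists W, w, rho, g, (sigma p0); split; first by split => // p [].
split; first by split => //; exact: g0.
split; first by split => //; exact: dr.
split => //; first exact: dw.
exact: not_tangent hA hB tw.
Qed.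

Lemma jac_continuous D (u ux uy v vx vy : R * R -> R) p : C1on D u ux uy -> C1on D v vx vy ->
  D p -> {for p, continuous (fun q => ux q * vy q - uy q * vx q)}.
Proof.
move=> Cu Cv Dp; have [_ _ cux cuy] := Cu _ Dp; have [_ _ cvx cvy] := Cv _ Dp.
by apply: continuousB; apply: continuousM.
Qed.

Section Geometry.
Context (tO D : set (R * R)) (A B Z Zx Zy : R * R -> R[i]).
Context (oD : open D) (AB : forall p, closure D p -> A p = - Zy p /\ B p = Zx p)
 (nt : nontangent_curve tO (closure D) (char_set D A B) A B)
 (fo : finite_order_along tO (closure D) (char_set D A B) A B)
 (Cu : C1on D (re_part Z) (re_part Zx) (re_part Zy))
 (Cv : C1on D (im_part Z) (im_part Zx) (im_part Zy))
 (J0 : forall p, D p -> 0 <= jac Zx Zy p).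

Lemma kernel_bounded_everywhere p0 : D p0 -> kernel_bounded (re_part Z) (im_part Z) D p0.
Proof.
move=> Dp; have [Je|Jn] := eqVneq (jac Zx Zy p0) 0; last first.
  apply: (kernel_bounded_elliptic oD Dp Cu Cv).
  by rewrite lt_neqAle eq_sym; apply/andP; split; [exact: Jn|exact: J0].
have [W [w [rho [g [s [[oW Wp WD] [[Cw Cr cg g0] [[JE rw r0 dr] [_ _ tr]]]]]]]]] :=
  char_set_local oD Dp AB nt fo Je.
apply: (kernel_bounded_sub WD).
exact: (kernel_bounded_order oW Wp (C1on_sub WD Cu) (C1on_sub WD Cv) Cw Cr cg g0
  (fun p Wp => J0 (WD _ Wp)) JE rw r0 dr tr).
Qed.

Lemma ae_jac_gt0 : {ae leb2, forall p, D p -> 0 < jac Zx Zy p}.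
Proof.
pose N := D `&` [set p | jac Zx Zy p = 0].
have mD : @measurable _ (measurableTypeR R * measurableTypeR R)%type D.
  exact: open_measurable_plane.
have mN : @measurable _ (measurableTypeR R * measurableTypeR R)%type N.
  have mJ : measurable_fun D (jac Zx Zy).
    by apply: open_continuous_measurable_plane => // p Dp; exact: jac_continuous Cu Cv Dp.
  exact: (mJ (open_measurable_plane oD) [set (0 : R)] (measurable_set1 0)).
have N0 : leb2 N = 0%E.
  apply: locally_null => // p [Dp Jp].
  have [W [w [rho [g [s [[oW Wp WD] [[Cw _ _ _] [_ [Jw dw _]]]]]]]]] :=
    char_set_local oD Dp AB nt fo Jp.
  have [r r_gt0 [rW H]] := null_zero_set oW Wp Cw dw.
  exists r => // C mC HC; apply: H => // q /HC[[Dq Jq] qr].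
  by split => //; apply: Jw => //; exact: rW.
exists N; split => // p /= /not_implyP[Dp /negP]; rewrite -leNgt => Jp.
by split => //=; apply/eqP; rewrite eq_le Jp J0.
Qed.

End Geometry.
End CharacteristicSet.

(** * The Cauchy kernel as an integral operator *)

Section CauchyKernel.
Context {R : realType}.
Local Notation leb2 := (@lebesgue_measure R \x @lebesgue_measure R)%E.
Local Notation plane := (measurableTypeR R * measurableTypeR R)%type.
Implicit Types (D U S : set (R * R)) (p q : R * R) (u v f h : R * R -> R).

Lemma integrable_patch D f : @measurable _ plane D -> leb2.-integrable D (EFin \o f) ->
  leb2.-integrable setT (EFin \o (f \_ D)).
Proof.
move=> mD i1; have i2 := (@integrable_mkcond _ _ _ leb2 D (EFin \o f) mD).1 i1.
suff E : (EFin \o f) \_ D = EFin \o (f \_ D) by rewrite E in i2.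
by apply/funext => p; rewrite /= !patchE; case: ifP.
Qed.

Lemma integrable_unpatch D f g : @measurable _ plane D ->
  leb2.-integrable setT (EFin \o f) -> (forall p, D p -> f p = g p) ->
  leb2.-integrable D (EFin \o g).
Proof.
move=> mD i1 fg; have i2 : leb2.-integrable D (EFin \o f).
  by apply: (@integrableS _ _ _ leb2 setT).
by apply: eq_integrable i2 => // p /set_mem Dp /=; rewrite fg.
Qed.

Lemma leb2_sigma_finite : @sigma_finite _ plane R setT leb2.
Proof.
exists (fun n => closed_square (0, 0) n%:R).
  apply/seteqP; split => // p _; exists (Num.bound `|p|) => //.
  rewrite closed_square_normE /= (_ : p - (0, 0) = p); last by rewrite subr0.
  by apply: ltW; apply: archi_boundP.
move=> n; split; first exact: measurable_closed_square.
exact: leb2_closed_square.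
Qed.

(** Lebesgue measure on the plane, as a sigma-finite measure. *)
Definition plane_measure : {sigma_finite_measure set plane -> \bar R} :=
  HB.pack_for {sigma_finite_measure set plane -> \bar R} leb2
    (@Measure_isSigmaFinite.Build _ _ _ leb2 leb2_sigma_finite).

(** [fubini_kernel] on [D], for a kernel dominated by [2 / |Z p - Z q|] and a
    bounded function [h] vanishing off a compact subset [S] of [D]. *)
Lemma fubini_cauchy D S u v f h (k : (R * R) * (R * R) -> R) (M : R) :
  open D -> compact S -> S `<=` D ->
  (forall p, D p -> {for p, continuous u}) -> (forall p, D p -> {for p, continuous v}) ->
  kernel_bounded_on u v D S ->
  @measurable_fun _ _ (plane * plane)%type (measurableTypeR R) (D `*` D) k ->
  (forall q p, D q -> D p -> `|k (q, p)| <= 2 * (dist1 u v p q)^-1) ->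
  leb2.-integrable D (EFin \o f) ->
  measurable_fun D h -> (forall p, D p -> `|h p| <= M) -> (forall p, ~ S p -> h p = 0) ->
  [/\ {ae leb2, forall p, D p -> h p != 0 -> leb2.-integrable D (EFin \o (fun q => f q * k (q, p)))},
      leb2.-integrable D (EFin \o (fun p => (\int[leb2]_(q in D) (f q * k (q, p))) * h p)),
      leb2.-integrable D (EFin \o (fun q => f q * \int[leb2]_(p in D) (k (q, p) * h p))),
      \int[leb2]_(p in D) ((\int[leb2]_(q in D) (f q * k (q, p))) * h p) =
      \int[leb2]_(q in D) (f q * \int[leb2]_(p in D) (k (q, p) * h p)) &
      forall q, D q -> leb2.-integrable D (EFin \o (fun p => k (q, p) * h p))].
Proof.
move=> oD cS SD cu cv [C C0 HC] mk kb intf mh hM h0.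
have mD : @measurable _ plane D by exact: open_measurable_plane.
have mS : @measurable _ plane S by exact: compact_measurable_plane.
have M0 : 0 <= `|M| by [].
have hM' p : D p -> `|h p| <= `|M| by move=> /hM/le_trans; apply; exact: ler_norm.
pose fD := f \_ D; pose hD := h \_ D; pose kD := k \_ (D `*` D).
have ifD : leb2.-integrable setT (EFin \o fD) by exact: integrable_patch.
have mhD : @measurable_fun _ _ plane (measurableTypeR R) setT hD.
  by apply/(measurable_restrictT _ mD).
have mkD : @measurable_fun _ _ (plane * plane)%type (measurableTypeR R) setT kD.
  by apply/(measurable_restrictT _ (measurableX mD mD)).
have fDE p : D p -> fD p = f p by move=> Dp; rewrite /fD patchT// mem_set.
have hDE p : D p -> hD p = h p by move=> Dp; rewrite /hD patchT// mem_set.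
have kDE q p : D q -> D p -> kD (q, p) = k (q, p).
  by move=> Dq Dp; rewrite /kD patchT// mem_set.
have fD0 p : ~ D p -> fD p = 0 by move=> nD; rewrite /fD patchC// mem_set.
have hD0 p : ~ D p -> hD p = 0 by move=> nD; rewrite /hD patchC// mem_set.
have bnd q p : D q -> (`|kD (q, p) * hD p| <= ((fun p => 2 * `|M| * (dist1 u v p q)^-1) \_ S) p).
  move=> Dq; rewrite patchE; case: ifPn => [/set_mem Sp|/negP nS].
    have Dp := SD _ Sp; rewrite kDE// hDE// normrM.
    have -> : 2 * `|M| * (dist1 u v p q)^-1 = 2 * (dist1 u v p q)^-1 * `|M| by ring.
    by apply: ler_pM => //; [exact: kb|exact: hM'].
  have hp0 : hD p = 0.
    have [Dp|/hD0//] := pselect (D p); rewrite hDE//; apply: h0 => Sp; apply: nS; exact: mem_set.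
  by rewrite hp0 mulr0 normr0.
have mkq q : D q -> measurable_fun S (fun p => (2 * `|M| * (dist1 u v p q)^-1)%:E).
  move=> Dq; have mk1 := measurable_kernel q oD cu cv.
  have mk2 := measurable_funS (open_measurable_plane oD) SD mk1.
  apply/measurable_EFinP; apply: measurable_funM; first exact: measurable_cst.
  exact/measurable_EFinP.
have Kint q : fD q != 0 ->
    (\int[leb2]_p (`|kD (q, p) * hD p|)%:E <= (2 * `|M| * C)%:E)%E.
  move=> fq; have Dq : D q by apply: contrapT => /fD0 f0; rewrite f0 eqxx in fq.
  have mabs : @measurable_fun _ _ plane _ setT (fun p => (`|kD (q, p) * hD p|)%:E).
    apply/measurable_EFinP; apply: measurableT_comp => //; apply: measurable_funM => //.
    exact: measurableT_comp mkD (measurable_pair1 q).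
  have mrhs : @measurable_fun _ _ plane _ setT
      (fun p => (((fun p => 2 * `|M| * (dist1 u v p q)^-1) \_ S) p)%:E).
    apply/measurable_EFinP; apply/(measurable_restrictT _ mS).
    exact: ((measurable_EFinP _ _).1 (mkq q Dq)).
  apply: (@le_trans _ _ (\int[leb2]_p (((fun p => 2 * `|M| * (dist1 u v p q)^-1) \_ S) p)%:E)%E).
    by apply: ge0_le_integral => // p _; rewrite lee_fin; exact: bnd.
  have -> : (\int[leb2]_p (((fun p => (2 * `|M| * (dist1 u v p q)^-1)%R) \_ S) p)%:E =
      \int[leb2]_(p in S) (2 * `|M| * (dist1 u v p q)^-1)%:E)%E.
    by rewrite [RHS]integral_mkcond; apply: eq_integral => p _; rewrite !patchE; case: ifP.
  have -> : (\int[leb2]_(p in S) (2 * `|M| * (dist1 u v p q)^-1)%:E =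
      (2 * `|M|)%:E * \int[leb2]_(p in S) (dist1 u v p q)^-1%:E)%E.
    have m1 := measurable_funS (open_measurable_plane oD) SD (measurable_kernel q oD cu cv).
    under eq_integral do rewrite EFinM.
    apply: (@ge0_integralZl _ plane R leb2 S mS _ m1) => [p _|].
      by rewrite lee_fin invr_ge0 dist1_ge0.
    by rewrite lee_fin mulr_ge0.
  by rewrite (EFinM _ C); apply: lee_wpmul2l; [rewrite lee_fin mulr_ge0|exact: HC].
have [H1 H2 H3 H4] := @fubini_kernel R _ plane plane_measure fD hD kD (2 * `|M| * C) ifD mhD mkD
  ltac:(by rewrite !mulr_ge0) Kint.
have innq p : D p -> \int[leb2]_q (fD q * kD (q, p)) = \int[leb2]_(q in D) (f q * k (q, p)).
  move=> Dp; rewrite [RHS]Rintegral_mkcond; apply: eq_Rintegral => q _.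
  rewrite patchE; case: ifPn => [/set_mem Dq|/negP nD]; first by rewrite fDE// kDE.
  by rewrite fD0 ?mul0r// => Dq; apply: nD; exact: mem_set.
have innp q : D q -> \int[leb2]_p (kD (q, p) * hD p) = \int[leb2]_(p in D) (k (q, p) * h p).
  move=> Dq; rewrite [RHS]Rintegral_mkcond; apply: eq_Rintegral => p _.
  rewrite patchE; case: ifPn => [/set_mem Dp|/negP nD]; first by rewrite hDE// kDE.
  by rewrite hD0 ?mulr0// => Dp; apply: nD; exact: mem_set.
split.
- move: H1; apply: (filterS (F := almost_everywhere leb2)) => p Hp Dp hp.
  apply: (integrable_unpatch mD (Hp _)); first by rewrite hDE.
  by move=> q Dq; rewrite fDE// kDE.
- by apply: (integrable_unpatch mD H2) => p Dp; rewrite innq// hDE.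
- by apply: (integrable_unpatch mD H3) => q Dq; rewrite innp// fDE.
- rewrite Rintegral_mkcond [RHS]Rintegral_mkcond.
  have E1 : (fun p => \int[leb2]_(q in D) (f q * k (q, p)) * h p) \_ D =
      (fun p => \int[leb2]_q (fD q * kD (q, p)) * hD p).
    apply/funext => p; rewrite patchE; case: ifPn => [/set_mem Dp|/negP nD].
      by rewrite innq// hDE.
    by rewrite hD0 ?mulr0// => Dp; apply: nD; exact: mem_set.
  have E2 : (fun q => f q * \int[leb2]_(p in D) (k (q, p) * h p)) \_ D =
      (fun q => fD q * \int[leb2]_p (kD (q, p) * hD p)).
    apply/funext => q; rewrite patchE; case: ifPn => [/set_mem Dq|/negP nD].
      by rewrite innp// fDE.
    by rewrite fD0 ?mul0r// => Dq; apply: nD; exact: mem_set.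
  by rewrite E1 E2; exact: H4.
move=> q Dq; have iS : leb2.-integrable S (EFin \o (fun p => 2 * `|M| * (dist1 u v p q)^-1)).
  have iK : leb2.-integrable S (EFin \o (fun p => (dist1 u v p q)^-1)).
    apply/integrableP; split.
      exact: measurable_funS (open_measurable_plane oD) SD (measurable_kernel q oD cu cv).
    apply: le_lt_trans (ltry C).
    under eq_integral do rewrite /= ger0_norm ?invr_ge0 ?dist1_ge0//.
    exact: HC.
  exact: (integrableZl mS (2 * `|M|) iK).
have iT := integrable_patch mS iS.
have iT' : leb2.-integrable setT (EFin \o (fun p => kD (q, p) * hD p)).
  apply: (le_integrableR _ _ _ iT) => //; last by move=> p _; exact: bnd.
  apply: measurable_funM => //.
  exact: measurableT_comp mkD (measurable_pair1 q).
by apply: (integrable_unpatch mD iT') => p Dp; rewrite kDE// hDE.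
Qed.

End CauchyKernel.

(** * Weak identities in real form *)

Section WeakIdentity.
Context {R : realType}.
Local Notation leb2 := (@lebesgue_measure R \x @lebesgue_measure R)%E.
Local Notation plane := (measurableTypeR R * measurableTypeR R)%type.
Implicit Types (D U S : set (R * R)) (p q : R * R) (u v f h : R * R -> R).

(** Real and imaginary parts of [1 / (Z q - Z p)] as functions of the pair
    [z = (q, p)], for [Z = u + i v]. *)
Definition ck1 u v (z : (R * R) * (R * R)) : R :=
  (u z.1 - u z.2) / ((u z.1 - u z.2) ^+ 2 + (v z.1 - v z.2) ^+ 2).
Definition ck2 u v (z : (R * R) * (R * R)) : R :=
  - (v z.1 - v z.2) / ((u z.1 - u z.2) ^+ 2 + (v z.1 - v z.2) ^+ 2).

Lemma ck_bound u v q p :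
  `|ck1 u v (q, p)| <= 2 * (dist1 u v p q)^-1 /\ `|ck2 u v (q, p)| <= 2 * (dist1 u v p q)^-1.
Proof.
rewrite /ck1 /ck2 /dist1 /= (distrC (u p)) (distrC (v p)).
set a := u q - u p; set b := v q - v p; clearbody a b.
have r0 : 0 <= a ^+ 2 + b ^+ 2 by rewrite addr_ge0 ?sqr_ge0.
rewrite !normrM normrN normfV (ger0_norm r0).
have [re|rn] := eqVneq (a ^+ 2 + b ^+ 2) 0.
  by rewrite re invr0 !mulr0; split; rewrite mulr_ge0// invr_ge0 addr_ge0.
have rp : 0 < a ^+ 2 + b ^+ 2 by rewrite lt_neqAle eq_sym rn.
have H := dist1_sq2 rp.
have i0 : 0 <= (a ^+ 2 + b ^+ 2)^-1 by rewrite invr_ge0.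
by split; apply: le_trans H; rewrite mulrC ler_wpM2l// ?lerDl ?lerDr.
Qed.

Lemma measurable_ck D u v : open D ->
  (forall p, D p -> {for p, continuous u}) -> (forall p, D p -> {for p, continuous v}) ->
  @measurable_fun _ _ (plane * plane)%type (measurableTypeR R) (D `*` D) (ck1 u v) /\
  @measurable_fun _ _ (plane * plane)%type (measurableTypeR R) (D `*` D) (ck2 u v).
Proof.
move=> oD cu cv.
have mD : @measurable _ plane D by exact: open_measurable_plane.
have mDD : @measurable _ (plane * plane)%type (D `*` D) by exact: measurableX.
have m1 (w : R * R -> R) : (forall p, D p -> {for p, continuous w}) ->
    @measurable_fun _ _ (plane * plane)%type (measurableTypeR R) (D `*` D) (fun z => w z.1 - w z.2).
  move=> cw; have mw : @measurable_fun _ _ plane (measurableTypeR R) D w.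
    exact: open_continuous_measurable_plane.
  apply: measurable_funB.
  - apply: (measurable_comp mD _ mw); last by apply: measurable_funTS; exact: measurable_fst.
    by move=> _ [z [+ _] <-].
  - apply: (measurable_comp mD _ mw); last by apply: measurable_funTS; exact: measurable_snd.
    by move=> _ [z [_ +] <-].
have mu_ := m1 u cu; have mv_ := m1 v cv.
have mr : @measurable_fun _ _ (plane * plane)%type (measurableTypeR R) (D `*` D)
    (fun z => ((u z.1 - u z.2) ^+ 2 + (v z.1 - v z.2) ^+ 2)^-1).
  by apply: measurable_funV; apply: measurable_funD; apply: measurable_funX.
split; first exact: measurable_funM.
by apply: measurable_funM => //; exact: measurableT_comp.
Qed.

(** Real and imaginary parts of [L phi = {Z, phi}], for [Z = u + i v] and
    [phi = phi1 + i phi2]. *)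
Definition lphi1 (ux uy vx vy p1x p1y p2x p2y : R * R -> R) p : R :=
  (ux p * p1y p - uy p * p1x p) - (vx p * p2y p - vy p * p2x p).
Definition lphi2 (ux uy vx vy p1x p1y p2x p2y : R * R -> R) p : R :=
  (vx p * p1y p - vy p * p1x p) + (ux p * p2y p - uy p * p2x p).

Lemma integrable_real_test D S f t tx ty : open D -> leb2.-integrable D (EFin \o f) ->
  real_test S t tx ty -> leb2.-integrable D (EFin \o (fun q => f q * t q)).
Proof.
move=> oD intf [Ct _ [K HK]].
have mD : @measurable _ plane D by exact: open_measurable_plane.
have [mt _ _] := C1on_measurable oD (C1on_sub (fun p (_ : D p) => I) Ct).
have mf : measurable_fun D f := (measurable_EFinP _ _).1 (measurable_int _ intf).
have iK := integrableZl mD K (integrable_abse intf).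
apply: (le_integrableR mD _ _ iK); first exact: measurable_funM.
by move=> q _; have [h _ _] := HK q; rewrite /= normrM mulrC ler_wpM2r.
Qed.

Section Identity.
Context (D S : set (R * R)) (M : R) (u ux uy v vx vy f1 f1x f1y f2 f2x f2y : R * R -> R).
Context (oD : open D) (Dfin : (leb2 D < +oo)%E) (cS : compact S) (SD : S `<=` D)
 (Cu : C1on D u ux uy) (Cv : C1on D v vx vy)
 (uM : forall p, D p -> [/\ `|u p| <= M, `|ux p| <= M & `|uy p| <= M])
 (vM : forall p, D p -> [/\ `|v p| <= M, `|vx p| <= M & `|vy p| <= M])
 (T1 : real_test S f1 f1x f1y) (T2 : real_test S f2 f2x f2y)
 (low : forall q, D q -> 0 < ux q * vy q - uy q * vx q -> exists2 c : R, 0 < c & forall p, D p ->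
    c * ((p.1 - q.1) ^+ 2 + (p.2 - q.2) ^+ 2) <= (u p - u q) ^+ 2 + (v p - v q) ^+ 2)
 (kb : kernel_bounded_on u v D S)
 (aeJ : {ae leb2, forall q, D q -> 0 < ux q * vy q - uy q * vx q}).

Local Notation h1 := (lphi1 ux uy vx vy f1x f1y f2x f2y).
Local Notation h2 := (lphi2 ux uy vx vy f1x f1y f2x f2y).
Local Notation k1 := (ck1 u v).
Local Notation k2 := (ck2 u v).

Lemma kernel_identity_real phi px py q : real_test S phi px py -> D q ->
  0 < ux q * vy q - uy q * vx q ->
  let a p := u p - u q in let b p := v p - v q in
  [/\ leb2.-integrable D (EFin \o (fun p => (sq2 a b p)^-1 *
       (a p * (ux p * py p - uy p * px p) + b p * (vx p * py p - vy p * px p)))),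
      leb2.-integrable D (EFin \o (fun p => (sq2 a b p)^-1 *
       (a p * (vx p * py p - vy p * px p) - b p * (ux p * py p - uy p * px p)))),
      \int[leb2]_(p in D) ((sq2 a b p)^-1 *
       (a p * (ux p * py p - uy p * px p) + b p * (vx p * py p - vy p * px p))) = 0 &
      \int[leb2]_(p in D) ((sq2 a b p)^-1 *
       (a p * (vx p * py p - vy p * px p) - b p * (ux p * py p - uy p * px p))) =
      2 * pi * phi q].
Proof.
move=> [Cphi phi0 [N phiN]] Dq J0; have [c c0 H] := low Dq J0.
have lM : M <= Num.max M N by rewrite le_max lexx.
have lN : N <= Num.max M N by rewrite le_max lexx orbT.
have b3 (x y z m : R) : m <= Num.max M N -> [/\ `|x| <= m, `|y| <= m & `|z| <= m] ->
    [/\ `|x| <= Num.max M N, `|y| <= Num.max M N & `|z| <= Num.max M N].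
  by move=> lm [h h' h'']; split; apply: le_trans lm.
exact: (kernel_identity (M := Num.max M N) oD Dfin cS SD Dq Cu Cv Cphi
  (fun p Dp => b3 _ _ _ _ lM (uM Dp)) (fun p Dp => b3 _ _ _ _ lM (vM Dp))
  (fun p => b3 _ _ _ _ lN (phiN p)) phi0 c0 H J0 kb).
Qed.

(** The integral in [p] of [L phi p / (Z q - Z p)] is [- 2 i pi phi q]. *)
Lemma cauchy_test q : D q -> 0 < ux q * vy q - uy q * vx q ->
  \int[leb2]_(p in D) (k1 (q, p) * h1 p - k2 (q, p) * h2 p) = 2 * pi * f2 q /\
  \int[leb2]_(p in D) (k2 (q, p) * h1 p + k1 (q, p) * h2 p) = - (2 * pi * f1 q).
Proof.
move=> Dq J0; have [i11 i12 e11 e12] := kernel_identity_real T1 Dq J0.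
have [i21 i22 e21 e22] := kernel_identity_real T2 Dq J0.
have mD : @measurable _ plane D by exact: open_measurable_plane.
have sqE p : (u q - u p) ^+ 2 + (v q - v p) ^+ 2 =
    sq2 (fun p => u p - u q) (fun p => v p - v q) p.
  by rewrite /sq2 -(sqrrN (u q - u p)) -(sqrrN (v q - v p)) !opprB.
split.
  rewrite -e22 -[RHS]subr0 -[X in _ = _ - X]e11 -RintegralB//.
  apply: eq_Rintegral => p _; rewrite /ck1 /ck2 /= sqE /lphi1 /lphi2.
  set r := (sq2 _ _ _)^-1; ring.
have -> : - (2 * pi * f1 q) = (-1) * (2 * pi * f1 q + 0) by ring.
rewrite -e12 -[X in _ + X]e21 -RintegralD// -RintegralZl//; last first.
  by have := integrableD mD i12 i21.
apply: eq_Rintegral => p _; rewrite /ck1 /ck2 /= sqE /lphi1 /lphi2.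
set r := (sq2 _ _ _)^-1; ring.
Qed.

Lemma lphi_support p : ~ S p -> h1 p = 0 /\ h2 p = 0.
Proof.
have [_ z1 _] := T1; have [_ z2 _] := T2.
move=> nS; have [_ a1 a2] := z1 p nS; have [_ b1 b2] := z2 p nS.
by rewrite /lphi1 /lphi2 a1 a2 b1 b2 !mulr0 !subr0 addr0.
Qed.

Lemma measurable_lphi : measurable_fun D h1 /\ measurable_fun D h2.
Proof.
have [C1 _ _] := T1; have [C2 _ _] := T2.
have [_ mux muy] := C1on_measurable oD Cu.
have [_ mvx mvy] := C1on_measurable oD Cv.
have [_ m1x m1y] := C1on_measurable oD (C1on_sub (fun p (_ : D p) => I) C1).
have [_ m2x m2y] := C1on_measurable oD (C1on_sub (fun p (_ : D p) => I) C2).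
split.
  by apply: measurable_funB; apply: measurable_funB; apply: measurable_funM.
by apply: measurable_funD; apply: measurable_funB; apply: measurable_funM.
Qed.

Lemma lphi_bounded : exists N : R, forall p, D p -> `|h1 p| <= N /\ `|h2 p| <= N.
Proof.
have [_ _ [N1 H1]] := T1; have [_ _ [N2 H2]] := T2.
exists (M * N1 + M * N1 + (M * N2 + M * N2)) => p Dp.
have [_ x1 x2] := uM Dp; have [_ y1 y2] := vM Dp.
have [_ a1 a2] := H1 p; have [_ b1 b2] := H2 p.
have brk (x y z w m : R) : `|x| <= M -> `|y| <= m -> `|z| <= M -> `|w| <= m ->
    `|x * y - z * w| <= M * m + M * m.
  by move=> ? ? ? ?; rewrite (le_trans (ler_normB _ _))// !normrM lerD// ler_pM.
split; first by rewrite (le_trans (ler_normB _ _))// lerD// brk.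
by rewrite (le_trans (ler_normD _ _))// lerD// brk.
Qed.

(** For real [f], with transform [F1 + i F2], the integral of [(F1 + i F2) L phi]
    is [- 2 i pi] times that of [f phi]. *)
Lemma weak_real f : leb2.-integrable D (EFin \o f) ->
  let F1 p := \int[leb2]_(q in D) (f q * k1 (q, p)) in
  let F2 p := \int[leb2]_(q in D) (f q * k2 (q, p)) in
  [/\ leb2.-integrable D (EFin \o (fun p => F1 p * h1 p)),
      leb2.-integrable D (EFin \o (fun p => F1 p * h2 p)),
      leb2.-integrable D (EFin \o (fun p => F2 p * h1 p)) &
      leb2.-integrable D (EFin \o (fun p => F2 p * h2 p))] /\
  \int[leb2]_(p in D) (F2 p * h1 p + F1 p * h2 p) =
    - (2 * pi * \int[leb2]_(q in D) (f q * f1 q)) /\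
  \int[leb2]_(p in D) (F1 p * h1 p - F2 p * h2 p) =
    2 * pi * \int[leb2]_(q in D) (f q * f2 q).
Proof.
move=> intf F1 F2.
have mD : @measurable _ plane D by exact: open_measurable_plane.
have mf : measurable_fun D f := (measurable_EFinP _ _).1 (measurable_int _ intf).
have cu p : D p -> {for p, continuous u} by exact: C1on_continuous oD Cu.
have cv p : D p -> {for p, continuous v} by exact: C1on_continuous oD Cv.
have [mk1 mk2] := measurable_ck oD cu cv.
have [mh1 mh2] := measurable_lphi.
have [N HN] := lphi_bounded.
have [_ a1 a2 a3 a4] := fubini_cauchy oD cS SD cu cv kb mk1 (fun q p _ _ => (ck_bound u v q p).1)
  intf mh1 (fun p Dp => (HN p Dp).1) (fun p nS => (lphi_support nS).1).
have [_ b1 b2 b3 b4] := fubini_cauchy oD cS SD cu cv kb mk1 (fun q p _ _ => (ck_bound u v q p).1)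
  intf mh2 (fun p Dp => (HN p Dp).2) (fun p nS => (lphi_support nS).2).
have [_ c1 c2 c3 c4] := fubini_cauchy oD cS SD cu cv kb mk2 (fun q p _ _ => (ck_bound u v q p).2)
  intf mh1 (fun p Dp => (HN p Dp).1) (fun p nS => (lphi_support nS).1).
have [_ d1 d2 d3 d4] := fubini_cauchy oD cS SD cu cv kb mk2 (fun q p _ _ => (ck_bound u v q p).2)
  intf mh2 (fun p Dp => (HN p Dp).2) (fun p nS => (lphi_support nS).2).
have if1 := integrable_real_test oD intf T1.
have if2 := integrable_real_test oD intf T2.
split; first by split.
split.
  rewrite RintegralD// /F1 /F2 c3 b3 -RintegralD// -RintegralZl// -[RHS]mulN1r -RintegralZl//; last first.
    exact: (integrableZl mD (2 * pi) if1).
  apply: ae_eq_Rintegral => //.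
  - exact: (measurable_EFinP _ _).1 (measurable_int _ (integrableD mD c2 b2)).
  - by apply: measurable_funM => //; apply: measurable_funM => //;
      exact: (measurable_EFinP _ _).1 (measurable_int _ if1).
  move: aeJ; apply: (filterS (F := almost_everywhere leb2)) => q Jq Dq.
  have [_] := cauchy_test Dq (Jq Dq); rewrite RintegralD//; [|exact: c4|exact: b4].
  by rewrite -mulrDr => ->; ring.
rewrite RintegralB// /F1 /F2 a3 d3 -RintegralB// -RintegralZl//.
apply: ae_eq_Rintegral => //.
- exact: (measurable_EFinP _ _).1 (measurable_int _ (integrableB mD a2 d2)).
- by apply: measurable_funM => //; exact: (measurable_EFinP _ _).1 (measurable_int _ if2).
move: aeJ; apply: (filterS (F := almost_everywhere leb2)) => q Jq Dq.
have [+ _] := cauchy_test Dq (Jq Dq); rewrite RintegralB//; [|exact: a4|exact: d4].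
by rewrite -mulrBr => ->; ring.
Qed.

End Identity.
End WeakIdentity.

(** * The Cauchy transform *)

Section CauchyTransform.
Context {R : realType}.
Local Notation leb2 := (@lebesgue_measure R \x @lebesgue_measure R)%E.
Local Notation plane := (measurableTypeR R * measurableTypeR R)%type.
Implicit Types (S K : set (R * R)) (p q : R * R) (f h : R * R -> R).

Lemma measurable_integral_param (D : set (R * R)) (g : (R * R) * (R * R) -> R) :
  @measurable _ plane D ->
  @measurable_fun _ _ (plane * plane)%type (measurableTypeR R) (D `*` D) g ->
  @measurable_fun _ _ plane (measurableTypeR R) D (fun p => \int[leb2]_(q in D) g (q, p)).
Proof.
move=> mD mg; pose gD := g \_ (D `*` D).
have mgD : @measurable_fun _ _ (plane * plane)%type (measurableTypeR R) setT gD.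
  by apply/(measurable_restrictT _ (measurableX mD mD)).
have mT := @measurable_Rintegral_param R _ plane plane_measure gD mgD.
apply: (eq_measurable_fun (fun p => \int[leb2]_q gD (q, p))); last exact: measurable_funTS.
move=> p /set_mem Dp; rewrite [RHS]Rintegral_mkcond; apply: eq_Rintegral => q _.
rewrite /gD !patchE; case: ifPn => [/set_mem[Dq _]|/negP nD]; first by rewrite mem_set.
by rewrite memNset// => Dq; apply: nD; apply: mem_set.
Qed.

Context (D : set (R * R)) (u v : R * R -> R).
Context (oD : open D)
 (cu : forall p, D p -> {for p, continuous u}) (cv : forall p, D p -> {for p, continuous v})
 (kb : forall S, compact S -> S `<=` D -> kernel_bounded_on u v D S).
Local Notation k1 := (ck1 u v).
Local Notation k2 := (ck2 u v).

(** [fubini_cauchy] for the indicator function of [K]. *)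
Lemma indic_fubini K f : compact K -> K `<=` D -> leb2.-integrable D (EFin \o f) ->
  {ae leb2, forall p, K p -> leb2.-integrable D (EFin \o (fun q => f q * k1 (q, p))) /\
     leb2.-integrable D (EFin \o (fun q => f q * k2 (q, p)))} /\
  leb2.-integrable K (EFin \o (fun p => \int[leb2]_(q in D) (f q * k1 (q, p)))) /\
  leb2.-integrable K (EFin \o (fun p => \int[leb2]_(q in D) (f q * k2 (q, p)))).
Proof.
move=> cK KD intf; have [mk1 mk2] := measurable_ck oD cu cv.
have mK : measurable K by exact: compact_measurable_plane.
have mK' : @measurable _ plane K by exact: compact_measurable_plane.
have mD : @measurable _ plane D by exact: open_measurable_plane.
have m1 : measurable_fun D (\1_K : R * R -> R) by apply: measurable_funTS; exact: measurable_indic.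
have b1 p : D p -> `|\1_K p : R| <= 1.
  by move=> _; rewrite indicE; case: (_ \in _); rewrite ?normr1// normr0.
have z1 p : ~ K p -> (\1_K p : R) = 0 by move=> nK; rewrite indicE memNset.
have e1 p : K p -> (\1_K p : R) = 1 by move=> Kp; rewrite indicE mem_set.
have [a1 a2 _ _ _] := fubini_cauchy oD cK KD cu cv (kb cK KD) mk1
  (fun q p _ _ => (ck_bound u v q p).1) intf m1 b1 z1.
have [c1 c2 _ _ _] := fubini_cauchy oD cK KD cu cv (kb cK KD) mk2
  (fun q p _ _ => (ck_bound u v q p).2) intf m1 b1 z1.
split.
  move: a1 c1; apply: (filterS2 (F := almost_everywhere leb2)) => p h1 h2 Kp.
  by split; [apply: h1|apply: h2]; rewrite ?e1 ?oner_neq0//; exact: KD.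
have sub g : leb2.-integrable D (EFin \o (fun p => g p * \1_K p)) ->
    leb2.-integrable K (EFin \o g).
  move=> i1; have i2 : leb2.-integrable K (EFin \o (fun p => g p * \1_K p)).
    exact: (@integrableS _ _ _ leb2 D).
  by apply: eq_integrable i2 => // p /set_mem Kp /=; rewrite e1// mulr1.
by split; apply: sub.
Qed.

Lemma ae_integrable_ck f : leb2.-integrable D (EFin \o f) ->
  {ae leb2, forall p, D p -> leb2.-integrable D (EFin \o (fun q => f q * k1 (q, p))) /\
     leb2.-integrable D (EFin \o (fun q => f q * k2 (q, p)))}.
Proof.
move=> intf; have [c [r DE]] := open_bigcup_square oD.
have SD n : closed_square (c n) (r n) `<=` D by rewrite DE => p Sp; exists n.
have H n := (indic_fubini (@compact_closed_square _ (c n) (r n)) (SD n) intf).1.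
move: (ae_foralln H); apply: (filterS (F := almost_everywhere leb2)) => p Hp.
by rewrite {1}DE => -[n _ /(Hp n)].
Qed.

Section Pair.
Context (fr fi : R * R -> R) (ir : leb2.-integrable D (EFin \o fr))
  (ii : leb2.-integrable D (EFin \o fi)).
Let I1 p := \int[leb2]_(q in D) (fr q * k1 (q, p) - fi q * k2 (q, p)).
Let I2 p := \int[leb2]_(q in D) (fr q * k2 (q, p) + fi q * k1 (q, p)).
Let F1 f p := \int[leb2]_(q in D) (f q * k1 (q, p)).
Let F2 f p := \int[leb2]_(q in D) (f q * k2 (q, p)).

Lemma cauchy_integrable_ae : {ae leb2, forall p, D p ->
  [/\ leb2.-integrable D (EFin \o (fun q => fr q * k1 (q, p) - fi q * k2 (q, p))),
      leb2.-integrable D (EFin \o (fun q => fr q * k2 (q, p) + fi q * k1 (q, p))),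
      I1 p = F1 fr p - F2 fi p & I2 p = F2 fr p + F1 fi p]}.
Proof.
have mD : @measurable _ plane D by exact: open_measurable_plane.
move: (ae_integrable_ck ir) (ae_integrable_ck ii).
apply: (filterS2 (F := almost_everywhere leb2)) => p h1 h2 Dp.
have [r1 r2] := h1 Dp; have [i1 i2] := h2 Dp; split.
- exact: (integrableB mD r1 i2).
- exact: (integrableD mD r2 i1).
- exact: RintegralB.
- exact: RintegralD.
Qed.

Lemma measurable_cauchy_parts : @measurable_fun _ _ plane (measurableTypeR R) D I1 /\
  @measurable_fun _ _ plane (measurableTypeR R) D I2.
Proof.
have mD : @measurable _ plane D by exact: open_measurable_plane.
have [mk1 mk2] := measurable_ck oD cu cv.
have mf f : leb2.-integrable D (EFin \o f) ->
    @measurable_fun _ _ (plane * plane)%type (measurableTypeR R) (D `*` D) (fun z => f z.1).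
  move=> i; have mf : @measurable_fun _ _ plane (measurableTypeR R) D f.
    exact: (measurable_EFinP _ _).1 (measurable_int _ i).
  apply: (measurable_comp mD _ mf); last by apply: measurable_funTS; exact: measurable_fst.
  by move=> _ [z [+ _] <-].
split.
  apply: (measurable_integral_param (g := fun z => fr z.1 * k1 z - fi z.1 * k2 z)) => //.
  by apply: measurable_funB; apply: measurable_funM => //; exact: mf.
apply: (measurable_integral_param (g := fun z => fr z.1 * k2 z + fi z.1 * k1 z)) => //.
by apply: measurable_funD; apply: measurable_funM => //; exact: mf.
Qed.

Lemma cauchy_parts_integrable K : compact K -> K `<=` D ->
  leb2.-integrable K (EFin \o I1) /\ leb2.-integrable K (EFin \o I2).
Proof.
move=> cK KD; have mK : @measurable _ plane K by exact: compact_measurable_plane.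
have [_ [r1 r2]] := indic_fubini cK KD ir; have [_ [i1 i2]] := indic_fubini cK KD ii.
have [m1 m2] := measurable_cauchy_parts.
have mD : @measurable _ plane D by exact: open_measurable_plane.
split.
  apply: (ae_integrableR mK _ (integrableB mK r1 i2)); first exact: measurable_funS mD KD m1.
  move: cauchy_integrable_ae; apply: (filterS (F := almost_everywhere leb2)) => p h Kp.
  by have [_ _ ? _] := h (KD _ Kp).
apply: (ae_integrableR mK _ (integrableD mK r2 i1)); first exact: measurable_funS mD KD m2.
move: cauchy_integrable_ae; apply: (filterS (F := almost_everywhere leb2)) => p h Kp.
by have [_ _ _ ?] := h (KD _ Kp).
Qed.

(** The transform of [fr + i fi] is [I1 + i I2]; the two equations are the
    imaginary part, and the opposite of the real part, of the statement that the
    integral of [(I1 + i I2) L phi] is [- 2 i pi] times that of [f phi]. *)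
Lemma weak_pair S M ux uy vx vy f1 f1x f1y f2 f2x f2y :
  (leb2 D < +oo)%E -> compact S -> S `<=` D ->
  C1on D u ux uy -> C1on D v vx vy ->
  (forall p, D p -> [/\ `|u p| <= M, `|ux p| <= M & `|uy p| <= M]) ->
  (forall p, D p -> [/\ `|v p| <= M, `|vx p| <= M & `|vy p| <= M]) ->
  real_test S f1 f1x f1y -> real_test S f2 f2x f2y ->
  (forall q, D q -> 0 < ux q * vy q - uy q * vx q -> exists2 c : R, 0 < c & forall p, D p ->
    c * ((p.1 - q.1) ^+ 2 + (p.2 - q.2) ^+ 2) <= (u p - u q) ^+ 2 + (v p - v q) ^+ 2) ->
  {ae leb2, forall q, D q -> 0 < ux q * vy q - uy q * vx q} ->
  let h1 := lphi1 ux uy vx vy f1x f1y f2x f2y in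
  let h2 := lphi2 ux uy vx vy f1x f1y f2x f2y in
  [/\ leb2.-integrable D (EFin \o (fun p => I2 p * h1 p + I1 p * h2 p)),
      leb2.-integrable D (EFin \o (fun p => I2 p * h2 p - I1 p * h1 p)),
  \int[leb2]_(p in D) (I2 p * h1 p + I1 p * h2 p) =
    - (2 * pi * \int[leb2]_(q in D) (fr q * f1 q - fi q * f2 q)) &
  \int[leb2]_(p in D) (I2 p * h2 p - I1 p * h1 p) =
    - (2 * pi * \int[leb2]_(q in D) (fr q * f2 q + fi q * f1 q))].
Proof.
move=> Dfin cS SD Cu Cv uM vM T1 T2 low aeJ h1 h2.
have mD : @measurable _ plane D by exact: open_measurable_plane.
have [mh1 mh2] := measurable_lphi oD Cu Cv T1 T2.
have [[r1 r2 r3 r4] [ra rb]] :=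
  weak_real oD Dfin cS SD Cu Cv uM vM T1 T2 low (kb cS SD) aeJ ir.
have [[i1 i2 i3 i4] [ia ib]] :=
  weak_real oD Dfin cS SD Cu Cv uM vM T1 T2 low (kb cS SD) aeJ ii.
have [m1 m2] := measurable_cauchy_parts.
have r5 := integrable_real_test oD ir T1; have r6 := integrable_real_test oD ir T2.
have i5 := integrable_real_test oD ii T1; have i6 := integrable_real_test oD ii T2.
have mI (f g a b : R * R -> R) : measurable_fun D f -> measurable_fun D g ->
    measurable_fun D a -> measurable_fun D b ->
    measurable_fun D (fun p => f p * a p + g p * b p) /\
    measurable_fun D (fun p => f p * a p - g p * b p).
  move=> ? ? ? ?; split; first by apply: measurable_funD; apply: measurable_funM.
  by apply: measurable_funB; apply: measurable_funM.
have rD := integrableD mD r3 r2; have iB := integrableB mD i1 i4.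
have iD := integrableD mD i3 i2; have rB := integrableB mD r1 r4.
have eq1 : {ae leb2, forall p, D p -> I2 p * h1 p + I1 p * h2 p =
    (F2 fr p * h1 p + F1 fr p * h2 p) + (F1 fi p * h1 p - F2 fi p * h2 p)}.
  move: cauchy_integrable_ae; apply: (filterS (F := almost_everywhere leb2)) => p h Dp.
  by have [_ _ -> ->] := h Dp; ring.
have eq2 : {ae leb2, forall p, D p -> I2 p * h2 p - I1 p * h1 p =
    (F2 fi p * h1 p + F1 fi p * h2 p) - (F1 fr p * h1 p - F2 fr p * h2 p)}.
  move: cauchy_integrable_ae; apply: (filterS (F := almost_everywhere leb2)) => p h Dp.
  by have [_ _ -> ->] := h Dp; ring.
have M1 := (mI _ _ _ _ m2 m1 mh1 mh2).1; have M2 := (mI _ _ _ _ m2 m1 mh2 mh1).2.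
have i_1 := integrableD mD rD iB; have i_2 := integrableB mD iD rB.
split.
- exact: ae_integrableR mD M1 i_1 eq1.
- exact: ae_integrableR mD M2 i_2 eq2.
- rewrite (ae_eq_Rintegral mD M1 ((measurable_EFinP _ _).1 (measurable_int _ i_1)) eq1).
  by rewrite RintegralD// ra ib RintegralB//; ring.
rewrite (ae_eq_Rintegral mD M2 ((measurable_EFinP _ _).1 (measurable_int _ i_2)) eq2).
by rewrite RintegralB// ia rb RintegralD//; ring.
Qed.

End Pair.
End CauchyTransform.
Local Open Scope complex_scope.

(** * The equation L (T_Z f) = f *)

Section ComplexParts.
Context {R : realType}.
Local Notation leb2 := (@lebesgue_measure R \x @lebesgue_measure R)%E.
Implicit Types (p q : R * R) (Z f : R * R -> R[i]).

Lemma re_cauchy_integrand Z f p q :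
  re_part (cauchy_integrand Z f p) q =
  re_part f q * ck1 (re_part Z) (im_part Z) (q, p) -
  im_part f q * ck2 (re_part Z) (im_part Z) (q, p).
Proof.
rewrite /re_part /im_part /cauchy_integrand /ck1 /ck2 /=.
by case: (f q) => a b; case: (Z q) => c d; case: (Z p) => c' d' /=; ring.
Qed.

Lemma im_cauchy_integrand Z f p q :
  im_part (cauchy_integrand Z f p) q =
  re_part f q * ck2 (re_part Z) (im_part Z) (q, p) +
  im_part f q * ck1 (re_part Z) (im_part Z) (q, p).
Proof.
rewrite /re_part /im_part /cauchy_integrand /ck1 /ck2 /=.
by case: (f q) => a b; case: (Z q) => c d; case: (Z p) => c' d' /=; ring.
Qed.

Lemma inv_2pi_i (a b : R) : (2 * (pi : R)%:C * 'i)^-1 * (a +i* b) =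
  ((2 * pi)^-1 * b) +i* (- ((2 * pi)^-1 * a)).
Proof.
have pi0 : (pi : R) != 0 by rewrite gt_eqF// pi_gt0.
have -> : 2 * (pi : R)%:C * 'i = 0 +i* (2 * pi).
  by apply/eqP; rewrite eq_complex /=; apply/andP; split; apply/eqP; ring.
have t0 : 2 * (pi : R) != 0 by rewrite mulf_neq0.
move: (2 * pi) t0 => t t0.
apply/eqP; rewrite eq_complex /=; apply/andP; split; apply/eqP; rewrite expr0n /= add0r; field; exact: t0.
Qed.

End ComplexParts.

Theorem theorem13 (R : realType) (tOmega Omega : set (R * R))
    (A B Z Zx Zy f : R * R -> R[i])
    (tOmega_open : open tOmega)
    (AB_hoelder : exists2 a : R, 0 < a &
       hoelder_onC a tOmega A /\ hoelder_onC a tOmega B)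
    (AB_neq0 : forall p, tOmega p -> 0 < `|A p| + `|B p|)
    (Omega_open : open Omega)
    (Omega_compact : compact (closure Omega))
    (Omega_sub : closure Omega `<=` tOmega)
    (Omega_boundary : piecewise_C1_boundary Omega)
    (L_hypocomplex : hypocomplex_on tOmega (closure Omega) A B)
    (Sigma_curve : nontangent_curve tOmega (closure Omega)
       (char_set Omega A B) A B)
    (Sigma_order : finite_order_along tOmega (closure Omega)
       (char_set Omega A B) A B)
    (Sigma_components : finitely_many_components (char_set Omega A B))
    (Z_C1 : C1_plus_closureC Omega Z Zx Zy)
    (Z_homeo : homeomorphism_onto_image (closure Omega) Z)
    (Z_LZ : forall p, closure Omega p -> A p * Zx p + B p * Zy p = 0)
    (Z_dZ : forall p, closure Omega p -> (Zx p, Zy p) != (0, 0))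
    (L_normalized : forall p, closure Omega p -> A p = - Zy p /\ B p = Zx p)
    (Z_orientation : orientation_preserving_on Omega Zx Zy)
    (f_L1 : integrableC Omega f) :
  T_op_defined_ae Z Omega f /\ weak_solution Omega A B (T_op Z Omega f) f.
Proof.
have [eps eps0 [Hu Hv]] := Z_C1.
have Cu := C1_hoelder_closure_C1on eps0 Omega_open Hu.
have Cv := C1_hoelder_closure_C1on eps0 Omega_open Hv.
have DC : Omega `<=` closure Omega := @subset_closure _ Omega.
have [Mu HMu] := C1_hoelder_closure_bounded eps0 Omega_compact Hu.
have [Mv HMv] := C1_hoelder_closure_bounded eps0 Omega_compact Hv.
have [d Hd] := compact_diameter Omega_compact.
set u := re_part Z in Cu Hu HMu; set v := im_part Z in Cv Hv HMv.
have J0 p : Omega p -> 0 <= jac Zx Zy p.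
  by move=> /Z_orientation; rewrite /jac (mulrC (re_part Zy p)).
have cu p : Omega p -> {for p, continuous u} by exact: C1on_continuous Omega_open Cu.
have cv p : Omega p -> {for p, continuous v} by exact: C1on_continuous Omega_open Cv.
have inj p0 : Omega p0 -> forall e : R, 0 < e -> exists2 h : R, 0 < h &
    forall q, Omega q -> dist1 u v q p0 < h -> `|q - p0| < e.
  move=> Dp e e0; have [h h0 H] := homeomorphism_inverse_continuous Z_homeo (DC _ Dp) e0.
  by exists h => // q Dq; exact: H (DC _ Dq).
have kb S : compact S -> S `<=` Omega -> kernel_bounded_on u v Omega S.
  apply: kernel_bounded_compact => // p0 Dp.
  exact: kernel_bounded_everywhere Omega_open L_normalized Sigma_curve Sigma_order Cu Cv J0 _ Dp.
have aeJ := ae_jac_gt0 Omega_open L_normalized Sigma_curve Sigma_order Cu Cv J0.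
have mD : @measurable _ (measurableTypeR R * measurableTypeR R)%type Omega.
  exact: open_measurable_plane.
have Dfin := bounded_leb2 mD Omega_compact.
have low q : Omega q -> 0 < jac Zx Zy q -> exists2 c : R, 0 < c & forall p, Omega p ->
    c * ((p.1 - q.1) ^+ 2 + (p.2 - q.2) ^+ 2) <= (u p - u q) ^+ 2 + (v p - v q) ^+ 2.
  move=> Dq Jq; apply: (lower_quadratic Omega_open Dq Cu Cv _ (D := d) _ (inj q Dq)).
    by rewrite gt_eqF.
  by move=> p Dp; apply: Hd; exact: DC.
have [ir ii] := f_L1.
have E1 p : re_part (cauchy_integrand Z f p) =
    (fun q => re_part f q * ck1 u v (q, p) - im_part f q * ck2 u v (q, p)).
  by apply/funext => q; exact: re_cauchy_integrand.
have E2 p : im_part (cauchy_integrand Z f p) =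
    (fun q => re_part f q * ck2 u v (q, p) + im_part f q * ck1 u v (q, p)).
  by apply/funext => q; exact: im_cauchy_integrand.
have aeI := cauchy_integrable_ae Omega_open cu cv kb ir ii.
pose G1 p := \int[(@lebesgue_measure R \x @lebesgue_measure R)%E]_(q in Omega)
  (re_part f q * ck1 u v (q, p) - im_part f q * ck2 u v (q, p)).
pose G2 p := \int[(@lebesgue_measure R \x @lebesgue_measure R)%E]_(q in Omega)
  (re_part f q * ck2 u v (q, p) + im_part f q * ck1 u v (q, p)).
have TE p : T_op Z Omega f p = ((2 * pi)^-1 * G2 p) +i* (- ((2 * pi)^-1 * G1 p)).
  by rewrite /T_op /integralC E1 E2 inv_2pi_i.
have reT : re_part (T_op Z Omega f) = (fun p => (2 * pi)^-1 * G2 p).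
  by apply/funext => p; rewrite /re_part TE.
have imT : im_part (T_op Z Omega f) = (fun p => - (2 * pi)^-1 * G1 p).
  by apply/funext => p; rewrite /im_part TE /= mulNr.
split.
  move: aeI; apply: (filterS (F := almost_everywhere _)) => p h Dp.
  by have [i1 i2 _ _] := h Dp; rewrite /integrableC E1 E2.
split.
  move=> K cK KD; have mK : @measurable _ (measurableTypeR R * measurableTypeR R)%type K.
    exact: compact_measurable_plane.
  have [i1 i2] := cauchy_parts_integrable Omega_open cu cv kb ir ii cK KD.
  rewrite /integrableC reT imT; split.
    exact: (integrableZl mK (2 * pi)^-1 i2).
  exact: (integrableZl mK (- (2 * pi)^-1) i1).
move=> phi tphi; have [S [cS SD] [[T1 T2] _]] := test_function_real tphi.
pose M := Num.max Mu Mv.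
have uM p : Omega p -> [/\ `|u p| <= M, `|re_part Zx p| <= M & `|re_part Zy p| <= M].
  by move=> /DC/HMu[? ? ?]; rewrite /M; split; rewrite le_max; apply/orP; left.
have vM p : Omega p -> [/\ `|v p| <= M, `|im_part Zx p| <= M & `|im_part Zy p| <= M].
  by move=> /DC/HMv[? ? ?]; rewrite /M; split; rewrite le_max; apply/orP; right.
have [iW1 iW2 W1 W2] := weak_pair Omega_open cu cv kb ir ii Dfin cS SD Cu Cv uM vM T1 T2 low aeJ.
have LE p : Omega p -> vfield A B phi p =
   lphi1 (re_part Zx) (re_part Zy) (im_part Zx) (im_part Zy)
     (dx (re_part phi)) (dy (re_part phi)) (dx (im_part phi)) (dy (im_part phi)) p +i*
   lphi2 (re_part Zx) (re_part Zy) (im_part Zx) (im_part Zy)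
     (dx (re_part phi)) (dy (re_part phi)) (dx (im_part phi)) (dy (im_part phi)) p.
  move=> /DC/L_normalized[hA hB]; rewrite /vfield hA hB /lphi1 /lphi2 /cdx /cdy.
  move: (dx (re_part phi) p) (dy (re_part phi) p) (dx (im_part phi) p) (dy (im_part phi) p).
  move=> a b a' b'; rewrite /re_part /im_part; case: (Zx p) => c1 c2; case: (Zy p) => e1 e2 /=.
  by apply/eqP; rewrite eq_complex /=; apply/andP; split; apply/eqP; ring.
have pi0 : 2 * (pi : R) != 0 by rewrite mulf_neq0// gt_eqF// pi_gt0.
set h1 := lphi1 _ _ _ _ _ _ _ _ in iW1 iW2 W1 W2 LE; set h2 := lphi2 _ _ _ _ _ _ _ _ in iW1 iW2 W1 W2 LE.
have R1 : \int[(@lebesgue_measure R \x @lebesgue_measure R)%E]_(p in Omega)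
    re_part (fun p => T_op Z Omega f p * vfield A B phi p) p =
    (2 * pi)^-1 * \int[(@lebesgue_measure R \x @lebesgue_measure R)%E]_(p in Omega)
    (G2 p * h1 p + G1 p * h2 p).
  rewrite -RintegralZl//.
  apply: eq_Rintegral => p /set_mem Dp.
  by rewrite /re_part TE LE//=; ring.
have R2 : \int[(@lebesgue_measure R \x @lebesgue_measure R)%E]_(p in Omega)
    im_part (fun p => T_op Z Omega f p * vfield A B phi p) p =
    (2 * pi)^-1 * \int[(@lebesgue_measure R \x @lebesgue_measure R)%E]_(p in Omega)
    (G2 p * h2 p - G1 p * h1 p).
  rewrite -RintegralZl//.
  apply: eq_Rintegral => p /set_mem Dp.
  by rewrite /im_part TE LE//=; ring.
rewrite /integralC R1 R2 W1 W2 !mulrN !mulKf//.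
have e1 : re_part (fun p => f p * phi p) =
    (fun p => re_part f p * re_part phi p - im_part f p * im_part phi p).
  by apply/funext => p; rewrite /re_part /im_part; case: (f p) => ? ?; case: (phi p).
have e2 : im_part (fun p => f p * phi p) =
    (fun p => re_part f p * im_part phi p + im_part f p * re_part phi p).
  by apply/funext => p; rewrite /re_part /im_part; case: (f p) => ? ?; case: (phi p).
rewrite e1 e2; apply/eqP; rewrite eq_complex /= !opprK; apply/andP; split => //.
Qed.
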